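(* Let $\Omega\subset\mathbb{R}^3$ be a nonempty open bounded convex set with $C^2$ boundary, let $\lambda_0,\mu_0,\rho_0>0$, $d_0>0$, $0<m_0\le M_0$, $t_0>0$, and let $B_{r_0}(\bar x)\subset\mathbb{R}^3\setminus\overline{\Omega}$ be an open ball of radius $r_0>0$. Let $q$ be a real-valued function such that $x\mapsto q(|x|)$ belongs to $C^2_0(\Omega)$, $\operatorname{supp} q\subset[-\tfrac{d_0}{2},\tfrac{d_0}{2}]$ and $\int_{\mathbb{R}^3}q(|x|)\,dx=1$. Then there is a constant $C>0$, depending on $M_0,m_0,d_0,\lambda_0,\mu_0,\rho_0$ and $t_0$ (with $\Omega$, $q$ and $B_{r_0}(\bar x)$ fixed), such that the following holds. Let $M^{(1)},M^{(2)}$ be real $3\times 3$ matrices that are nonzero, symmetric, with vanishing trace, and satisfy $m_0\le|M^{(j)}|\le M_0$ for $j=1,2$; let $P^{(1)},P^{(2)}\in\Omega_{d_0}$; and set $$\mathbf{f}^{(j)}(x)=-M^{(j)}\nabla\big(q(|x-P^{(j)}|)\big),\qquad j=1,2.$$ Let $(\mathbf{u}^{(j)},S^{(j)})$, $j=1,2$, be the (weak) solutions of the elasto-gravitational system (described in the context) with source $\mathbf{f}=\mathbf{f}^{(j)}$ and constant coefficients $\lambda_0,\mu_0,\rho_0$. If $$\|\nabla S^{(1)}(\cdot,t)-\nabla S^{(2)}(\cdot,t)\|_{L^2(B_{r_0}(\bar x))}\le\varepsilon\quad\text{for all }t\in[0,t_0],$$ then $$|P^{(1)}-P^{(2)}|+|M^{(1)}-M^{(2)}|\le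 C\varepsilon.$$
   Context: For $h>0$, $\Omega_h:=\{x\in\Omega:\operatorname{dist}(x,\partial\Omega)>h\}$. For a matrix $A$, $|A|=\sqrt{A\cdot A}$ with $A\cdot B=A_{ij}B_{ij}$ (summation over repeated indices). The function $x\mapsto q(|x|)$ is extended by zero to $\mathbb{R}^3$. The isotropic stiffness tensor is $C_{ijk\ell}=\lambda_0\delta_{ij}\delta_{k\ell}+\mu_0(\delta_{ik}\delta_{j\ell}+\delta_{i\ell}\delta_{jk})$, acting on matrices by $(\mathbb{C}A)_{ij}=C_{ijk\ell}A_{k\ell}$. Elasto-gravitational system with source $\mathbf{f}\in H^1(\Omega,\mathbb{R}^3)$ (independent of $t$): first, $\mathbf{u}=\mathbf{u}(x,t)$ is the solution of $$\rho_0\mathbf{u}_{tt}-\operatorname{div}(\mathbb{C}\nabla\mathbf{u})=\mathbf{f}\ \text{ in }\Omega\times[0,\infty),\qquad(\mathbb{C}\nabla\mathbf{u})\cdot\nu=0\ \text{ on }\partial\Omega\times[0,\infty),\qquad\mathbf{u}(x,0)=\mathbf{u}_t(x,0)=0\ \text{ in }\Omega,$$ where $\nu$ is the outward normal to $\partial\Omega$, with $\mathbf{u}\in C([0,\infty);H^2(\Omega,\mathbb{R}^3))$, $\mathbf{u}_t\in C([0,\infty);H^1(\Omega,\mathbb{R}^3))$, $\mathbf{u}_{tt}\in C([0,\infty);L^2(\Omega,\mathbb{R}^3))$. Second, for each $t\ge0$, $S(\cdot,t)$ is the weak solution of the transmission problem for the gravitational potential ($\Delta S=-\rho_0\operatorname{div}\mathbf{u}$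 in $\Omega$, $\Delta S=0$ in $\mathbb{R}^3\setminus\overline\Omega$, with transmission conditions on $\partial\Omega$ and $S\to0$ at infinity), that is, the unique $S(\cdot,t)\in H^1(\mathbb{R}^3)$ with $$\int_{\mathbb{R}^3}\nabla S(\cdot,t)\cdot\nabla\phi\,dx=-\int_\Omega\rho_0\,\mathbf{u}(\cdot,t)\cdot\nabla\phi\,dx\qquad\forall\phi\in H^1(\mathbb{R}^3).$$ *)

(* Defs.v *)
From HB Require Import structures.
From mathcomp Require Import all_boot all_order all_algebra.
From mathcomp Require Import all_classical all_reals all_analysis.

Set Implicit Arguments.
Unset Strict Implicit.
Unset Printing Implicit Defensive.

Import Order.TTheory GRing.Theory Num.Theory numFieldNormedType.Exports.

Local Open Scope classical_set_scope.
Local Open Scope ring_scope.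

(* The library norm on matrices is the sup norm: it is used for the topology
   only, and every metric notion below goes through [enorm].                 *)
Definition enorm (R : realType) (n : nat) (x : 'cV[R]_n) : R :=
  Num.sqrt (\sum_i x i 0 ^+ 2).

Definition fnorm (R : realType) (n : nat) (A : 'M[R]_n) : R :=
  Num.sqrt (\sum_i \sum_j A i j * A i j).

Definition eball (R : realType) (c : 'cV[R]_3) (r : R) : set 'cV[R]_3 :=
  [set x | enorm (x - c) < r].

Definition frontier (R : realType) (U : set 'cV[R]_3) : set 'cV[R]_3 :=
  closure U `\` interior U.

Definition euclid_dist (R : realType) (x : 'cV[R]_3) (A : set 'cV[R]_3) : R :=
  inf [set enorm (x - y) | y in A].

Definition inner_domain (R : realType) (U : set 'cV[R]_3) (h : R) :
    set 'cV[R]_3 :=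
  [set x | U x /\ h < euclid_dist x (frontier U)].

Definition partial (R : realType) (n : nat) (i : 'I_n.+1)
    (f : 'cV[R]_n.+1 -> R) : 'cV[R]_n.+1 -> R :=
  fun x => 'D_(delta_mx i 0) f x.

Definition grad (R : realType) (n : nat) (f : 'cV[R]_n.+1 -> R)
    (x : 'cV[R]_n.+1) : 'cV[R]_n.+1 :=
  \col_i partial i f x.

Fixpoint Ck (R : realType) (n : nat) (k : nat) (f : 'cV[R]_n.+1 -> R) : Prop :=
  match k with
  | 0 => continuous f
  | k'.+1 => continuous f /\
      forall i : 'I_n.+1,
        (forall x, derivable f x (delta_mx i 0)) /\ Ck k' (partial i f)
  end.

Definition compact_supp_in (R : realType) (U : set 'cV[R]_3)
    (f : 'cV[R]_3 -> R) : Prop :=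
  compact (closure [set x | f x != 0]) /\ closure [set x | f x != 0] `<=` U.

Definition Ck_c (R : realType) (k : nat) (U : set 'cV[R]_3)
    (f : 'cV[R]_3 -> R) : Prop :=
  Ck k f /\ compact_supp_in U f.

Definition test_function (R : realType) (U : set 'cV[R]_3)
    (f : 'cV[R]_3 -> R) : Prop :=
  (forall k, Ck k f) /\ compact_supp_in U f.

(* After a rigid motion, U is locally the strict epigraph of a C^2 function of
   the first two coordinates.                                                *)
Definition C2_boundary (R : realType) (U : set 'cV[R]_3) : Prop :=
  forall x, frontier U x ->
    exists (A : 'M[R]_3) (r : R) (psi : 'cV[R]_2 -> R),
      [/\ A *m A^T = 1%:M, 0 < r, Ck 2 psi &
        forall y : 'cV[R]_3, enorm (y - x) < r ->
          let z : 'cV[R]_(2 + 1) := A *m (y - x) in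
          (U y <-> psi (usubmx z) < dsubmx z 0 0)].

(* The library has no measurable structure on column vectors, so integration on
   'cV[R]_3 is integration of the pullback along [vec3] against the triple
   product of the Lebesgue measure.                                          *)
Definition vec3 (R : realType)
    (p : measurableTypeR R * measurableTypeR R * measurableTypeR R) :
    'cV[R]_3 :=
  \col_i [:: p.1.1; p.1.2; p.2]`_i.

Definition leb3 (R : realType) :
    {measure set (measurableTypeR R * measurableTypeR R * measurableTypeR R)
       -> \bar R} :=
  ((@lebesgue_measure R \x @lebesgue_measure R) \x @lebesgue_measure R)%E.

Definition measurable_on (R : realType) (U : set 'cV[R]_3)
    (f : 'cV[R]_3 -> R) : Prop :=
  measurable_fun (@vec3 R @^-1` U) (fun p => f (vec3 p) : measurableTypeR R).

Definition eint3 (R : realType) (U : set 'cV[R]_3) (f : 'cV[R]_3 -> R) :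
    \bar R :=
  (\int[@leb3 R]_(p in @vec3 R @^-1` U) (f (vec3 p))%:E)%E.

Definition int3 (R : realType) (U : set 'cV[R]_3) (f : 'cV[R]_3 -> R) : R :=
  \int[@leb3 R]_(p in @vec3 R @^-1` U) f (vec3 p).

Definition ae_on (R : realType) (U : set 'cV[R]_3) (P : 'cV[R]_3 -> Prop) :
    Prop :=
  {ae @leb3 R, forall p, U (vec3 p) -> P (vec3 p)}.

Definition L2 (R : realType) (U : set 'cV[R]_3) (f : 'cV[R]_3 -> R) : Prop :=
  measurable_on U f /\ (eint3 U (fun x => (f x) ^+ 2)%R < +oo)%E.

Definition L1loc (R : realType) (U : set 'cV[R]_3) (f : 'cV[R]_3 -> R) : Prop :=
  measurable_on U f /\
  forall K, compact K -> K `<=` U -> (eint3 K (fun x => `|f x|%R) < +oo)%E.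

Definition L2norm (R : realType) (U : set 'cV[R]_3)
    (F : 'cV[R]_3 -> 'cV[R]_3) : R :=
  Num.sqrt (int3 U (fun x => enorm (F x) ^+ 2)).

Definition is_wderiv (R : realType) (U : set 'cV[R]_3) (i : 'I_3)
    (f g : 'cV[R]_3 -> R) : Prop :=
  [/\ L1loc U f, L1loc U g &
    forall phi, test_function U phi ->
      int3 U (fun x => f x * partial i phi x)
      = - int3 U (fun x => g x * phi x)].

(* A representative of the weak derivative on U, meaningful when there is one;
   it is then unique up to null subsets of U, and arbitrary outside U.       *)
Definition wderiv (R : realType) (U : set 'cV[R]_3) (i : 'I_3)
    (f : 'cV[R]_3 -> R) : 'cV[R]_3 -> R :=
  xget (fun=> 0) [set g | is_wderiv U i f g].

Fixpoint Hk (R : realType) (U : set 'cV[R]_3) (k : nat)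
    (f : 'cV[R]_3 -> R) : Prop :=
  match k with
  | 0 => L2 U f
  | k'.+1 => L2 U f /\
      forall i, (exists g, is_wderiv U i f g) /\ Hk U k' (wderiv U i f)
  end.

Fixpoint Hk_sqnorm (R : realType) (U : set 'cV[R]_3) (k : nat)
    (f : 'cV[R]_3 -> R) : R :=
  int3 U (fun x => f x ^+ 2) +
  match k with
  | 0 => 0
  | k'.+1 => \sum_i Hk_sqnorm U k' (wderiv U i f)
  end.

Definition HkV (R : realType) (U : set 'cV[R]_3) (k : nat)
    (F : 'cV[R]_3 -> 'cV[R]_3) : Prop :=
  forall i, Hk U k (fun x => F x i 0).

Definition HkV_norm (R : realType) (U : set 'cV[R]_3) (k : nat)
    (F : 'cV[R]_3 -> 'cV[R]_3) : R :=
  Num.sqrt (\sum_i Hk_sqnorm U k (fun x => F x i 0)).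

Definition wgrad (R : realType) (U : set 'cV[R]_3) (f : 'cV[R]_3 -> R)
    (x : 'cV[R]_3) : 'cV[R]_3 :=
  \col_i wderiv U i f x.

Definition wjac (R : realType) (U : set 'cV[R]_3)
    (F : 'cV[R]_3 -> 'cV[R]_3) (x : 'cV[R]_3) : 'M[R]_3 :=
  \matrix_(i, j) wderiv U j (fun y => F y i 0) x.

Definition wdiv (R : realType) (U : set 'cV[R]_3)
    (F : 'cV[R]_3 -> 'cV[R]_3) (x : 'cV[R]_3) : R :=
  \sum_j wderiv U j (fun y => F y j 0) x.

Definition wdiv_mx (R : realType) (U : set 'cV[R]_3)
    (G : 'cV[R]_3 -> 'M[R]_3) (x : 'cV[R]_3) : 'cV[R]_3 :=
  \col_i wdiv U (fun y => (row i (G y))^T) x.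

Definition dot (R : realType) (n : nat) (x y : 'cV[R]_n) : R :=
  \sum_i x i 0 * y i 0.

(* The normal trace F.nu on the boundary, as a functional on (traces of)
   functions phi in H^1(U): by Green's formula it is the integral over the
   boundary of (F.nu) phi when F is in H^1(U).                               *)
Definition normal_trace (R : realType) (U : set 'cV[R]_3)
    (F : 'cV[R]_3 -> 'cV[R]_3) (phi : 'cV[R]_3 -> R) : R :=
  int3 U (fun x => dot (F x) (wgrad U phi x) + wdiv U F x * phi x).

Definition normal_trace_eq0 (R : realType) (U : set 'cV[R]_3)
    (G : 'cV[R]_3 -> 'M[R]_3) : Prop :=
  forall i phi, Hk U 1 phi ->
    normal_trace U (fun x => (row i (G x))^T) phi = 0.

Definition C0_Hk (R : realType) (U : set 'cV[R]_3) (k : nat)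
    (u : R -> 'cV[R]_3 -> 'cV[R]_3) : Prop :=
  forall t, 0 <= t ->
    HkV U k (u t) /\
    HkV_norm U k (fun x => u s x - u t x) @[s --> within [set s | 0 <= s] (nbhs t)]
      --> (0 : R).

(* [v] is the derivative of [u] on [0, +oo[ as an L^2(U)-valued function
   (one-sided at 0).                                                         *)
Definition time_deriv (R : realType) (U : set 'cV[R]_3)
    (u v : R -> 'cV[R]_3 -> 'cV[R]_3) : Prop :=
  forall t, 0 <= t ->
    L2norm U (fun x => (s - t)^-1 *: (u s x - u t x) - v t x)
      @[s --> within [set s | 0 <= s] t^'] --> (0 : R).

Definition stiffness (R : realType) (lambda0 mu0 : R) (i j k l : 'I_3) : R :=
  lambda0 * (i == j)%:R * (k == l)%:R
  + mu0 * ((i == k)%:R * (j == l)%:R + (i == l)%:R * (j == k)%:R).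

Definition stiff_mul (R : realType) (lambda0 mu0 : R) (A : 'M[R]_3) : 'M[R]_3 :=
  \matrix_(i, j) \sum_k \sum_l stiffness lambda0 mu0 i j k l * A k l.

Definition elastic_solution (R : realType) (Om : set 'cV[R]_3)
    (lambda0 mu0 rho0 : R) (f : 'cV[R]_3 -> 'cV[R]_3)
    (u : R -> 'cV[R]_3 -> 'cV[R]_3) : Prop :=
  let stress t x := stiff_mul lambda0 mu0 (wjac Om (u t) x) in
  exists ut utt : R -> 'cV[R]_3 -> 'cV[R]_3,
    [/\ [/\ C0_Hk Om 2 u, C0_Hk Om 1 ut & C0_Hk Om 0 utt],
        time_deriv Om u ut /\ time_deriv Om ut utt,
        forall t, 0 <= t ->
          ae_on Om (fun x => rho0 *: utt t x - wdiv_mx Om (stress t) x = f x),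
        forall t, 0 <= t -> normal_trace_eq0 Om (stress t) &
        ae_on Om (fun x => u 0 x = 0) /\ ae_on Om (fun x => ut 0 x = 0)].

Definition gravity_solution (R : realType) (Om : set 'cV[R]_3) (rho0 : R)
    (u : R -> 'cV[R]_3 -> 'cV[R]_3) (S : R -> 'cV[R]_3 -> R) : Prop :=
  forall t, 0 <= t ->
    Hk setT 1 (S t) /\
    forall phi, Hk setT 1 phi ->
      int3 setT (fun x => dot (wgrad setT (S t) x) (wgrad setT phi x))
      = - int3 Om (fun x => rho0 * dot (u t x) (wgrad setT phi x)).

Definition elasto_gravitational_solution (R : realType) (Om : set 'cV[R]_3)
    (lambda0 mu0 rho0 : R) (f : 'cV[R]_3 -> 'cV[R]_3)
    (u : R -> 'cV[R]_3 -> 'cV[R]_3) (S : R -> 'cV[R]_3 -> R) : Prop :=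
  elastic_solution Om lambda0 mu0 rho0 f u /\ gravity_solution Om rho0 u S.

Definition moment_source (R : realType) (q : R -> R) (M : 'M[R]_3)
    (P : 'cV[R]_3) (x : 'cV[R]_3) : 'cV[R]_3 :=
  - (M *m grad (fun y => q (enorm (y - P))) x).

Definition admissible_moment (R : realType) (m0 M0 : R) (M : 'M[R]_3) : Prop :=
  [/\ M != 0, M^T = M, \tr M = 0 & m0 <= fnorm M <= M0].

(* Main.v *)
Require Import Defs.
From HB Require Import structures.
From mathcomp Require Import all_boot all_order all_algebra.
From mathcomp Require Import all_classical all_reals all_analysis.
From mathcomp Require Import ring lra measurable_realfun.

Set Implicit Arguments.
Unset Strict Implicit.
Unset Printing Implicit Defensive.

Import Order.TTheory GRing.Theory Num.Theory numFieldNormedType.Exports.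

Local Open Scope classical_set_scope.
Local Open Scope ring_scope.


(** Write [u], [S] and [f] for the differences of the two displacements, the two
    potentials and the two sources, and [e] for [P1 - P2].  The proof probes [f]
    with gradients of functions [psi] that are harmonic on the domain, namely
    first and second derivatives of the Newtonian potential [1 / |x - a|] with
    a pole [a] in the ball of measurements.

    Gravity gives the moments of the displacement.  Testing the equation of the
    potential with a derivative of a test function [phi], and exchanging
    derivatives, yields
      rho int_Om u . grad (d_i phi) = - int d_i S (Laplacian phi)
    ([gravity_identity]).  Let [phi] be the Newtonian potential, or a derivative
    of it, smoothed near its pole and cut off at a large distance [r].  Its
    Laplacian has one part near the pole, in the ball where [grad S] is
    measured, and one part at distance [r], which disappears as [r] grows.  So
    the integral of [u(t) . grad psi] is bounded by a multiple of the
    measurement error, at every time ([gravity_bound], [measurement_bound]).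

    Short times turn displacement into source.  The second derivative in time of
    [rho int u . G] is [int f . G] minus the integral of the stress against the
    gradient of [G].  The stress is bounded by the square root of the elastic
    energy, and the energy by [t] times the squared norm of [f].  Integrating
    twice, [rho int u(T) . G] equals [T^2 / 2] times [int f . G] up to
    an error which, divided by [T^2 / 2], is of size [sqrt T |f|]
    ([elastic_source_bound]).

    Harmonicity removes the profile of the source.  The profile is radial with
    integral 1, so by the mean value property a smeared moment acts on [grad psi]
    like the point moment: [int f^(j) . grad psi = M^(j) : Hessian psi (P^(j))]
    ([source_pairing]).  For the chosen [psi] these numbers are the first and
    second derivatives at [y = P^(j) - a] of [3 (M^(j) y . y) / |y|^5]
    ([contract_pole1], [contract_pole2]).

    It remains to recover [(P, M)] stably from such derivatives, known for all
    [a] in a ball ([pole_stability]).  Homogeneity (Euler's identity) shows that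
    if the derivatives for the two sources are close, then the derivative of the
    field of the first source in the direction [e] is small.  Up to a power of
    [|y|] this derivative is a cubic form in [y]; being small on a ball it has
    small coefficients, and these control [|M| |e|].  With [|M|] bounded below
    [e] is small, and then so is [M1 - M2].

    Altogether [|e| + |M1 - M2|] is at most a multiple of the measurement error
    plus a multiple of [sqrt T |f|].  Since [|f|] is itself at most a multiple of
    [|e| + |M1 - M2|] ([moment_source_lipschitz]), a fixed small [T] lets the last
    term be absorbed.

    The weak formulations are reached through the fundamental lemma of the
    calculus of variations, which identifies weak and classical derivatives of
    smooth functions ([wderiv_C1]), and through the divergence theorem for
    compactly supported functions ([int3_partial_eq0]). *)

(** * Smooth functions of one real variable *)

Section OneVariable.
Context {R : realType}.
Implicit Types (f g h : R -> R) (x : R) (k n : nat).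

(** Regularity in one variable, in the form that composes with [Ck]. *)
Fixpoint C1k k h : Prop :=
  match k with
  | 0 => continuous h
  | k'.+1 => (forall x, derivable h x 1) /\ C1k k' (derive1 h)
  end.

Definition smooth h := forall k, C1k k h.

Lemma derivable_continuous h : (forall x, derivable h x 1) -> continuous h.
Proof. by move=> dh x; apply/differentiable_continuous/derivable1_diffP. Qed.

Lemma C1k_continuous k h : C1k k h -> continuous h.
Proof. by case: k => //= k [dh _]; exact: derivable_continuous. Qed.

Lemma C1k_le k h : C1k k.+1 h -> C1k k h.
Proof.
elim: k h => [|k IH] h; first by case=> dh _; exact: derivable_continuous.
by case=> dh /IH.
Qed.

Lemma derive1_is_derive h h' :
  (forall x, is_derive x 1 h (h' x)) -> (derive1 h) = h'.
Proof. by move=> H; apply/funext => x; rewrite derive1E; apply: derive_val. Qed.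

Lemma C1kS_is_derive k h h' :
  (forall x, is_derive x 1 h (h' x)) -> C1k k h' -> C1k k.+1 h.
Proof. by move=> H Hk; split => [x|]; [exact: ex_derive|rewrite (derive1_is_derive H)]. Qed.

Lemma C1kS_derive k h : C1k k.+1 h -> forall x, is_derive x 1 h ((derive1 h) x).
Proof. by case=> dh _ x; rewrite derive1E; apply: DeriveDef. Qed.

Lemma C1k_cst k (c : R) : C1k k (fun=> c).
Proof.
elim: k c => [|k IH] c; first exact: cst_continuous.
by apply: (@C1kS_is_derive _ _ (fun=> 0)) => // x; exact: is_derive_cst.
Qed.

Lemma C1k_id k : C1k k id.
Proof.
case: k => [|k]; first by move=> x.
by apply: (@C1kS_is_derive _ _ (fun=> 1)); exact: C1k_cst.
Qed.

Lemma C1kD k f g : C1k k f -> C1k k g -> C1k k (fun x => f x + g x).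
Proof.
elim: k f g => [|k IH] f g Hf Hg; first by move=> x; apply: cvgD; [exact: Hf|exact: Hg].
apply: (@C1kS_is_derive _ _ (fun x => (derive1 f) x + (derive1 g) x)).
  by move=> x; exact: (is_deriveD (C1kS_derive Hf x) (C1kS_derive Hg x)).
by apply: IH; [case: Hf|case: Hg].
Qed.

Lemma C1kM k f g : C1k k f -> C1k k g -> C1k k (fun x => f x * g x).
Proof.
elim: k f g => [|k IH] f g Hf Hg; first by move=> x; apply: cvgM; [exact: Hf|exact: Hg].
apply: (@C1kS_is_derive _ _ (fun x => f x * (derive1 g) x + g x * (derive1 f) x)).
  by move=> x; have := is_deriveM (C1kS_derive Hf x) (C1kS_derive Hg x).
by apply: C1kD; apply: IH; do ?[exact: C1k_le|by case: Hf|by case: Hg].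
Qed.

Lemma C1kZ k (c : R) f : C1k k f -> C1k k (fun x => c * f x).
Proof. by apply: C1kM; exact: C1k_cst. Qed.

Lemma C1kN k f : C1k k f -> C1k k (fun x => - f x).
Proof.
by move=> /(C1kZ (-1)); rewrite (_ : (fun _ => -1 * _) = (fun x => - f x))//;
  apply/funext => x; rewrite mulN1r.
Qed.

Lemma C1k_comp k f g : C1k k f -> C1k k g -> C1k k (fun x => f (g x)).
Proof.
elim: k f g => [|k IH] f g Hf Hg.
  by move=> x; apply: (@continuous_comp _ _ _ g f); [exact: Hg|exact: Hf].
apply: (@C1kS_is_derive _ (fun x => f (g x)) (fun x => (derive1 f) (g x) * (derive1 g) x)).
    move=> x; have dg := C1kS_derive Hg x; have df := C1kS_derive Hf (g x).
  exact: (@is_derive1_comp _ f g x _ _ df dg).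
by apply: C1kM; [apply: IH; [by case: Hf|exact: C1k_le]|case: Hg].
Qed.

Lemma C1kV k f : (forall x, f x != 0) -> C1k k f -> C1k k (fun x => (f x)^-1).
Proof.
move=> f0; elim: k => [|k IH] Hf; first by move=> x; apply: cvgV; [exact: f0|exact: Hf].
apply: (@C1kS_is_derive _ _ (fun x => - ((f x)^-1 * (f x)^-1) * (derive1 f) x)).
  by move=> x; have := is_deriveV (f0 x) (C1kS_derive Hf x); rewrite expr2 invfM.
apply: C1kM; last by case: Hf.
by apply: C1kN; apply: C1kM; apply: IH; exact: C1k_le.
Qed.

Lemma smooth_derive1 h : smooth h -> smooth (derive1 h).
Proof. by move=> sh k; case: (sh k.+1). Qed.

Lemma smooth_derive1n n h : smooth h -> smooth (derive1n n h).
Proof. by move=> sh; elim: n => // n IH; rewrite derive1nS; exact: smooth_derive1. Qed.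

Lemma smooth_is_derive h n x : smooth h -> is_derive x 1 (derive1n n h) ((derive1n n.+1 h) x).
Proof.
by move=> /(smooth_derive1n n) /(_ 1%N) /C1kS_derive /(_ x); rewrite derive1nS.
Qed.

Lemma smooth_continuous h : smooth h -> continuous h.
Proof. by move=> /(_ 0%N). Qed.

Lemma derive1n_near f g n x : (\near x, f x = g x) -> (derive1n n f) x = (derive1n n g) x.
Proof.
elim: n x => [|n IH] x fg; first by rewrite !derive1n0; exact: nbhs_singleton fg.
rewrite !derive1nS !derive1E; apply: near_eq_derive.
have := near_join fg.
by apply: filterS => y; exact: IH.
Qed.

(** ** The flat functions x^-n exp(-1/x) *)

(** Extended by 0 to x <= 0.  Each is the derivative of a combination of two
    others, so no polynomials in 1/x need to be tracked. *)
Definition flat n x : R := if 0 < x then expR (- x^-1) * x^-1 ^+ n else 0.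

Lemma flat_ge0 n x : 0 <= flat n x.
Proof.
rewrite /flat; case: ifP => // x0.
by rewrite mulr_ge0 ?expR_ge0 ?exprn_ge0 ?invr_ge0 // ltW.
Qed.

Lemma flat_gt0 n x : 0 < x -> 0 < flat n x.
Proof. by move=> x0; rewrite /flat x0 mulr_gt0 ?expR_gt0 ?exprn_gt0 ?invr_gt0. Qed.

Lemma flat_le0 n x : x <= 0 -> flat n x = 0.
Proof. by rewrite /flat leNgt => /negbTE ->. Qed.

(** A quadratic bound at 0 gives both continuity there and a zero derivative. *)
Lemma flat_le_sqr n x : flat n x <= (n.+2)`!%:R * x ^+ 2.
Proof.
rewrite /flat; case: ifPn => [x0|_]; last by rewrite mulr_ge0 ?sqr_ge0.
have iy0 : 0 <= x^-1 by rewrite invr_ge0 ltW.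
have := @expR_ge1Dxn R x^-1 n.+1 iy0.
set F := _`!%:R => H.
have F0 : 0 < F by rewrite ltr0n fact_gt0.
have {}H : x^-1 ^+ n.+2 / F <= expR x^-1 by apply: le_trans H; rewrite lerDr.
rewrite expRN -(@ler_pM2l _ (expR x^-1)) ?expR_gt0// mulrA divff ?expR_eq0// mul1r.
have -> : x^-1 ^+ n = x^-1 ^+ n.+2 * x ^+ 2.
  by rewrite -addn2 exprD -mulrA -exprMn mulVf ?gt_eqF// expr1n mulr1.
by rewrite [leRHS]mulrA ler_pM2r ?exprn_gt0// -ler_pdivrMr.
Qed.

Lemma flat_is_derive n x :
  is_derive x 1 (flat n) (flat n.+2 x - n%:R * flat n.+1 x).
Proof.
have [x0|x0|x0] := ltgtP 0 x; last rewrite -x0.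
- have xn0 : x != 0 by rewrite gt_eqF.
  apply: (@near_eq_is_derive _ _ _ (fun x => expR (- x^-1) * x^-1 ^+ n)).
    near=> y; rewrite /flat ifT//.
    by near: y; exact: lt_nbhsr.
  rewrite /flat x0.
  have dV : is_derive x 1 (fun y : R => y^-1) (- x ^- 2 *: 1) by exact: is_deriveV.
  have dNV := is_deriveN dV.
  have dE := @is_derive1_comp _ expR _ x _ _ (is_derive_expR _) dNV.
  have dX : is_derive x 1 (fun y : R => y^-1 ^+ n) (n%:R * x^-1 ^+ n.-1 * - x ^- 2).
    have -> : (fun y : R => y^-1 ^+ n) = (fun y => y^-1) ^+ n.
      by apply/funext => y; rewrite exprfctE.
    by apply: is_derive_eq (is_deriveX n dV) _; rewrite scaler1.
  apply: is_derive_eq (is_deriveM dE dX) _.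
  rewrite /= !fctE !scaler1 /GRing.scale/=.
  by case: n {dX} => [|n] /=; rewrite ?exprS; field.
- apply: (@near_eq_is_derive _ _ _ (cst 0)).
    near=> y; rewrite flat_le0//; apply: ltW.
    by near: y; exact: lt_nbhsl.
  by rewrite !flat_le0 ?ltW// mulr0 subr0; exact: is_derive_cst.
- rewrite !flat_le0// mulr0 subr0.
  have cv : h^-1 *: ((flat n \o shift 0) (h *: 1) - flat n 0) @[h --> 0^'] --> (0 : R).
    apply/cvgrPdist_le => e e0.
    near=> h.
    have h0 : h != 0 by near: h; exact: nbhs_dnbhs_neq.
    rewrite sub0r normrN /= addr0 scaler1 [flat n 0]flat_le0// subr0.
    rewrite normrM normfV ger0_norm ?flat_ge0//.
    rewrite ler_pdivrMl ?normr_gt0//.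
    apply: le_trans (flat_le_sqr n h) _.
    rewrite -(real_normK (num_real h)) expr2 mulrCA ler_wpM2l//.
    rewrite -ler_pdivlMl ?ltr0n ?fact_gt0//.
    near: h; apply: dnbhs0_le.
    by rewrite mulr_gt0 ?invr_gt0 ?ltr0n ?fact_gt0.
  apply: DeriveDef; last exact/cvg_lim.
  by apply/cvg_ex; exists 0.
Unshelve. all: by end_near. Qed.

Lemma smooth_flat n : smooth (flat n).
Proof.
move=> k; elim: k n => [|k IH] n.
  by apply: derivable_continuous => x; have := flat_is_derive n x; case.
apply: C1kS_is_derive (flat_is_derive n) _.
by apply: C1kD => //; apply: C1kN; apply: C1kZ.
Qed.

(** ** A smooth step *)

(** The two flat functions in the denominator never vanish together. *)
Definition step x : R := flat 0 x / (flat 0 x + flat 0 (1 - x)).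

Let step_den x : 0 < flat 0 x + flat 0 (1 - x).
Proof.
have [x0|x0] := ltP 0 x; first by rewrite ltr_pwDl ?flat_gt0 ?flat_ge0.
by rewrite ltr_wpDl ?flat_ge0// flat_gt0// subr_gt0 (le_lt_trans x0).
Qed.

Lemma smooth_step : smooth step.
Proof.
move=> k; apply: C1kM; first exact: smooth_flat.
apply: C1kV; first by move=> x; rewrite gt_eqF.
apply: C1kD; first exact: smooth_flat.
apply: C1k_comp; first exact: smooth_flat.
by apply: C1kD; [exact: C1k_cst|apply: C1kN; exact: C1k_id].
Qed.

Lemma step_le0 x : x <= 0 -> step x = 0.
Proof. by move=> x0; rewrite /step flat_le0// mul0r. Qed.

Lemma step_ge1 x : 1 <= x -> step x = 1.
Proof.
move=> x1; rewrite /step (@flat_le0 0 (1 - x)) ?subr_le0// addr0 divff//.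
by rewrite gt_eqF// flat_gt0// (lt_le_trans ltr01).
Qed.

Lemma step_01 x : 0 <= step x <= 1.
Proof.
rewrite divr_ge0 ?flat_ge0 ?(ltW (step_den x))//=.
by rewrite ler_pdivrMr// mul1r lerDl flat_ge0.
Qed.

(** ** Smooth functions times powers *)

(** A cutoff that vanishes near 0 makes every power smooth. *)
Lemma C1k_powR (b a : R) k h : 0 < a -> (forall s, s < a -> h s = 0) ->
  C1k k h -> C1k k (fun s => h s * s `^ b).
Proof.
move=> a0; elim: k h b => [|k IH] h b ha hk.
  move=> s; have [sa|sa] := ltP s a.
    apply: (@near_cst_continuous _ _ 0).
    near=> t; rewrite ha ?mul0r//; near: t; exact: lt_nbhsl.
  apply: cvgM; first exact: hk.
  have s0 : 0 < s by exact: lt_le_trans sa.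
  have /derivable1_diffP/differentiable_continuous := @ex_derive _ _ _ _ _ _ _ (is_derive1_powR b s0).
  exact.
have h'a s : s < a -> (derive1 h) s = 0.
  move=> sa; rewrite derive1E -(derive_cst (0 : R) s 1).
  apply: near_eq_derive.
  by near=> t; rewrite ha//; near: t; exact: lt_nbhsl.
apply: (@C1kS_is_derive _ _ (fun s => h s * s `^ (b - 1) * b + (derive1 h) s * s `^ b)).
  move=> s; have [sa|sa] := ltP s a.
    rewrite ha// h'a// !mul0r addr0.
    apply: (@near_eq_is_derive _ _ _ (cst 0)).
    by near=> t; rewrite ha ?mul0r//; near: t; exact: lt_nbhsl.
  have s0 : 0 < s by exact: lt_le_trans sa.
  apply: is_derive_eq (is_deriveM (C1kS_derive hk s) (is_derive1_powR b s0)) _.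
  rewrite /GRing.scale/=; ring.
apply: C1kD; last by apply: IH => //; case: hk.
have := IH _ (b - 1) ha (C1k_le hk) => /(C1kZ b).
by congr (C1k _ _); apply/funext => s; rewrite mulrC.
Unshelve. all: by end_near. Qed.

End OneVariable.

(** * Differential calculus on column vectors *)

Section Topology.
Context {R : realType} {n : nat}.
Local Notation E := 'cV[R]_n.
Implicit Types (x y : E) (r : R).

Lemma cv_norm_le x r : 0 <= r -> (`|x| <= r) = [forall i, `|x i 0| <= r].
Proof.
move=> r0; rewrite /Num.norm/= mx_normrE; apply/bigmax_leP/forallP => [[_ H] i|H].
  exact: (H (i, 0)).
by split=> // -[i j] _; rewrite (ord1 j)/=; exact: H.
Qed.

Lemma cv_coord_le x i : `|x i 0| <= `|x|.
Proof. by have := lexx `|x|; rewrite cv_norm_le// => /forallP. Qed.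

Lemma cv_cvg (T : Type) (F : set_system T) {FF : Filter F} (f : T -> E) (l : E) :
  (forall i, f t i 0 @[t --> F] --> l i 0) -> f t @[t --> F] --> l.
Proof.
move=> H; apply/cvgrPdist_le => e e0.
have : \forall t \near F, forall i, `|l i 0 - f t i 0| <= e.
  apply: filter_forall => i; by move/cvgrPdist_le : (H i); exact.
apply: filterS => t Ht; rewrite cv_norm_le ?ltW//; apply/forallP => i.
by rewrite !mxE; exact: Ht.
Qed.

Lemma trmx_cv_continuous : continuous (fun v : 'rV[R]_n => v^T : E).
Proof.
move=> v; apply: (@cv_cvg _ (nbhs v)) => i; rewrite mxE.
under eq_fun do rewrite mxE.
exact: coord_continuous.
Qed.

Lemma cv_bounded_closed_compact (A : set E) : bounded_set A -> closed A -> compact A.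
Proof.
move=> [M [Mr HM]] cA.
have -> : A = (fun v : 'rV[R]_n => v^T : E) @` [set v : 'rV[R]_n | A v^T].
  apply/seteqP; split => [x Ax|_ [v Av <-]//].
  by exists x^T; rewrite ?trmxK//= trmxK.
apply: continuous_compact.
  by apply: continuous_subspaceT; exact: trmx_cv_continuous.
apply: bounded_closed_compact.
  exists (Num.max M 0); split; first by rewrite num_real.
  move=> r rM v Av; have r0 : 0 <= r by apply: ltW; apply: le_lt_trans rM; rewrite le_max lexx orbT.
  have H : `|v^T| <= r by apply: HM Av; apply: le_lt_trans rM; rewrite le_max lexx.
  move: H; rewrite cv_norm_le// => H.
  rewrite /= /Num.norm/= mx_normrE; apply/bigmax_leP; split=> // -[i j] _ /=.
  by have /forallP/(_ j) := H; rewrite mxE (ord1 i).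
apply: (@preimage_closed _ _ (fun v : 'rV[R]_n => v^T : E)) => //.
by move=> ? ?; exact: trmx_cv_continuous.
Qed.

End Topology.

Section Lines.
Context {R : realType} {V : normedModType R}.
Implicit Types (f : V -> R) (x v : V).

Lemma is_derive_line f x v t b :
  is_derive (x + t *: v) v f b <-> is_derive t 1 (fun s : R => f (x + s *: v)) b.
Proof.
have E : (fun h : R => h^-1 *: ((f \o shift (x + t *: v)) (h *: v) - f (x + t *: v))) =
   (fun h : R => h^-1 *: (((fun s : R => f (x + s *: v)) \o shift t) (h *: 1) - f (x + t *: v))).
  apply/funext => h; congr (_ *: (_ - _)) => /=; congr f.
  by rewrite scaler1 scalerDl addrCA addrC addrAC -!addrA; congr (_ + _); rewrite addrC.
split=> -[dx dv].
  split; first by move: dx; rewrite /derivable E.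
  by rewrite -dv /derive E.
split; first by move: dx; rewrite /derivable E.
by rewrite -dv /derive E.
Qed.

Lemma is_derive_comp1 (h : R -> R) f x v a b :
  is_derive (f x) 1 h a -> is_derive x v f b -> is_derive x v (fun y => h (f y)) (a * b).
Proof.
move=> dh df.
have x0 : x = x + 0 *: v by rewrite scale0r addr0.
rewrite x0 in df; have /is_derive_line d1 := df.
rewrite x0; apply/is_derive_line.
apply: (@is_derive1_comp _ h (fun s : R => f (x + s *: v))) => //.
by rewrite scale0r addr0.
Qed.

Let quotient_shift f a x v : (fun h : R => h^-1 *: (((fun y => f (y - a)) \o shift x) (h *: v) - f (x - a)))
  = (fun h => h^-1 *: ((f \o shift (x - a)) (h *: v) - f (x - a))).
Proof. by apply/funext => h /=; rewrite addrA. Qed.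

Lemma derive_shift_sub f a x v : 'D_v (fun y => f (y - a)) x = 'D_v f (x - a).
Proof. by rewrite /derive quotient_shift. Qed.

Lemma derivable_shift_sub f a x v :
  derivable (fun y => f (y - a)) x v = derivable f (x - a) v.
Proof. by rewrite /derivable quotient_shift. Qed.

Lemma is_deriveZv f x v (c : R) b : is_derive x v f b -> is_derive x (c *: v) f (c * b).
Proof.
move=> df; have x0 w : x = x + 0 *: w :> V by rewrite scale0r addr0.
rewrite (x0 v) in df; have /is_derive_line d1 := df.
rewrite [X in is_derive X](x0 (c *: v)); apply/is_derive_line.
have -> : (fun s : R => f (x + s *: (c *: v))) = (fun s => f (x + s *: v)) \o (fun s => c * s).
  by apply/funext => s /=; rewrite scalerA mulrC.
have dc : is_derive (0 : R) 1 (fun s : R => c * s) c.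
  by apply: is_derive_eq (is_deriveZ c (is_derive_id (0 : R) 1)) _; rewrite scaler1.
rewrite mulrC; apply: is_derive1_comp => //.
by rewrite mulr0.
Qed.

Lemma is_derive_line_MVT f (df : R -> R) x v :
  (forall t : R, is_derive (x + t *: v) v f (df t)) ->
  exists2 t : R, 0 <= t <= 1 & f (x + v) - f x = df t.
Proof.
move=> H.
have d (s : R) : is_derive s 1 (fun s : R => f (x + s *: v)) (df s) by apply/is_derive_line.
have := @MVT_segment R (fun s : R => f (x + s *: v)) df 0 1 ler01 (fun s _ => d s).
rewrite scale1r scale0r addr0 subr0 => -[].
  apply: derivable_within_continuous => s _; exact: ex_derive.
by move=> t; rewrite in_itv/= => t01; rewrite mulr1 => ->; exists t.
Qed.

End Lines.

Section Partials.
Context {R : realType} {n : nat}.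
Local Notation E := 'cV[R]_n.+1.
Local Notation e_ i := (delta_mx i 0 : E).
Implicit Types (x y v a : E) (f g : E -> R) (k : nat) (i j : 'I_n.+1).

Lemma partial_is_derive f (g : E -> R) i :
  (forall x, is_derive x (e_ i) f (g x)) -> partial i f = g.
Proof. by move=> H; apply/funext => x; apply: derive_val. Qed.

Lemma Ck_continuous k f : Ck k f -> continuous f.
Proof. by case: k => //= k []. Qed.

Lemma Ck_le k f : Ck k.+1 f -> Ck k f.
Proof.
elim: k f => [|k IH] f; first by case.
by case=> cf H; split=> // i; have [df /IH] := H i.
Qed.

Lemma CkS_is_derive k f (g : 'I_n.+1 -> E -> R) : continuous f ->
  (forall i x, is_derive x (e_ i) f (g i x)) -> (forall i, Ck k (g i)) -> Ck k.+1 f.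
Proof.
move=> cf H Hg; split=> // i; split; first by move=> x; exact: ex_derive.
by rewrite (partial_is_derive (H i)).
Qed.

Lemma CkS_derive k f i : Ck k.+1 f -> forall x, is_derive x (e_ i) f (partial i f x).
Proof. by case=> _ H x; have [dx _] := H i; apply: DeriveDef. Qed.

Lemma Ck_partial k f i : Ck k.+1 f -> Ck k (partial i f).
Proof. by case=> _ /(_ i) []. Qed.

Lemma Ck_cst k (c : R) : Ck k (fun _ : E => c).
Proof.
elim: k c => [|k IH] c; first exact: cst_continuous.
by apply: (@CkS_is_derive _ _ (fun _ _ => 0)) => //; exact: cst_continuous.
Qed.

Lemma coord_is_derive i x v : is_derive x v (fun y : E => y i 0) (v i 0).
Proof.
rewrite -[x]addr0 -(scale0r v); apply/is_derive_line.
have -> : (fun s : R => (x + s *: v) i 0) = (fun s => x i 0 + v i 0 * s).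
  by apply/funext => s; rewrite !mxE mulrC.
have := is_deriveD (is_derive_cst (x i 0) (0 : R) 1) (is_deriveZ (v i 0) (is_derive_id (0 : R) 1)).
by rewrite add0r scaler1.
Qed.

Lemma Ck_coord k i : Ck k (fun y : E => y i 0).
Proof.
case: k => [|k]; first exact: coord_continuous.
apply: (@CkS_is_derive _ _ (fun j _ => e_ j i 0)); first exact: coord_continuous.
  by move=> j x; exact: coord_is_derive.
by move=> j; exact: Ck_cst.
Qed.

Lemma CkD k f g : Ck k f -> Ck k g -> Ck k (fun x => f x + g x).
Proof.
elim: k f g => [|k IH] f g Hf Hg; first by move=> x; exact: (cvgD (Hf x) (Hg x)).
apply: (@CkS_is_derive _ _ (fun i x => partial i f x + partial i g x)).
- have [cf cg] : continuous f /\ continuous g by split; apply: Ck_continuous; eassumption.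
  by move=> x; exact: (cvgD (cf x) (cg x)).
- by move=> i x; exact: (is_deriveD (CkS_derive i Hf x) (CkS_derive i Hg x)).
- by move=> i; apply: IH; exact: Ck_partial.
Qed.

Lemma CkM k f g : Ck k f -> Ck k g -> Ck k (fun x => f x * g x).
Proof.
elim: k f g => [|k IH] f g Hf Hg; first by move=> x; exact: (cvgM (Hf x) (Hg x)).
apply: (@CkS_is_derive _ _ (fun i x => f x * partial i g x + g x * partial i f x)).
- have [cf cg] : continuous f /\ continuous g by split; apply: Ck_continuous; eassumption.
  by move=> x; exact: (cvgM (cf x) (cg x)).
- by move=> i x; exact: (is_deriveM (CkS_derive i Hf x) (CkS_derive i Hg x)).
- by move=> i; apply: CkD; apply: IH; do ?[exact: Ck_le|exact: Ck_partial].
Qed.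

Lemma CkZ k (c : R) f : Ck k f -> Ck k (fun x => c * f x).
Proof. by apply: CkM; exact: Ck_cst. Qed.

Lemma CkN k f : Ck k f -> Ck k (fun x => - f x).
Proof.
move=> /(CkZ (-1)); congr (Ck k _).
by apply/funext => x; rewrite mulN1r.
Qed.

Lemma CkB k f g : Ck k f -> Ck k g -> Ck k (fun x => f x - g x).
Proof. by move=> Hf Hg; apply: CkD => //; exact: CkN. Qed.

Lemma Ck_sum k (I : Type) (r : seq I) (P : pred I) (F : I -> E -> R) :
  (forall a : I, P a -> Ck k (F a)) -> Ck k (fun x => \sum_(i <- r | P i) F i x).
Proof.
move=> H; elim: r => [|a r IH].
  by under eq_fun do rewrite big_nil; exact: Ck_cst.
under eq_fun do rewrite big_cons.
case: (boolP (P a)) => Pa //; apply: CkD => //; exact: H.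
Qed.

Lemma Ck_comp1 k (h : R -> R) f : C1k k h -> Ck k f -> Ck k (fun x => h (f x)).
Proof.
elim: k h f => [|k IH] h f Hh Hf.
  by move=> x; apply: (@continuous_comp _ _ _ f h); [exact: (Hf : continuous f)|exact: (Hh : continuous h)].
apply: (@CkS_is_derive _ _ (fun i x => derive1 h (f x) * partial i f x)).
- move=> x; apply: (@continuous_comp _ _ _ f h); first exact: (Ck_continuous Hf).
  exact: (C1k_continuous Hh).
- by move=> i x; exact: (is_derive_comp1 (C1kS_derive Hh (f x)) (CkS_derive i Hf x)).
- move=> i; apply: CkM; last exact: Ck_partial.
  by apply: IH; [case: Hh|exact: Ck_le].
Qed.

(** Partial derivatives that are continuous add up to all directional
    derivatives; one coordinate direction is added at a time, and the mean
    value theorem applies along it. *)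
Lemma C1_is_derive f x v : Ck 1 f ->
  is_derive x v f (\sum_i v i 0 * partial i f x).
Proof.
move=> Hf.
suff H (s : seq 'I_n.+1) :
    is_derive x (\sum_(i <- s) v i 0 *: e_ i) f (\sum_(i <- s) v i 0 * partial i f x).
  have := H (index_enum _).
  congr (is_derive _ _ _ _); apply/matrixP => i j; rewrite (ord1 j) summxE.
  rewrite (bigD1 i)//= !mxE !eqxx mulr1 big1 ?addr0// => k ki.
  by rewrite !mxE eq_sym (negbTE ki) mulr0.
elim: s => [|i s IH]; first by rewrite !big_nil; exact: is_derive0.
rewrite !big_cons; set w := \sum_(j <- s) _ in IH *; set c := v i 0.
set d := \sum_(j <- s) _ in IH *.
have H2 : h^-1 *: ((f \o shift x) (h *: w) - f x) @[h --> 0^'] --> d.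
  by case: IH => /cvg_ex[l Hl] <-; move: (Hl) => /(cvg_lim (@Rhausdorff R)) lE; rewrite /derive lE.
have H1 : h^-1 *: (f (x + h *: w + h *: (c *: e_ i)) - f (x + h *: w)) @[h --> 0^'] -->
    c * partial i f x.
  apply/cvgrPdist_le => e e0.
  have cp : continuous (partial i f) by exact: (Ck_continuous (Ck_partial i Hf)).
  have ct : (fun y => c * partial i f y) @ x --> c * partial i f x.
    exact: (cvgM (cvg_cst c) (cp x)).
  have /cvgrPdist_le/(_ _ e0) := ct; rewrite near_nbhs => /nbhs_ballP[r /= r0 Hr].
  pose K := `|w| + `|c *: e_ i|.
  have K0 : 0 <= K by rewrite addr_ge0.
  near=> h.
  have h0 : h != 0 by near: h; exact: nbhs_dnbhs_neq.
  have hK : `|h| < r / (K + 1).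
    by near: h; apply: dnbhs0_lt; rewrite divr_gt0// ltr_wpDl.
  pose X t : E := x + h *: w + t *: (h *: (c *: e_ i)).
  have [t /andP[t0 t1] ->] : exists2 t : R, 0 <= t <= 1 &
      f (x + h *: w + h *: (c *: e_ i)) - f (x + h *: w) = h * (c * partial i f (X t)).
    apply: (@is_derive_line_MVT _ _ f (fun t => h * (c * partial i f (X t)))) => t.
    exact: (is_deriveZv h (is_deriveZv c (CkS_derive i Hf (X t)))).
  rewrite /GRing.scale/= mulKf//; apply: Hr; rewrite mx_norm_ball /ball_/=.
  rewrite /X -addrA opprD addrA subrr add0r normrN.
  apply: le_lt_trans (ler_normD _ _) _; rewrite !normrZ.
  apply: (@le_lt_trans _ _ (`|h| * K)).
    rewrite /K normrZ mulrDr lerD2l mulrA -[leRHS]mul1r -mulrA ler_wpM2r ?mulr_ge0//.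
    by rewrite ger0_norm.
  apply: (@le_lt_trans _ _ (`|h| * (K + 1))); first by rewrite ler_wpM2l// lerDl.
  by rewrite -ltr_pdivlMr// ltr_wpDl.
have H3 := cvgD H1 H2.
have dE : h^-1 *: ((f \o shift x) (h *: (c *: e_ i + w)) - f x) @[h --> 0^'] --> c * partial i f x + d.
  have -> : (fun h : R => h^-1 *: ((f \o shift x) (h *: (c *: e_ i + w)) - f x)) =
    (fun h => h^-1 *: (f (x + h *: w + h *: (c *: e_ i)) - f (x + h *: w))) +
    (fun h => h^-1 *: ((f \o shift x) (h *: w) - f x)).
    apply/funext => h; rewrite fctE /=.
    have -> : h *: (c *: e_ i + w) + x = x + h *: w + h *: (c *: e_ i).
      by rewrite scalerDr addrC [in LHS](addrC (h *: (c *: _))) addrA.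
    transitivity (h^-1 * (f (x + h *: w + h *: (c *: e_ i)) - f (x + h *: w))
        + h^-1 * (f (h *: w + x) - f x)); last by [].
    by rewrite (addrC (h *: w) x) /GRing.scale/=; ring.
  exact: H3.
by apply: DeriveDef; [apply/cvg_ex; eexists; exact: dE|exact/cvg_lim].
Unshelve. all: by end_near. Qed.

Lemma partial_shift f a i x : partial i (fun y => f (y - a)) x = partial i f (x - a).
Proof. by rewrite /partial derive_shift_sub. Qed.

Lemma Ck_shift k f a : Ck k f -> Ck k (fun y => f (y - a)).
Proof.
have cs : continuous (fun y : E => y - a).
  by move=> y; exact: (cvgB (@cvg_id _ (nbhs y)) (cvg_cst a)).
elim: k f => [|k IH] f Hf.
  by move=> x; apply: (@continuous_comp _ _ _ (fun y : E => y - a) f); [exact: cs|exact: (Hf : continuous f)].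
apply: (@CkS_is_derive _ _ (fun i y => partial i f (y - a))).
- move=> x; apply: (@continuous_comp _ _ _ (fun y : E => y - a) f); first exact: cs.
  exact: (Ck_continuous Hf).
- move=> i x; have [_ /(_ i) [dfi _]] := Hf.
  by apply: DeriveDef; [rewrite derivable_shift_sub|exact: partial_shift].
- by move=> i; apply: IH; exact: Ck_partial.
Qed.

End Partials.

(** * Measure theory on space *)

Section Measurability.
Context {R : realType}.
Local Notation E := 'cV[R]_3.
Local Notation T1 := (measurableTypeR R).
Local Notation T3 := (T1 * T1 * T1)%type.
Implicit Types (U : set E) (f g : E -> R) (a b : E).

Lemma vec3E (p : T3) : (vec3 p 0 0 = p.1.1) * (vec3 p 1 0 = p.1.2) * (vec3 p 2%:R 0 = p.2).
Proof. by rewrite !mxE. Qed.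

Lemma forall_I3 (P : 'I_3 -> Prop) : (forall i, P i) <-> [/\ P 0, P 1 & P 2%:R].
Proof.
split=> [H|[H0 H1 H2] i]; first by split.
case: i => -[|[|[|//]]] Hi.
- by rewrite (_ : Ordinal Hi = 0)//; apply/val_inj.
- by rewrite (_ : Ordinal Hi = 1)//; apply/val_inj.
- by rewrite (_ : Ordinal Hi = 2%:R)//; apply/val_inj.
Qed.

Lemma sum_I3 (V : nmodType) (F : 'I_3 -> V) : \sum_i F i = F 0 + F 1 + F 2%:R.
Proof.
rewrite big_ord_recl big_ord_recl big_ord_recl big_ord0 addr0 addrA.
by congr (_ + F _ + F _); apply/val_inj.
Qed.

Definition box a b : set E := [set x | forall i, a i 0 < x i 0 < b i 0].

Lemma measurable_vec3_coord i : measurable_fun setT (fun p : T3 => vec3 p i 0 : T1).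
Proof.
move: i; apply/forall_I3; split.
- under eq_fun do rewrite vec3E.
  by apply: measurableT_comp => //; exact: measurable_fst.
- under eq_fun do rewrite vec3E.
  by apply: measurableT_comp => //; exact: measurable_snd.
- under eq_fun do rewrite vec3E; exact: measurable_snd.
Qed.

Lemma measurable_box a b : measurable (@vec3 R @^-1` box a b).
Proof.
have -> : @vec3 R @^-1` box a b =
    \bigcap_(i in [set: 'I_3]) ((fun p => vec3 p i 0) @^-1` `]a i 0, b i 0[).
  apply/seteqP; split => [p H i _|p H i]; first by rewrite /= in_itv/=; exact: H.
  by have := H i Logic.I; rewrite /= in_itv.
apply: fin_bigcap_measurable => // i _; rewrite -[X in measurable X]setTI.
by apply: measurable_vec3_coord.
Qed.

Lemma ball_box (x : E) r : 0 < r -> ball x r = box (x - const_mx r) (x + const_mx r).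
Proof.
move=> r0; apply/seteqP; split => y /=.
  case=> _ H i; have := H i 0; rewrite /ball/= !mxE ltr_distl => /andP[H1 H2].
  by rewrite ltrBlDr H2/= -ltrBlDr.
move=> H; split=> // i j; rewrite (ord1 j) /ball/=.
have /andP[] := H i; rewrite !mxE => H1 H2.
by rewrite ltr_distl; apply/andP; split; lra.
Qed.

Definition ratcube (u : 'cV[rat]_3 * nat) : set E := ball (map_mx (@ratr R) u.1 : E) (u.2.+1%:R^-1).

(** Countably many cubes suffice, and one may ask their doubles to stay in the set. *)
Lemma open_ratcubes U : open U ->
  U = \bigcup_(u in [set u : 'cV[rat]_3 * nat |
       ball (map_mx (@ratr R) u.1 : E) (2 / (u.2.+1%:R)) `<=` U]) ratcube u.
Proof.
move=> oU; apply/seteqP; split => [x Ux|x [u /= Hu]]; last first.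
  move=> xu; apply: Hu; move: xu; apply: le_ball.
  by rewrite ler_peMl ?invr_ge0// ler1n.
have /nbhs_ballP[r /= r0 Hr] : nbhs x U by exact: open_nbhs_nbhs.
have [n Hn] : exists n : nat, (n.+1%:R^-1 : R) < r / 3.
  have r30 : 0 < r / 3 by rewrite divr_gt0.
  exists (Num.truncn (r / 3)^-1).
  by rewrite invf_plt ?posrE// truncnS_gt.
have n0 : 0 < (n.+1%:R^-1 : R) by rewrite invr_gt0.
have /choice[c Hc] : forall i : 'I_3, exists q : rat, x i 0 - n.+1%:R^-1 < ratr q < x i 0 + n.+1%:R^-1.
  move=> i; have lt : x i 0 - n.+1%:R^-1 < x i 0 + n.+1%:R^-1.
    by rewrite ltrBlDr -addrA ltrDl addr_gt0.
  have [q] := rat_in_itvoo lt.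
  by rewrite in_itv/= => H; exists q.
have xc : ball (map_mx (@ratr R) (\col_i c i) : E) n.+1%:R^-1 x.
  rewrite ball_box// => i; rewrite !mxE; have /andP[h1 h2] := Hc i.
  by move: (n.+1%:R^-1) h1 h2 => d h1 h2; apply/andP; split; lra.
exists (\col_i c i, n) => //= y Hy; apply: Hr.
apply: (@le_ball _ _ x (n.+1%:R^-1 + 2 / n.+1%:R)).
  by move: (n.+1%:R^-1) Hn => d Hn; lra.
by apply: ball_triangle Hy; exact: ball_sym.
Qed.

Lemma measurable_open U : open U -> measurable (@vec3 R @^-1` U).
Proof.
move=> /open_ratcubes ->; rewrite preimage_bigcup.
rewrite bigcup_mkcond; apply: countable_bigcupT_measurable => [//|u].
case: ifPn => // _.
by rewrite /ratcube ball_box ?invr_gt0//; exact: measurable_box.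
Qed.

Lemma measurable_closed U : closed U -> measurable (@vec3 R @^-1` U).
Proof.
move=> cU; have := @measurable_open (~` U) (closed_openC cU).
by rewrite preimage_setC => /measurableC; rewrite setCK.
Qed.

Lemma continuous_measurable f : continuous f ->
  measurable_fun setT (fun p : T3 => f (vec3 p) : T1).
Proof.
move=> cf; apply: (measurability _ (measurable_realfun.RGenOInfty.measurableE R)) => _ [_ [x ->] <-].
rewrite setTI; apply: (@measurable_open (f @^-1` `]x, +oo[)).
by apply: open_comp => [y _|]; [exact: cf|exact: interval_open].
Qed.

Lemma continuous_measurable_on U f : measurable (@vec3 R @^-1` U) -> continuous f ->
  measurable_on U f.
Proof. by move=> mU cf; apply: measurable_funTS; exact: continuous_measurable. Qed.

Definition boxes : set (set T3) := [set @vec3 R @^-1` box u.1 u.2 | u in [set: E * E]].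

(** Boxes are stable under intersection, so an identity between integrals
    extends from boxes to all measurable sets. *)
Lemma measurable_boxes : @measurable _ T3 = <<s boxes >>.
Proof.
apply/seteqP; split; last first.
  apply: smallest_sub; first exact: sigma_algebra_measurable.
  by move=> _ [[a b] _ <-]; exact: measurable_box.
have mcoord i : measurable_fun setT (fun p : g_sigma_algebraType boxes => vec3 (p : T3) i 0 : T1).
  apply: (measurability _ (measurable_realfun.RGenOInfty.measurableE R)) => _ [_ [x ->] <-].
  rewrite setTI.
  pose a (n : nat) : E := \col_j if j == i then x else - n%:R.
  have -> : (fun p : T3 => vec3 p i 0) @^-1` `]x, +oo[ =
      \bigcup_n (@vec3 R @^-1` box (a n) (const_mx n%:R)).
    apply/seteqP; split => [p|p [n _ /(_ i)]]; last first.
      by rewrite /= !mxE eqxx in_itv/= andbT => /andP[].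
    rewrite /= in_itv/= andbT; set v := vec3 p => xp.
    have [n Hn] : exists n : nat, forall j, `|v j 0| < n%:R.
      exists (Num.truncn `|v|).+1 => j.
      by apply: le_lt_trans (cv_coord_le _ _) _; rewrite truncnS_gt.
    exists n => // j; rewrite -/v [a n j 0]mxE [const_mx _ j 0]mxE.
    have := Hn j; rewrite ltr_norml => /andP[h1 ->]; rewrite andbT.
    by case: eqP => [->|].
  apply: bigcupT_measurable => n.
  by apply: sub_sigma_algebra; exists (a n, const_mx n%:R).
have : measurable_fun setT (fun p : g_sigma_algebraType boxes => (p : T3)).
  have -> : (fun p : g_sigma_algebraType boxes => (p : T3)) = (fun p => ((vec3 (p : T3) 0 0, vec3 (p : T3) 1 0), vec3 (p : T3) 2%:R 0)).
    by apply/funext => -[[u v] w]; rewrite !vec3E.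
  by apply: measurable_fun_pair => //; exact: measurable_fun_pair.
move=> H A mA; have := H measurableT A mA.
by rewrite setTI preimage_id.
Qed.

End Measurability.

(** * Integrals over space *)

Section Integrals.
Context {R : realType}.
Local Notation E := 'cV[R]_3.
Local Notation T1 := (measurableTypeR R).
Local Notation T3 := (T1 * T1 * T1)%type.
Local Notation mu := (@leb3 R).
Implicit Types (U : set E) (f g : E -> R) (a b x : E).

Definition mbl U := measurable (@vec3 R @^-1` U).

Definition integ U f := mu.-integrable (@vec3 R @^-1` U) (EFin \o (fun p => f (vec3 p))).

Lemma mblT : mbl setT.
Proof. by rewrite /mbl preimage_setT. Qed.

Lemma integ_measurable_on U f : integ U f -> measurable_on U f.
Proof. by move=> /integrableP[/measurable_EFinP]. Qed.

Lemma int3D U f g : mbl U -> integ U f -> integ U g ->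
  int3 U (fun x => f x + g x) = int3 U f + int3 U g.
Proof. exact: RintegralD. Qed.

Lemma int3B U f g : mbl U -> integ U f -> integ U g ->
  int3 U (fun x => f x - g x) = int3 U f - int3 U g.
Proof. exact: RintegralB. Qed.

Lemma int3Z U f (c : R) : mbl U -> integ U f ->
  int3 U (fun x => c * f x) = c * int3 U f.
Proof. exact: RintegralZl. Qed.

Lemma int3N U f : mbl U -> integ U f ->
  int3 U (fun x => - f x) = - int3 U f.
Proof.
move=> mU /(int3Z (-1) mU); rewrite mulN1r => <-; congr (int3 U _).
by apply/funext => x; rewrite mulN1r.
Qed.

Lemma integD U f g : mbl U -> integ U f -> integ U g -> integ U (fun x => f x + g x).
Proof. by move=> mU fi gi; rewrite /integ /comp; under eq_fun do rewrite EFinD; exact: integrableD. Qed.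

Lemma integZ U f (c : R) : mbl U -> integ U f -> integ U (fun x => c * f x).
Proof. by move=> mU fi; rewrite /integ /comp; under eq_fun do rewrite EFinM; exact: integrableZl. Qed.

Lemma integN U f : mbl U -> integ U f -> integ U (fun x => - f x).
Proof. by move=> mU fi; rewrite /integ /comp; under eq_fun do rewrite EFinN; exact: integrableN. Qed.

Lemma integB U f g : mbl U -> integ U f -> integ U g -> integ U (fun x => f x - g x).
Proof. by move=> mU fi gi; apply: integD => //; exact: integN. Qed.

Lemma integ0 U : mbl U -> integ U (fun=> 0).
Proof. by move=> mU; exact: integrable0. Qed.

Lemma integ_sum U (I : Type) (r : seq I) (F : I -> E -> R) : mbl U ->
  (forall i : I, integ U (F i)) -> integ U (fun x => \sum_(i <- r) F i x).
Proof.
move=> mU H; elim: r => [|i r IH].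
  by under eq_fun do rewrite big_nil; exact: integ0.
by under eq_fun do rewrite big_cons; exact: integD.
Qed.

Lemma int3_0 U : int3 U (fun=> 0) = 0.
Proof. by rewrite /int3 /Rintegral integral0. Qed.

Lemma int3_sum U (I : Type) (r : seq I) (F : I -> E -> R) : mbl U ->
  (forall i : I, integ U (F i)) ->
  int3 U (fun x => \sum_(i <- r) F i x) = \sum_(i <- r) int3 U (F i).
Proof.
move=> mU H; elim: r => [|i r IH].
  by under eq_fun do rewrite big_nil; rewrite big_nil int3_0.
under eq_fun do rewrite big_cons; rewrite int3D// ?IH ?big_cons//.
exact: integ_sum.
Qed.

Lemma int3_ge0 U f : (forall x, U x -> 0 <= f x) -> 0 <= int3 U f.
Proof. by move=> f0; apply: Rintegral_ge0 => p; exact: f0. Qed.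

Lemma int3_le U f g : mbl U -> integ U f -> integ U g ->
  (forall x, U x -> f x <= g x) -> int3 U f <= int3 U g.
Proof. by move=> mU fi gi fg; apply: le_Rintegral => // p; exact: fg. Qed.

Lemma integ_norm U f : integ U f -> integ U (fun x => `|f x|).
Proof. by move=> fi; have := integrable_abse fi; congr (integrable _ _ _). Qed.

Lemma int3_eq U f g : (forall x, U x -> f x = g x) -> int3 U f = int3 U g.
Proof. by move=> fg; apply: eq_Rintegral => p; rewrite inE; exact: fg. Qed.

Lemma integ_eq U f g : mbl U -> (forall x, U x -> f x = g x) -> integ U f -> integ U g.
Proof. by move=> mU fg; apply: eq_integrable => // p; rewrite inE => /fg /= ->. Qed.

Lemma integ_le U f g : mbl U -> measurable_on U f ->
  (forall x, U x -> `|f x| <= g x) -> integ U g -> integ U f.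
Proof.
move=> mU mf fg; apply: le_integrable => //; first exact/measurable_EFinP.
move=> p Up /=; rewrite lee_fin; apply: le_trans (fg _ Up) _; exact: ler_norm.
Qed.

Lemma integS U V f : mbl U -> mbl V -> V `<=` U -> integ U f -> integ V f.
Proof. by move=> mU mV VU; apply: integrableS => // p; exact: VU. Qed.

(** ** Functions vanishing outside a cube *)

Definition cube (r : R) : set E := box (const_mx (- r)) (const_mx r).

Lemma mbl_cube r : mbl (cube r).
Proof. exact: measurable_box. Qed.

Lemma leb3_box a b : (forall i, a i 0 <= b i 0) ->
  mu (@vec3 R @^-1` box a b) = (\prod_i (b i 0 - a i 0))%:E.
Proof.
move=> ab.
have -> : @vec3 R @^-1` box a b =
    (`]a 0 0, b 0 0[%classic `*` `]a 1 0, b 1 0[%classic) `*` `]a 2%:R 0, b 2%:R 0[%classic.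
  apply/seteqP; split => [p /forall_I3[]|p [[/= h0 h1] h2]].
    by rewrite !vec3E => h0 h1 h2; rewrite /= !in_itv.
  by apply/forall_I3; rewrite !vec3E; move: h0 h1 h2; rewrite /= !in_itv.
have lb i : lebesgue_measure (`]a i 0, b i 0[%classic : set R) = (b i 0 - a i 0)%:E.
  rewrite lebesgue_measure_itv/= lte_fin; case: ltP => // ba.
  by rewrite (_ : b i 0 = a i 0) ?subrr//; apply/le_anti; rewrite ab ba.
transitivity (((b 0 0 - a 0 0)%:E * (b 1 0 - a 1 0)%:E) * (b 2%:R 0 - a 2%:R 0)%:E)%E.
  rewrite [LHS]product_measure1E//; last exact: measurableX.
  congr (_ * _)%E; last exact: lb.
  by rewrite [LHS]product_measure1E//; congr (_ * _)%E; exact: lb.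
rewrite -!EFinM; congr EFin.
by rewrite big_ord_recl big_ord_recl big_ord_recl big_ord0 mulr1 mulrA;
  congr (_ * (b _ 0 - a _ 0) * (b _ 0 - a _ 0)); apply/val_inj.
Qed.

Lemma leb3_cube r : 0 <= r -> mu (@vec3 R @^-1` cube r) = ((2 * r) ^+ 3)%:E.
Proof.
move=> r0; rewrite leb3_box => [|i]; last by rewrite !mxE; lra.
congr EFin; rewrite (eq_bigr (fun=> 2 * r)); last by move=> i _; rewrite !mxE; ring.
by rewrite prodr_const card_ord.
Qed.

Lemma in_cube x r : `|x| < r -> cube r x.
Proof.
move=> xr i; rewrite !mxE -ltr_norml.
by apply: le_lt_trans xr; exact: cv_coord_le.
Qed.

Lemma cubeE x r : cube r x -> `|x| <= r.
Proof.
move=> H; have r0 : 0 <= r by have := H 0; rewrite !mxE => /andP[]; lra.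
rewrite cv_norm_le//; apply/forallP => i.
by have := H i; rewrite !mxE -ltr_norml => /ltW.
Qed.

Lemma integrable_bounded_off d (T : measurableType d) (m : {measure set T -> \bar R})
    (D A : set T) (f : T -> R) (M : R) :
  measurable D -> measurable A -> (m A < +oo)%E -> measurable_fun D f ->
  (forall y : T, D y -> `|f y| <= M) -> (forall y : T, D y -> ~ A y -> f y = 0) ->
  m.-integrable D (EFin \o f).
Proof.
move=> mD mA Afin mf fM f0.
have mC : measurable (D `&` A) by exact: measurableI.
have iC : m.-integrable (D `&` A) (EFin \o f).
  apply: measurable_bounded_integrable => //.
  - by apply: le_lt_trans Afin; apply: le_measure; rewrite ?inE.
  - by apply: measurable_funS mf => // p [].
  - by exists M; split; [exact: num_real|move=> y My p [Dp _] /=; apply: le_trans (fM _ Dp) (ltW My)].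
move: iC => /(integrable_mkcond _ mC) => iC.
apply/(integrable_mkcond _ mD); apply: eq_integrable iC => // p _.
rewrite /patch; case: ifPn => [|nC]; first by rewrite inE => -[Dp _]; rewrite ifT// inE.
case: ifPn => //; rewrite inE => Dp /=; rewrite f0// => Ap.
by move: nC; rewrite notin_setE; apply.
Qed.

Lemma integ_bounded U f (M r : R) : mbl U -> measurable_on U f -> 
  (forall x, U x -> `|f x| <= M) -> (forall x, U x -> r <= `|x| -> f x = 0) -> integ U f.
Proof.
move=> mU mf fM f0.
apply: (@integrable_bounded_off _ _ _ _ (@vec3 R @^-1` cube `|r|) _ M) => //.
- exact: mbl_cube.
- by have -> := leb3_cube (normr_ge0 r); rewrite ltry.
- by move=> p; exact: fM.
- move=> p Up nC; apply: f0 => //; rewrite leNgt; apply/negP => h; apply: nC.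
  by apply: in_cube; apply: lt_le_trans h _; exact: ler_norm.
Qed.

Lemma continuous_bounded_on f r : continuous f ->
  exists2 M, 0 <= M & forall x, `|x| <= r -> `|f x| <= M.
Proof.
move=> cf; have cB : compact [set x : E | `|x| <= r].
  apply: cv_bounded_closed_compact.
    by exists r; split; [exact: num_real|move=> y ry x /= xr; apply: le_trans xr (ltW ry)].
  rewrite (_ : [set x : E | _] = (fun x : E => `|x|) @^-1` `]-oo, r]%classic); last first.
    by apply/seteqP; split => x /=; rewrite in_itv.
  by apply: preimage_closed; [move=> y _; exact: norm_continuous|exact: interval_closed].
have : compact (f @` [set x : E | `|x| <= r]).
  by apply: continuous_compact => //; exact: continuous_subspaceT.
move=> /compact_bounded[M [Mr HM]].
exists (Num.max M 0 + 1); first by rewrite addr_ge0// le_max lexx orbT.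
move=> x xr; apply: (HM (Num.max M 0 + 1)); last by exists x.
by rewrite ltr_pwDr// le_max lexx.
Qed.

Lemma integ_continuous U f r : mbl U -> continuous f ->
  (forall x, U x -> r <= `|x| -> f x = 0) -> integ U f.
Proof.
move=> mU cf f0; have [M M0 HM] := continuous_bounded_on r cf.
apply: (@integ_bounded _ _ M r) => //; first exact: continuous_measurable_on.
move=> x Ux; have [xr|xr] := leP r `|x|; first by rewrite f0// normr0.
by rewrite HM// ltW.
Qed.

Lemma int3_setT_sub U f : mbl U -> measurable_on setT f -> (forall x, ~ U x -> f x = 0) ->
  int3 setT f = int3 U f.
Proof.
move=> mU mf f0; rewrite /int3 [RHS]Rintegral_mkcond preimage_setT.
apply: eq_Rintegral => p _; rewrite /patch; case: ifPn => //.
by rewrite notin_setE => /f0.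
Qed.

(** ** Integrals of derivatives *)

Lemma int1_derivative (h h' : R -> R) (r : R) : 0 < r -> continuous h' ->
  (forall t : R, is_derive t 1 h (h' t)) -> (forall t : R, r <= `|t| -> h t = 0) ->
  (\int[@lebesgue_measure R]_t (h' t)%:E)%E = 0%E.
Proof.
move=> r0 ch' dh h0.
have h'0 t : r < `|t| -> h' t = 0.
  move=> rt; have [_ <-] := dh t; rewrite -(derive_cst (0 : R) t 1).
  apply: near_eq_derive.
  have : \forall s \near t, r < `|s|.
    exact: (cvgr_gt _ (@norm_continuous _ _ t)).
  by apply: filterS => s rs; rewrite h0// ltW.
have ch : continuous h by apply: derivable_continuous => t; have [] := dh t.
pose I : set R := `[- (r + 1), r + 1]%classic.
have -> : (\int[@lebesgue_measure R]_t (h' t)%:E = \int[@lebesgue_measure R]_(t in I) (h' t)%:E)%E.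
  rewrite [RHS]integral_mkcond; apply: eq_integral => t _; rewrite /patch.
  case: ifPn => //; rewrite notin_setE /I/= in_itv/= -ler_norml => /negP; rewrite -ltNge => rt.
  by rewrite h'0//; lra.
rewrite (@continuous_FTC2 _ h' h).
- by rewrite !h0 ?subee// ?normrN ger0_norm; lra.
- lra.
- exact: continuous_subspaceT.
- split; [by move=> t _; have [] := dh t|exact: (cvg_at_right_filter (ch _))|exact: (cvg_at_left_filter (ch _))].
- by move=> t _; rewrite derive1E; have [] := dh t.
Qed.

Lemma int1_partial g (dg : E -> R) i r x : continuous dg ->
  (forall x, is_derive x (delta_mx i 0) g (dg x)) ->
  (forall x, r <= `|x| -> g x = 0) ->
  (\int[@lebesgue_measure R]_t (dg (x + t *: delta_mx i 0))%:E)%E = 0%E.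
Proof.
move=> cdg ddg g0; apply: (@int1_derivative (fun t => g (x + t *: delta_mx i 0)) _ (`|r| + `|x| + 1)).
- by rewrite ltr_pwDr// addr_ge0.
- move=> t; apply: (@continuous_comp _ _ _ (fun t : R => x + t *: delta_mx i 0) dg).
    exact: (cvgD (cvg_cst x) (cvgZr_tmp (@cvg_id _ (nbhs t)) )).
  exact: cdg.
- by move=> t; exact: ((is_derive_line g x (delta_mx i 0) t _).1 (ddg _)).
- move=> t rt; apply: g0.
  have H : `|t| <= `|x + t *: delta_mx i 0 : E| + `|x|.
    apply: (@le_trans _ _ `|t *: delta_mx i 0 : E|).
      by have := cv_coord_le (t *: delta_mx i 0 : E) i; rewrite !mxE !eqxx mulr1.
    by have := ler_normB (x + t *: delta_mx i 0) x; rewrite addrAC subrr add0r.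
  by have := ler_norm r; lra.
Qed.

(** The planar measure, packed as a sigma-finite measure so that Fubini applies
    to the triple product. *)
Definition leb2 : set (T1 * T1)%type -> \bar R := (@lebesgue_measure R \x @lebesgue_measure R)%E.
HB.instance Definition _ := Measure.copy leb2 (@lebesgue_measure R \x @lebesgue_measure R)%E.
Let leb2_sigma_finite : sigma_finite setT leb2.
Proof.
pose J (n : nat) : set T1 := `]- n%:R, n%:R[%classic.
have mJ n : measurable (J n) by exact: measurable_itv.
exists (fun n => J n `*` J n).
  apply/seteqP; split=> // -[x y] _; exists (Num.truncn (Num.max `|x| `|y|)).+1 => //.
  have := truncnS_gt (Num.max `|x| `|y|); rewrite gt_max => /andP[hx hy].
  by split; rewrite /J /= in_itv/= -ltr_norml.
move=> n; split; first exact: measurableX.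
rewrite [ltLHS](_ : _ = (@lebesgue_measure R (J n) * @lebesgue_measure R (J n))%E); last exact: product_measure1E.
by rewrite lebesgue_measure_itv/=; case: ifP => _; rewrite ?mul0e// -EFinM ltry.
Qed.
HB.instance Definition _ := Measure_isSigmaFinite.Build _ _ _ leb2 leb2_sigma_finite.

Lemma leb3E : @leb3 R = (leb2 \x @lebesgue_measure R)%E :> {measure set T3 -> \bar R}.
Proof. reflexivity. Qed.

Lemma integral_prod_eq0l d1 d2 (X : measurableType d1) (Y : measurableType d2)
    (m1 : {sigma_finite_measure set X -> \bar R})
    (m2 : {sigma_finite_measure set Y -> \bar R}) (f : X * Y -> \bar R) :
  (m1 \x m2)%E.-integrable setT f ->
  (forall u, \int[m2]_v f (u, v) = 0)%E -> (\int[m1 \x m2]_p f p = 0)%E.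
Proof.
move=> fi f0; rewrite -(integral12_prod_meas1 fi) -[RHS](@integral0 _ _ _ m1 setT).
by apply: eq_integral => u _; exact: f0.
Qed.

Lemma integral_prod_eq0r d1 d2 (X : measurableType d1) (Y : measurableType d2)
    (m1 : {sigma_finite_measure set X -> \bar R})
    (m2 : {sigma_finite_measure set Y -> \bar R}) (f : X * Y -> \bar R) :
  (m1 \x m2)%E.-integrable setT f ->
  (forall v, \int[m1]_u f (u, v) = 0)%E -> (\int[m1 \x m2]_p f p = 0)%E.
Proof.
move=> fi f0; rewrite -(integral21_prod_meas1 fi) -[RHS](@integral0 _ _ _ m2 setT).
by apply: eq_integral => v _; exact: f0.
Qed.

(** The divergence theorem for compactly supported functions: Fubini, with
    the innermost integral along the direction of differentiation. *)
Lemma int3_partial_eq0 g (dg : E -> R) i r : continuous dg ->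
  (forall x, is_derive x (delta_mx i 0) g (dg x)) ->
  (forall x, r <= `|x| -> g x = 0) -> int3 setT dg = 0.
Proof.
move=> cdg ddg g0.
have dg0 x : r < `|x| -> dg x = 0.
  move=> rx; have [_ <-] := ddg x; rewrite -(derive_cst (0 : R) x (delta_mx i 0)).
  apply: near_eq_derive.
  have : \forall s \near x, r < `|s|.
    exact: (cvgr_gt _ (@norm_continuous _ _ x)).
  by apply: filterS => s rs; rewrite g0// ltW.
have mdg := continuous_measurable cdg.
have idg : integ setT dg.
  apply: (@integ_continuous _ _ (`|r| + 1)) => //; first exact: mblT.
  by move=> x _ rx; rewrite dg0//; have := ler_norm r; lra.
have [M M0 HM] : exists2 M, 0 <= M & forall x, `|dg x| <= M.
  have [M M0 HM] := continuous_bounded_on r cdg; exists M => // x.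
  by have [|rx] := leP `|x| r; [exact: HM|rewrite dg0// normr0].
rewrite /int3 /Rintegral preimage_setT.
have {}idg : mu.-integrable setT (fun p => (dg (vec3 p))%:E) by rewrite /integ preimage_setT in idg.
rewrite leb3E in idg *.
have line x : (\int[@lebesgue_measure R]_t (dg (x + t *: delta_mx i 0))%:E)%E = 0%E.
  exact: int1_partial g0.
have i2 (t : R) : (@lebesgue_measure R \x @lebesgue_measure R)%E.-integrable setT
     (fun q : T1 * T1 => (dg (vec3 (q, t)))%:E).
  pose J : set R := `](- (`|r| + 1)), (`|r| + 1)[%classic.
  have mJ : measurable (J : set T1) by exact: measurable_itv.
  apply: (@integrable_bounded_off _ (T1 * T1)%type (@lebesgue_measure R \x @lebesgue_measure R)%E setT (J `*` J) (fun q : T1 * T1 => dg (vec3 (q, t))) M) => //.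
  - exact: measurableX.
  - rewrite [ltLHS](_ : _ = (@lebesgue_measure R J * @lebesgue_measure R J)%E); last exact: product_measure1E.
    by rewrite lebesgue_measure_itv/=; case: ifP => _; rewrite ?mul0e// -EFinM ltry.
  - have := measurableT_comp mdg (measurable_pair2 t); exact.
  - move=> -[u v] _ nJ; apply: dg0; rewrite ltNge; apply/negP => h; apply: nJ.
    have h0 := le_trans (cv_coord_le _ 0) h; have h1 := le_trans (cv_coord_le _ 1) h.
    move: h0 h1; rewrite !vec3E/= => h0 h1; have rr := ler_norm r.
    by split; rewrite /J /= in_itv/= -ltr_norml; lra.
suff -> : (\int[leb2 \x @lebesgue_measure R]_p (dg (vec3 p))%:E)%E = 0%E by [].
have vE i' (p q : T3) (t : R) : (forall j, vec3 p j 0 = vec3 q j 0 + t * (j == i')%:R) ->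
    vec3 p = vec3 q + t *: delta_mx i' 0.
  by move=> H; apply/matrixP => j k; rewrite (ord1 k) H !mxE andbT.
have [] : [\/ i = 0, i = 1 | i = 2%:R].
  have := @forall_I3 (fun i => [\/ i = 0, i = 1 | i = 2%:R]).
  by case=> _ /(_ _ i); apply; split; [constructor 1|constructor 2|constructor 3].
- move=> i0; rewrite i0 in line.
  apply: (@integral_prod_eq0r _ _ _ _ leb2 _ _ idg) => t; apply: (integral_prod_eq0r (i2 t)) => v.
  rewrite -[RHS](line (vec3 ((0, v), t))).
  apply: eq_integral => u _; congr (dg _)%:E; apply: vE.
  by apply/forall_I3; rewrite !vec3E/=; split; ring.
- move=> i0; rewrite i0 in line.
  apply: (@integral_prod_eq0r _ _ _ _ leb2 _ _ idg) => t; apply: (integral_prod_eq0l (i2 t)) => u.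
  rewrite -[RHS](line (vec3 ((u, 0), t))).
  apply: eq_integral => v _; congr (dg _)%:E; apply: vE.
  by apply/forall_I3; rewrite !vec3E/=; split; ring.
- move=> i0; rewrite i0 in line.
  apply: (@integral_prod_eq0l _ _ _ _ leb2 _ _ idg) => -[u v].
  rewrite -[RHS](line (vec3 ((u, v), 0))).
  apply: eq_integral => t _; congr (dg _)%:E; apply: vE.
  by apply/forall_I3; rewrite !vec3E/=; split; ring.
Qed.

End Integrals.

(** * Test functions and weak derivatives *)

Section TestFunctions.
Context {R : realType}.
Local Notation E := 'cV[R]_3.
Local Notation mu := (@leb3 R).
Implicit Types (U K : set E) (f g phi : E -> R) (a b x : E) (i : 'I_3) (r : R).

Definition vanishing r f := forall x, r <= `|x| -> f x = 0.

Lemma partial_vanishing r f i : vanishing r f -> vanishing (r + 1) (partial i f).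
Proof.
move=> f0 x rx; rewrite /partial -(derive_cst (0 : R) x (delta_mx i 0)).
apply: near_eq_derive.
have : \forall s \near x, r < `|s|.
  by apply: (cvgr_gt _ (@norm_continuous _ _ x)); apply: lt_le_trans rx; rewrite ltrDl.
by apply: filterS => s rs; rewrite f0// ltW.
Qed.

Lemma int3_by_parts f g i r : Ck 1 f -> Ck 1 g -> vanishing r g ->
  int3 setT (fun x => f x * partial i g x) = - int3 setT (fun x => partial i f x * g x).
Proof.
move=> Cf Cg g0.
have [cf cg] : continuous f /\ continuous g by split; apply: Ck_continuous; eassumption.
have [cdf cdg] : continuous (partial i f) /\ continuous (partial i g).
  by split; apply: (@Ck_continuous _ _ 0); exact: Ck_partial.
have c1 : continuous (fun x => f x * partial i g x) by move=> x; exact: (cvgM (cf x) (cdg x)).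
have c2 : continuous (fun x => partial i f x * g x) by move=> x; exact: (cvgM (cdf x) (cg x)).
have i1 : integ setT (fun x => f x * partial i g x).
  apply: (@integ_continuous _ _ _ (r + 1)) => //; first exact: mblT.
  by move=> x _ rx; rewrite (partial_vanishing i g0 rx) mulr0.
have i2 : integ setT (fun x => partial i f x * g x).
  apply: (@integ_continuous _ _ _ r) => //; first exact: mblT.
  by move=> x _ rx; rewrite g0// mulr0.
apply/eqP; rewrite -addr_eq0 -int3D//; last exact: mblT.
apply/eqP; apply: (@int3_partial_eq0 _ (fun x => f x * g x) _ i r).
- by move=> x; exact: (cvgD (c1 x) (c2 x)).
- move=> x; apply: is_derive_eq (is_deriveM (CkS_derive i Cf x) (CkS_derive i Cg x)) _.
  by rewrite /GRing.scale/= [X in _ + X]mulrC.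
- by move=> x rx; rewrite g0// mulr0.
Qed.

Lemma test_function_Ck U f k : test_function U f -> Ck k f.
Proof. by case. Qed.

Lemma test_function_continuous U f : test_function U f -> continuous f.
Proof. by move=> /test_function_Ck-/(_ 0%N). Qed.

Lemma test_function_eq0 U f x : test_function U f -> ~ U x -> f x = 0.
Proof.
move=> [_ [_ H]] nU; apply/eqP; apply: contra_notT nU => fx; apply: H.
exact: subset_closure.
Qed.

Lemma compact_bound K : compact K -> exists2 r, 0 < r & forall x, K x -> `|x| < r.
Proof.
move=> /compact_bounded[M [Mr HM]]; exists (Num.max M 0 + 2).
  by rewrite ltr_wpDl// le_max lexx orbT.
move=> x Kx; apply: (@le_lt_trans _ _ (Num.max M 0 + 1)).
  by apply: (HM (Num.max M 0 + 1)) => //; rewrite ltr_pwDr// le_max lexx.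
by rewrite ltrD2l ltr1n.
Qed.

Lemma compact_supp_vanishing U f : compact_supp_in U f -> exists2 r, 0 < r & vanishing r f.
Proof.
move=> [cK _]; have [r r0 H] := compact_bound cK; exists r => // x rx.
apply/eqP; apply: contraLR rx => fx; rewrite -ltNge; apply: H.
exact: subset_closure.
Qed.

Lemma compact_supp_intro U K f : compact K -> K `<=` U -> (forall x, ~ K x -> f x = 0) ->
  compact_supp_in U f.
Proof.
move=> cK KU f0.
have cl : closure [set x | f x != 0] `<=` K.
  have -> : K = closure K by apply/closure_id; apply: compact_closed => //; exact: norm_hausdorff.
  by apply: closure_subset => x /= fx; apply: contrapT => /f0 E0; rewrite E0 eqxx in fx.
split; last exact: subset_trans cl KU.
by apply: subclosed_compact cK cl; exact: closed_closure.
Qed.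

Lemma partial_support f i : [set x | partial i f x != 0] `<=` closure [set x | f x != 0].
Proof.
move=> x /= dfx; apply: contrapT => nx.
have : nbhs x (~` closure [set x | f x != 0]).
  by apply: open_nbhs_nbhs; split => //; apply: closed_openC; exact: closed_closure.
move=> H; move/eqP : dfx; apply.
rewrite /partial -(derive_cst (0 : R) x (delta_mx i 0)); apply: near_eq_derive.
apply: filterS H => y ny; apply/eqP; apply: contra_notT ny => fy.
exact: subset_closure.
Qed.

Lemma test_function_partial U f i : test_function U f -> test_function U (partial i f).
Proof.
move=> [Cf [cK KU]]; split; first by move=> k; apply: Ck_partial; exact: Cf.
apply: compact_supp_intro cK KU _ => x nx; apply/eqP; apply: contra_notT nx.
exact: partial_support.
Qed.

Lemma mbl_open U : open U -> mbl U.
Proof. exact: measurable_open. Qed.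

Lemma mbl_compact K : compact K -> mbl K.
Proof.
by move=> cK; apply: measurable_closed; apply: compact_closed => //; exact: norm_hausdorff.
Qed.

Lemma integ_compact_continuous K f : compact K -> continuous f -> integ K f.
Proof.
move=> cK cf; have [r r0 H] := compact_bound cK.
apply: (@integ_continuous _ _ _ r) => //; first exact: mbl_compact.
by move=> x /H; rewrite ltNge => /negP.
Qed.

Lemma measurable_on_sub U V f : mbl U -> V `<=` U -> measurable_on U f -> measurable_on V f.
Proof. by move=> mU VU; apply: measurable_funS => // p; exact: VU. Qed.

Lemma integP U f : integ U f <-> measurable_on U f /\ (eint3 U (fun x => `|f x|%R) < +oo)%E.
Proof.
split=> [fi|[mf fi]]; last by apply/integrableP; split => //; exact/measurable_EFinP.
by split; [exact: integ_measurable_on|move/integrableP : fi => []].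
Qed.

Lemma L1loc_integ U K f : open U -> L1loc U f -> compact K -> K `<=` U -> integ K f.
Proof.
move=> oU [mf H] cK KU; apply/integP; split; last exact: H.
by apply: measurable_on_sub mf => //; exact: mbl_open.
Qed.

Lemma continuous_L1loc U f : open U -> continuous f -> L1loc U f.
Proof.
move=> oU cf; split; first by apply: continuous_measurable_on => //; exact: mbl_open.
by move=> K cK _; have /integP[] := integ_compact_continuous cK cf.
Qed.

Lemma measurable_onD U f g : measurable_on U f -> measurable_on U g ->
  measurable_on U (fun x => f x + g x).
Proof. by move=> mf mg; exact: measurable_funD. Qed.

Lemma measurable_onM U f g : measurable_on U f -> measurable_on U g ->
  measurable_on U (fun x => f x * g x).
Proof. by move=> mf mg; exact: measurable_funM. Qed.

Lemma measurable_on_cst U (c : R) : measurable_on U (fun=> c).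
Proof. exact: measurable_cst. Qed.

Lemma integ_mul_bounded U f g (M : R) : mbl U -> integ U f -> measurable_on U g ->
  (forall x, U x -> `|g x| <= M) -> integ U (fun x => f x * g x).
Proof.
move=> mU fi mg gM.
apply: (@integ_le _ _ _ (fun x => M * `|f x|)) => //.
- by apply: measurable_onM => //; exact: integ_measurable_on.
- by move=> x Ux; rewrite normrM mulrC ler_wpM2r// gM.
- by apply: integZ => //; exact: integ_norm.
Qed.

Lemma L1loc_test U f phi : open U -> L1loc U f -> test_function U phi ->
  integ U (fun x => f x * phi x).
Proof.
move=> oU Lf tphi; have [Cphi [cK KU]] := tphi.
set K := closure _ in cK KU.
have cphi := test_function_continuous tphi.
have [r r0 Hr] := compact_bound cK.
have [M M0 HM] := continuous_bounded_on r cphi.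
have mU := mbl_open oU; have mK := mbl_compact cK.
have iK : integ K (fun x => f x * phi x).
  apply: (@integ_mul_bounded _ _ _ M) => //.
  - exact: L1loc_integ Lf cK KU.
  - exact: continuous_measurable_on.
  - by move=> x Kx; apply: HM; apply: ltW; exact: Hr.
apply/(integrable_mkcond _ mU); move: iK => /(integrable_mkcond _ mK).
apply: eq_integrable => // p _; rewrite /patch.
case: ifPn => [|pK]; first by rewrite inE => Kp; rewrite ifT// inE; exact: KU.
case: ifPn => // _; rewrite /= (_ : phi _ = 0) ?mulr0//.
apply/eqP; apply: contraNT pK => pp; rewrite inE; exact: subset_closure.
Qed.

(** Integration by parts: no boundary term appears, as the test function
    vanishes near the boundary. *)
Lemma C1_wderiv U f i : open U -> Ck 1 f -> is_wderiv U i f (partial i f).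
Proof.
move=> oU Cf; have cf := Ck_continuous Cf.
have cdf : continuous (partial i f) by apply: (@Ck_continuous _ _ 0); exact: Ck_partial.
split; [exact: continuous_L1loc|exact: continuous_L1loc|move=> phi tphi].
have [_ cs] := tphi; have [r r0 phi0] := compact_supp_vanishing cs.
have tdphi := test_function_partial i tphi.
have := int3_by_parts i Cf (test_function_Ck 1 tphi) phi0.
have cphi := test_function_continuous tphi; have cdphi := test_function_continuous tdphi.
have mU := mbl_open oU.
rewrite (int3_setT_sub mU) ?(int3_setT_sub mU (f := fun x => partial i f x * phi x))//.
- by apply: continuous_measurable_on; [exact: mblT|move=> x; exact: (cvgM (cdf x) (cphi x))].
- by move=> x nU; rewrite (test_function_eq0 tphi nU) mulr0.
- by apply: continuous_measurable_on; [exact: mblT|move=> x; exact: (cvgM (cf x) (cdphi x))].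
- by move=> x nU; rewrite (test_function_eq0 tdphi nU) mulr0.
Qed.

(** ** The fundamental lemma of the calculus of variations *)

Definition cbox a b : set E := [set x | forall i, a i 0 <= x i 0 <= b i 0].

Lemma box_cbox a b : box a b `<=` cbox a b.
Proof. by move=> x H i; have /andP[h1 h2] := H i; rewrite !ltW. Qed.

Lemma cbox_compact a b : compact (cbox a b).
Proof.
apply: cv_bounded_closed_compact.
  exists (`|a| + `|b|); split; first by rewrite num_real.
  move=> r Hr x /= Hx; rewrite cv_norm_le; last by apply: ltW; apply: le_lt_trans Hr; exact: addr_ge0.
  apply/forallP => i; have /andP[h1 h2] := Hx i.
  have ha := cv_coord_le a i; have hb := cv_coord_le b i.
  move: ha hb; rewrite !ler_norml => /andP[ha1 ha2] /andP[hb1 hb2].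
  by have a0 := normr_ge0 a; have b0 := normr_ge0 b; apply/andP; split; lra.
have -> : cbox a b = \bigcap_(i in [set: 'I_3]) ((fun x : E => x i 0) @^-1` `[a i 0, b i 0]%classic).
  apply/seteqP; split => [x H i _|x H i]; first by rewrite /= in_itv/=; exact: H.
  by have := H i Logic.I; rewrite /= in_itv.
apply: closed_bigI => i _; apply: preimage_closed; last exact: interval_closed.
by move=> x _; exact: coord_continuous.
Qed.

(** Smooth, and converging pointwise to the indicator of the box as [n] grows. *)
Definition bump n a b x : R :=
  \prod_i (step (n%:R * (x i 0 - a i 0)) * step (n%:R * (b i 0 - x i 0))).

Lemma bump_01 n a b x : 0 <= bump n a b x <= 1.
Proof.
rewrite /bump; apply: (big_ind (fun y : R => 0 <= y <= 1)); first by rewrite ler01 lexx.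
  by move=> y z /andP[y0 y1] /andP[z0 z1]; rewrite mulr_ge0//= mulr_ile1.
move=> i _.
have /andP[h0 h1] := step_01 (n%:R * (x i 0 - a i 0)).
have /andP[k0 k1] := step_01 (n%:R * (b i 0 - x i 0)).
by rewrite mulr_ge0//= mulr_ile1.
Qed.

Lemma bump_out n a b x : ~ box a b x -> bump n a b x = 0.
Proof.
move=> nb; have [i Hi] : exists i, ~~ (a i 0 < x i 0 < b i 0).
  by apply: contra_notP nb => /forallNP H i; apply/negPn/negP; exact: H.
rewrite /bump (bigD1 i)//=; move: Hi; rewrite negb_and -!leNgt => /orP[h|h].
  by rewrite step_le0 ?mul0r// mulr_ge0_le0// subr_le0.
by rewrite (@step_le0 _ (_ * (b i 0 - _))) ?mulr0 ?mul0r// mulr_ge0_le0// subr_le0.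
Qed.

Lemma bump_in a b x : box a b x -> \forall n \near \oo, bump n a b x = 1.
Proof.
move=> Hx.
have H (c : R) : 0 < c -> \forall n \near \oo, 1 <= n%:R * c.
  move=> c0; exists (Num.truncn c^-1).+1 => // n /= Hn.
  rewrite -ler_pdivrMr// mul1r; apply: (@le_trans _ _ (Num.truncn c^-1).+1%:R); first by rewrite ltW// truncnS_gt.
  by rewrite ler_nat.
have : \forall n \near \oo, forall i, 1 <= n%:R * (x i 0 - a i 0) /\ 1 <= n%:R * (b i 0 - x i 0).
  apply: filter_forall => i; have /andP[h1 h2] := Hx i.
  by apply: filterI; apply: H; rewrite subr_gt0.
apply: filterS => n Hn; rewrite /bump big1// => i _.
by have [h1 h2] := Hn i; rewrite !step_ge1// mul1r.
Qed.

Lemma Ck_bump k n a b : Ck k (bump n a b).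
Proof.
suff H (s : seq 'I_3) : Ck k (fun x => \prod_(i <- s) (step (n%:R * (x i 0 - a i 0)) * step (n%:R * (b i 0 - x i 0)))) by exact: H.
elim: s => [|i s IH].
  by under eq_fun do rewrite big_nil; exact: Ck_cst.
under eq_fun do rewrite big_cons.
apply: CkM => //; apply: CkM; apply: Ck_comp1; try exact: smooth_step.
  by apply: CkZ; apply: CkB; [exact: Ck_coord|exact: Ck_cst].
by apply: CkZ; apply: CkB; [exact: Ck_cst|exact: Ck_coord].
Qed.

Lemma test_function_bump U n a b : cbox a b `<=` U -> test_function U (bump n a b).
Proof.
move=> bU; split; first by move=> k; exact: Ck_bump.
apply: compact_supp_intro (@cbox_compact a b) bU _ => x nx.
by apply: bump_out => /box_cbox.
Qed.

Lemma int3_box_eq0 U f a b : open U -> L1loc U f ->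
  (forall phi, test_function U phi -> int3 U (fun x => f x * phi x) = 0) ->
  cbox a b `<=` U -> int3 (box a b) f = 0.
Proof.
move=> oU Lf H bU.
have mU := mbl_open oU; have mB : mbl (box a b) by exact: measurable_box.
have BU : box a b `<=` U by apply: subset_trans bU; exact: box_cbox.
have iB : integ (box a b) f.
  have cb := @cbox_compact a b.
  apply: integS (L1loc_integ oU Lf cb bU) => //; [exact: mbl_compact|exact: box_cbox].
have E0 n : (\int[mu]_(p in @vec3 R @^-1` box a b) (f (vec3 p) * bump n a b (vec3 p))%:E)%E = 0%E.
  have tb := test_function_bump n bU.
  have := H _ tb; rewrite /int3 Rintegral_mkcond.
  have -> : (fun p => f (vec3 p) * bump n a b (vec3 p)) \_ (@vec3 R @^-1` U) =
            (fun p => f (vec3 p) * bump n a b (vec3 p)) \_ (@vec3 R @^-1` box a b).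
    apply/funext => p; rewrite /patch; case: ifPn => [|pU].
      by move=> _; case: ifPn => //; rewrite notin_setE => /bump_out ->; rewrite mulr0.
    by case: ifPn => //; rewrite inE => /BU pB; move: pU; rewrite notin_setE.
  rewrite -Rintegral_mkcond /Rintegral => /eqP; rewrite fine_eq0.
    by move=> /eqP.
  apply: integrable_fin_num => //.
  apply: (@integ_mul_bounded _ _ (bump n a b) 1) => //.
    by apply: continuous_measurable_on => //; exact: (test_function_continuous tb).
  by move=> x _; have /andP[h0 h1] := bump_01 n a b x; rewrite ger0_norm.
pose F n (p : measurableTypeR R * measurableTypeR R * measurableTypeR R) := (f (vec3 p) * bump n a b (vec3 p))%:E.
have mf : measurable_fun (@vec3 R @^-1` box a b) (fun p => (f (vec3 p))%:E).
  by apply/measurable_EFinP; exact: integ_measurable_on iB.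
have h1 n : measurable_fun (@vec3 R @^-1` box a b) (F n).
  apply/measurable_EFinP; apply: measurable_onM; first exact: integ_measurable_on iB.
  by apply: continuous_measurable_on => //; apply: (@Ck_continuous _ _ 0); exact: Ck_bump.
have h2 : {ae mu, forall p, (@vec3 R @^-1` box a b) p -> F n p @[n --> \oo] --> (f (vec3 p))%:E}.
  apply: aeW => p Bp; apply: cvg_near_cst.
  by have := bump_in Bp; apply: filterS => n E1; rewrite /F E1 mulr1.
have h3 : {ae mu, forall p, forall n, (@vec3 R @^-1` box a b) p -> (`|F n p| <= `|(f (vec3 p))%:E|)%E}.
  apply: aeW => p n Bp; rewrite /F lee_fin normrM.
  have /andP[k0 k1] := bump_01 n a b (vec3 p).
  by rewrite (ger0_norm k0) ler_piMr.
have [_ _] := dominated_convergence mB h1 mf h2 (integrable_abse iB) h3.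
rewrite (_ : [sequence _]_n = cst 0%E); last by apply/funext => n; exact: E0.
by move=> /(cvg_unique _ (cvg_cst _)) E1; rewrite /int3 /Rintegral -E1.
Qed.

Lemma box_setI a b a' b' : box a b `&` box a' b' =
  box (\col_i Num.max (a i 0) (a' i 0)) (\col_i Num.min (b i 0) (b' i 0)).
Proof.
apply/seteqP; split => [x [h h'] i|x h].
  by rewrite !mxE gt_max lt_min; have /andP[-> ->] := h i; have /andP[-> ->] := h' i.
by split=> i; have := h i; rewrite !mxE gt_max lt_min => /andP[/andP[h1 h2] /andP[h3 h4]]; rewrite ?h1 ?h2 ?h3 ?h4.
Qed.

(** Dynkin's lemma carries the vanishing of the integral from boxes to all
    measurable sets. *)
Lemma ae_eq0_box f a b : integ (box a b) f ->
  (forall a' b', cbox a' b' `<=` cbox a b -> int3 (box a' b') f = 0) ->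
  ae_on (box a b) (fun x => f x = 0).
Proof.
move=> iB H.
have mB : measurable (@vec3 R @^-1` box a b) by exact: measurable_box.
have cbI a' b' : int3 (box a b `&` box a' b') f = 0.
  rewrite box_setI; apply: H => x Hx i.
  by have := Hx i; rewrite !mxE ge_max le_min => /andP[/andP[-> _] /andP[-> _]].
pose P (A : set _) := (\int[mu]_(p in A `&` @vec3 R @^-1` box a b) (f (vec3 p))%:E = 0)%E.
have fin A : measurable A -> mu.-integrable (A `&` @vec3 R @^-1` box a b) (fun p => (f (vec3 p))%:E).
  by move=> mA; apply: integrableS iB => //; exact: measurableI.
have PB a' b' : P (@vec3 R @^-1` box a' b').
  have := cbI a' b'; rewrite setIC /int3 /Rintegral => /eqP; rewrite fine_eq0; first by move/eqP.
  by apply: integrable_fin_num; [apply: measurableI => //|apply: fin]; exact: measurable_box.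
have PA A : measurable A -> P A.
  rewrite measurable_boxes; apply: (dynkin_induction measurable_boxes).
  - move=> _ _ [[a1 b1] _ <-] [[a2 b2] _ <-] /=; rewrite -preimage_setI box_setI.
    by exists (\col_i Num.max (a1 i 0) (a2 i 0), \col_i Num.min (b1 i 0) (b2 i 0)).
  - by have := PB a b; rewrite /P setIid setTI.
  - by move=> _ [[a1 b1] _ <-]; exact: PB.
  - move=> S mS PS.
    pose I A := (\int[mu]_(p in A `&` @vec3 R @^-1` box a b) (f (vec3 p))%:E)%E.
    suff : (I S + I (~` S))%E = 0%E by rewrite {1}/I PS add0e.
    rewrite -integral_setU_EFin//=.
    + by rewrite -setIUl setUv setTI; have := PB a b; rewrite /P setIid.
    + exact: measurableI.
    + by apply: measurableI => //; exact: measurableC.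
    + by rewrite -setIUl setUv setTI; exact: (integ_measurable_on iB).
    + by apply/disj_setPS => p [[h _] [nh _]].
  - move=> F mF tF PF; rewrite /P setI_bigcupl.
    rewrite integral_bigcup.
    + by apply: eseries0 => n _ _; exact: PF.
    + exact: trivIset_setIr.
    + by move=> n; exact: measurableI.
    + by rewrite -setI_bigcupl; apply: fin; exact: bigcup_measurable.
have ae0 : ae_eq mu (@vec3 R @^-1` box a b) (fun p => (f (vec3 p))%:E) (cst 0%E).
  apply: integral_ae_eq => // A AB mA; rewrite integral0.
  by have := PA A mA; rewrite /P (_ : A `&` _ = A)//; exact/setIidl.
by apply: filterS ae0 => p Hp Bp; have [] := Hp Bp.
Qed.

(** Bumps converge to the indicator of a box, so the integral over every
    box inside the open set vanishes; boxes determine the function, and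
    countably many cubes cover the open set. *)
Lemma fundamental_lemma U f : open U -> L1loc U f ->
  (forall phi, test_function U phi -> int3 U (fun x => f x * phi x) = 0) ->
  ae_on U (fun x => f x = 0).
Proof.
move=> oU Lf H.
pose good (u : 'cV[rat]_3 * nat) := ball (map_mx (@ratr R) u.1 : E) (2 / u.2.+1%:R) `<=` U.
have cube_ae u : good u -> ae_on (ratcube u) (fun x => f x = 0).
  move=> gu; have n0 : 0 < (u.2.+1%:R^-1 : R) by rewrite invr_gt0.
  rewrite /ratcube ball_box//; set a := _ - _; set b := _ + _.
  have abU : cbox a b `<=` U.
    move=> x Hx; apply: gu; rewrite ball_box ?mulr_gt0// => i.
    move: n0 (Hx i); rewrite !mxE mulrC; move: (_^-1) => d d0 /andP[h1 h2].
    by apply/andP; split; lra.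
  have cb := @cbox_compact a b.
  apply: ae_eq0_box => [|a' b' sub].
    apply: integS (L1loc_integ oU Lf cb abU); [exact: mbl_compact|exact: measurable_box|exact: box_cbox].
  by apply: int3_box_eq0 oU Lf H _; exact: subset_trans sub abU.
pose N k := [set p | exists2 u, unpickle k = Some u & good u /\ ratcube u (vec3 p) /\ f (vec3 p) != 0].
have negN : mu.-negligible (\bigcup_k N k).
  apply: negligible_bigcup => k; rewrite /N.
  case E : (unpickle k : option ('cV[rat]_3 * nat)%type) => [u|]; last first.
    by apply: negligibleS (negligible_set0 _) => p [u].
  have [gu|ngu] := pselect (good u); last first.
    by apply: negligibleS (negligible_set0 _) => p [v [<-]] [].
  apply: negligibleS (cube_ae u gu) => p [v [<-]] [_ [cp fp]] /=.
  by move=> /(_ cp) f0; rewrite f0 eqxx in fp.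
apply: negligibleS negN => p /= /not_implyP[Up fp].
move: Up; rewrite {1}(open_ratcubes oU) => -[u gu cu].
by exists (pickle u) => //; exists u; [exact: pickleK|split => //; split => //; exact/eqP].
Qed.

Lemma L1locB U f g : open U -> L1loc U f -> L1loc U g -> L1loc U (fun x => f x - g x).
Proof.
move=> oU Lf Lg; split; first by apply: measurable_funB; [case: Lf|case: Lg].
move=> K cK KU; have mK := mbl_compact cK.
by have /integP[] := integB mK (L1loc_integ oU Lf cK KU) (L1loc_integ oU Lg cK KU).
Qed.

Lemma wderiv_unique U i f g1 g2 : open U -> is_wderiv U i f g1 -> is_wderiv U i f g2 ->
  ae_on U (fun x => g1 x = g2 x).
Proof.
move=> oU [_ L1 H1] [_ L2 H2]; have mU := mbl_open oU.
have : ae_on U (fun x => g1 x - g2 x = 0).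
  apply: fundamental_lemma => //; first exact: L1locB.
  move=> phi tphi; have i1 := L1loc_test oU L1 tphi; have i2 := L1loc_test oU L2 tphi.
  rewrite (_ : (fun x => _) = (fun x => g1 x * phi x - g2 x * phi x)).
    have e := H1 _ tphi; rewrite (H2 _ tphi) in e; move/oppr_inj: e => e.
    by rewrite int3B// e subrr.
  by apply/funext => x; rewrite mulrBl.
by rewrite /ae_on; apply: filterS => p H Up; apply/eqP; rewrite -subr_eq0; apply/eqP/H.
Qed.

Lemma wderivP U i f : (exists g, is_wderiv U i f g) -> is_wderiv U i f (wderiv U i f).
Proof. by move=> H; rewrite /wderiv; apply: (@xgetPex _ _ [set g | is_wderiv U i f g]). Qed.

(** Without a weak derivative, the chosen representative is the zero function. *)
Lemma wderiv_measurable U i f : measurable_on U (wderiv U i f).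
Proof.
have [/wderivP[_ [] //]|nex] := pselect (exists g, is_wderiv U i f g).
rewrite /wderiv xgetPN; first exact: measurable_on_cst.
by move=> g Hg; apply: nex; exists g.
Qed.

(** This is what replaces weak derivatives by classical ones in every integral
    against a smooth field. *)
Lemma wderiv_C1 U i f : open U -> Ck 1 f -> ae_on U (fun x => wderiv U i f x = partial i f x).
Proof.
move=> oU Cf; have H := C1_wderiv i oU Cf.
by apply: (wderiv_unique oU (wderivP _) H); exists (partial i f).
Qed.

Lemma ae_onS U (P Q : E -> Prop) : (forall x, U x -> P x -> Q x) -> ae_on U P -> ae_on U Q.
Proof. by rewrite /ae_on => PQ H; apply: filterS H => p Hp Up; apply: PQ => //; exact: Hp. Qed.

Lemma ae_eq_int3 U f g : mbl U -> measurable_on U f -> measurable_on U g ->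
  ae_on U (fun x => f x = g x) -> int3 U f = int3 U g.
Proof.
move=> mU mf mg H; congr fine; apply: ae_eq_integral => //; try exact/measurable_EFinP.
by rewrite /ae_on in H; apply: filterS H => p Hp Up; rewrite Hp.
Qed.

Lemma ae_eq_integ U f g : mbl U -> measurable_on U f -> measurable_on U g ->
  ae_on U (fun x => f x = g x) -> integ U f -> integ U g.
Proof.
move=> mU mf mg H /integP[_ Hf]; apply/integP; split=> //.
rewrite /eint3; rewrite -(@ae_eq_integral _ _ _ _ _ _ (fun p => `|f (vec3 p)|%:E))//.
- by apply/measurable_EFinP; apply: measurableT_comp.
- by apply/measurable_EFinP; apply: measurableT_comp.
- by rewrite /ae_on in H; apply: filterS H => p Hp Up; rewrite Hp.
Qed.

Lemma L2P U f : L2 U f <-> measurable_on U f /\ integ U (fun x => f x ^+ 2).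
Proof.
have E1 : eint3 U (fun x => `|f x ^+ 2|%R) = eint3 U (fun x => (f x ^+ 2)%R).
  by congr eint3; apply/funext => x; rewrite ger0_norm ?sqr_ge0.
split=> -[mf H]; split=> //.
  by apply/integP; rewrite E1; split => //; exact: measurable_onM.
by move/integP : H => []; rewrite E1.
Qed.

Lemma L2_measurable U f : L2 U f -> measurable_on U f.
Proof. by case. Qed.

Lemma L2_sqr U f : L2 U f -> integ U (fun x => f x ^+ 2).
Proof. by move=> /L2P[]. Qed.

Lemma L2_mul U f g : mbl U -> L2 U f -> L2 U g -> integ U (fun x => f x * g x).
Proof.
move=> mU Lf Lg; apply: (@integ_le _ _ _ (fun x => f x ^+ 2 + g x ^+ 2)) => //.
- by apply: measurable_onM; exact: L2_measurable.
- move=> x _; rewrite normrM -(real_normK (num_real (f x))) -(real_normK (num_real (g x))).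
  move: (normr_ge0 (f x)) (normr_ge0 (g x)); move: `|f x| `|g x| => s t s0 t0.
  by have := sqr_ge0 (s - t); have := mulr_ge0 s0 t0; rewrite sqrrB; lra.
- by apply: integD => //; exact: L2_sqr.
Qed.

Lemma L2D U f g : mbl U -> L2 U f -> L2 U g -> L2 U (fun x => f x + g x).
Proof.
move=> mU Lf Lg; apply/L2P; split; first by apply: measurable_onD; exact: L2_measurable.
rewrite (_ : (fun x => _) = (fun x => f x ^+ 2 + (2 * (f x * g x) + g x ^+ 2))).
  by apply: integD => //; [exact: L2_sqr|apply: integD => //; [apply: integZ => //; exact: L2_mul|exact: L2_sqr]].
by apply/funext => x; ring.
Qed.

Lemma L2Z U f (c : R) : mbl U -> L2 U f -> L2 U (fun x => c * f x).
Proof.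
move=> mU Lf; apply/L2P; split.
  by apply: measurable_onM; [exact: measurable_on_cst|exact: L2_measurable].
rewrite (_ : (fun x => _) = (fun x => c ^+ 2 * f x ^+ 2)); last by apply/funext => x; rewrite exprMn.
by apply: integZ => //; exact: L2_sqr.
Qed.

Lemma L2B U f g : mbl U -> L2 U f -> L2 U g -> L2 U (fun x => f x - g x).
Proof.
move=> mU Lf /(L2Z (-1) mU) /(L2D mU Lf); congr (L2 U _).
by apply/funext => x; rewrite mulN1r.
Qed.

Lemma L2_sum U (I : Type) (s : seq I) (F : I -> E -> R) : mbl U ->
  (forall i : I, L2 U (F i)) -> L2 U (fun x => \sum_(i <- s) F i x).
Proof.
move=> mU H; elim: s => [|i s IH].
  under eq_fun do rewrite big_nil; apply/L2P; split; first exact: measurable_on_cst.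
  by under eq_fun do rewrite expr0n; exact: integ0.
by under eq_fun do rewrite big_cons; exact: L2D.
Qed.

Lemma L2_ae U f g : mbl U -> measurable_on U g ->
  ae_on U (fun x => f x = g x) -> L2 U f -> L2 U g.
Proof.
move=> mU mg H /L2P[mf Hf]; apply/L2P; split => //.
apply: ae_eq_integ Hf => //; do ?exact: measurable_onM.
by apply: ae_onS H => x _ ->.
Qed.

Lemma L2_continuous U f r : mbl U -> continuous f ->
  (forall x, U x -> r <= `|x| -> f x = 0) -> L2 U f.
Proof.
move=> mU cf f0; apply/L2P; split; first exact: continuous_measurable_on.
apply: (@integ_continuous _ _ _ r) => //; first by move=> x; exact: (cvgM (cf x) (cf x)).
by move=> x Ux rx; rewrite f0// expr0n.
Qed.

Lemma Hk_C1 U f : open U -> Ck 1 f -> L2 U f -> (forall i, L2 U (partial i f)) -> Hk U 1 f.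
Proof.
move=> oU Cf Lf Ldf; split => // i; split; first by exists (partial i f); exact: C1_wderiv.
apply: L2_ae (Ldf i); [exact: mbl_open|exact: wderiv_measurable|].
by apply: ae_onS (wderiv_C1 i oU Cf) => x _ ->.
Qed.

End TestFunctions.

(** * The energy method *)

Section ScalarCalculus.
Context {R : realType}.
Implicit Types (h k : R -> R) (s t e : R).

(** Differentiability on the half-line, one-sided at 0. *)
Definition sder h h' := forall t, 0 <= t -> forall e, 0 < e ->
  exists2 d, 0 < d & forall s, 0 <= s -> `|s - t| < d ->
    `|h s - h t - (s - t) * h' t| <= e * `|s - t|.

(** Monotonicity stands in for integration in time: each bound compares a function
    of time with an explicit one. *)
Lemma sder_ndecr h h' T : 0 <= T -> sder h h' ->
  (forall t, 0 <= t <= T -> 0 <= h' t) -> h 0 <= h T.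
Proof.
move=> T0 dh h'0.
have ch : {within `[0, T], continuous h}.
  apply/subspace_continuousP => t /=; rewrite in_itv/= => /andP[t0 tT].
  apply/cvgrPdist_le => e e0.
  have [d d0 Hd] := dh t t0 1 ltr01.
  have c0 : 0 < 1 + `|h' t| by rewrite ltr_pwDl.
  have m0 : 0 < Num.min d (e / (1 + `|h' t|)) by rewrite lt_min d0 divr_gt0.
  apply/nbhs_ballP; exists (Num.min d (e / (1 + `|h' t|))) => //= s.
  rewrite /ball/= distrC => sd; rewrite in_itv/= => /andP[s0 sT].
  move: sd; rewrite lt_min => /andP[sd1]; rewrite ltr_pdivlMr// => sd2.
  have := Hd s s0 sd1; rewrite mul1r => Hs.
  have : `|h t - h s| <= `|h s - h t - (s - t) * h' t| + `|(s - t) * h' t|.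
    by rewrite distrC -{1}(subrK ((s - t) * h' t) (h s - h t)) ler_normD.
  by rewrite normrM; move: Hs sd2; rewrite mulrDr mulr1; lra.
have dh1 t : t \in `]0, T[ -> is_derive t 1 h (h' t).
  rewrite in_itv/= => /andP[t0 tT].
  have cv : x^-1 *: ((h \o shift t) (x *: 1) - h t) @[x --> 0^'] --> h' t.
    apply/cvgrPdist_le => e e0.
    have [d d0 Hd] := dh t (ltW t0) e e0.
    near=> x.
    have x0 : x != 0 by near: x; exact: nbhs_dnbhs_neq.
    have xd : `|x| < Num.min d t.
      by near: x; apply: dnbhs0_lt; rewrite lt_min d0 t0.
    move: xd; rewrite lt_min => /andP[xd xt].
    have := Hd (x + t); rewrite addrK => /(_ _ xd) H.
    rewrite /= [x *: 1]mulr1 distrC -(ler_pM2l (_ : 0 < `|x|)) ?normr_gt0//.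
    rewrite -normrM mulrBr /GRing.scale/= mulVKf// [leRHS]mulrC; apply: H.
    by move: xt; rewrite ltr_norml => /andP[]; lra.
  by apply: DeriveDef; [apply/cvg_ex; eexists; exact: cv|exact/cvg_lim].
have [T00|T00] := eqVneq T 0; first by rewrite T00.
have TT : 0 < T by rewrite lt_neqAle eq_sym T00.
have [c] := MVT TT dh1 ch.
rewrite in_itv/= subr0 => /andP[c0 cT] E0.
by rewrite -subr_ge0 E0 mulr_ge0// h'0// !ltW.
Unshelve. all: by end_near. Qed.

Lemma sderD h h' k k' : sder h h' -> sder k k' ->
  sder (fun t => h t + k t) (fun t => h' t + k' t).
Proof.
move=> dh dk t t0 e e0; have e20 : 0 < e / 2 by rewrite divr_gt0.
have [d d0 Hd] := dh t t0 _ e20; have [c c0 Hc] := dk t t0 _ e20.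
exists (Num.min d c); first by rewrite lt_min d0.
move=> s s0; rewrite lt_min => /andP[sd sc].
have -> : h s + k s - (h t + k t) - (s - t) * (h' t + k' t) =
  (h s - h t - (s - t) * h' t) + (k s - k t - (s - t) * k' t) by ring.
apply: le_trans (ler_normD _ _) _.
by have := Hd s s0 sd; have := Hc s s0 sc; lra.
Qed.

Lemma sderZ c h h' : sder h h' -> sder (fun t => c * h t) (fun t => c * h' t).
Proof.
move=> dh t t0 e e0.
have c0 : 0 < `|c| + 1 by rewrite ltr_wpDl.
have [d d0 Hd] := dh t t0 (e / (`|c| + 1)) (divr_gt0 e0 c0).
exists d => // s s0 sd.
have -> : c * h s - c * h t - (s - t) * (c * h' t) = c * (h s - h t - (s - t) * h' t) by ring.
rewrite normrM; apply: (@le_trans _ _ ((`|c| + 1) * (e / (`|c| + 1) * `|s - t|))).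
  by apply: ler_pM => //; [rewrite lerDl|exact: Hd].
by rewrite mulrA mulrCA divff ?gt_eqF// mulr1.
Qed.

Lemma sder_eq h h' k k' : h =1 k -> h' =1 k' -> sder h h' -> sder k k'.
Proof. by move=> /funext -> /funext ->. Qed.

Lemma sderN h h' : sder h h' -> sder (fun t => - h t) (fun t => - h' t).
Proof. by move=> /(sderZ (-1)); apply: sder_eq => t; rewrite mulN1r. Qed.

Lemma sder_id : sder id (fun=> 1).
Proof.
by move=> t _ e e0; exists 1 => // s _ _; rewrite mulr1 subrr normr0 mulr_ge0// ltW.
Qed.

Lemma sder_sqr : sder (fun t => t ^+ 2) (fun t => 2 * t).
Proof.
move=> t _ e e0; exists e => // s _ se.
have -> : s ^+ 2 - t ^+ 2 - (s - t) * (2 * t) = (s - t) * (s - t) by ring.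
by rewrite normrM ler_wpM2r// ltW.
Qed.

Lemma sder_bounded h h' t : 0 <= t -> sder h h' ->
  exists2 d, 0 < d & forall s, 0 <= s -> `|s - t| < d ->
    `|h s - h t| <= (`|h' t| + 1) * `|s - t|.
Proof.
move=> t0 dh; have [d d0 Hd] := dh t t0 1 ltr01; exists d => // s s0 sd.
rewrite -[X in `|X|](subrK ((s - t) * h' t) (h s - h t)); apply: le_trans (ler_normD _ _) _.
by have := Hd s s0 sd; rewrite normrM; lra.
Qed.

Lemma sderM h h' k k' : sder h h' -> sder k k' ->
  sder (fun t => h t * k t) (fun t => h' t * k t + h t * k' t).
Proof.
move=> dh dk t t0 e e0.
have [d1 d10 H1] := sder_bounded t0 dh.
pose M := `|k t| + `|h t| + (`|h' t| + 1) + 1.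
have M0 : 0 < M by rewrite ltr_wpDl// !addr_ge0.
have [d2 d20 H2] := sder_bounded t0 dk.
pose e' := e / (3 * M).
have e'0 : 0 < e' by rewrite divr_gt0// mulr_gt0.
have [d3 d30 H3] := dh t t0 _ e'0; have [d4 d40 H4] := dk t t0 _ e'0.
pose K := (`|h' t| + 1) * (`|k' t| + 1).
have K0 : 0 < K by rewrite mulr_gt0// ltr_wpDl.
exists (Num.min (Num.min d1 d2) (Num.min (Num.min d3 d4) (e / (3 * K)))).
  by rewrite !lt_min d10 d20 d30 d40 divr_gt0// mulr_gt0.
move=> s s0; rewrite !lt_min => /andP[/andP[s1 s2] /andP[/andP[s3 s4] s5]].
have -> : h s * k s - h t * k t - (s - t) * (h' t * k t + h t * k' t) =
  k t * (h s - h t - (s - t) * h' t) + h t * (k s - k t - (s - t) * k' t)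
  + (h s - h t) * (k s - k t) by ring.
have A1 : `|k t * (h s - h t - (s - t) * h' t)| <= e / 3 * `|s - t|.
  rewrite normrM; apply: (@le_trans _ _ (M * (e' * `|s - t|))).
    by apply: ler_pM => //; [rewrite /M -!addrA lerDl !addr_ge0|exact: H3].
  by rewrite /e' mulrA le_eqVlt; apply/orP; left; apply/eqP; field; rewrite gt_eqF.
have A2 : `|h t * (k s - k t - (s - t) * k' t)| <= e / 3 * `|s - t|.
  rewrite normrM; apply: (@le_trans _ _ (M * (e' * `|s - t|))).
    by apply: ler_pM => //; [rewrite /M -!addrA addrCA lerDl !addr_ge0|exact: H4].
  by rewrite /e' mulrA le_eqVlt; apply/orP; left; apply/eqP; field; rewrite gt_eqF.
have A3 : `|(h s - h t) * (k s - k t)| <= e / 3 * `|s - t|.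
  rewrite normrM; apply: (@le_trans _ _ (((`|h' t| + 1) * `|s - t|) * ((`|k' t| + 1) * `|s - t|))).
    by apply: ler_pM => //; [exact: H1|exact: H2].
  rewrite mulrACA -/K mulrA ler_wpM2r//.
  move: s5; rewrite ltr_pdivlMr ?mulr_gt0// => /ltW.
  by rewrite ler_pdivlMr//; lra.
apply: le_trans (ler_normD _ _) _; have := ler_normD (k t * (h s - h t - (s - t) * h' t)) (h t * (k s - k t - (s - t) * k' t)).
lra.
Qed.

End ScalarCalculus.

(** An abstract wave equation in a space with a semi-definite form [b], which is
    a form only on the vectors satisfying [L]: here fields, with the L^2 pairing
    and square-integrability.  Pairing the unknown with vectors leaves only real
    functions of time to differentiate. *)
Section Energy.
Context {R : realType} {V : lmodType R}.
Variables (L : V -> Prop) (b : V -> V -> R).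
Hypothesis LD : forall u v, L u -> L v -> L (u + v).
Hypothesis LZ : forall (c : R) u, L u -> L (c *: u).
Hypothesis bC : forall u v, b u v = b v u.
Hypothesis bD : forall u v w, L u -> L v -> L w -> b (u + v) w = b u w + b v w.
Hypothesis bZ : forall (c : R) u v, L u -> L v -> b (c *: u) v = c * b u v.
Hypothesis b_ge0 : forall u, L u -> 0 <= b u u.

Definition nrm u := Num.sqrt (b u u).

Let LN u : L u -> L (- u).
Proof. by move=> /(LZ (-1)); rewrite scaleN1r. Qed.

Let LB u v : L u -> L v -> L (u - v).
Proof. by move=> Lu Lv; apply: LD => //; exact: LN. Qed.

Let bN u v : L u -> L v -> b (- u) v = - b u v.
Proof. by move=> Lu Lv; rewrite -scaleN1r bZ// mulN1r. Qed.

Let bB u v w : L u -> L v -> L w -> b (u - v) w = b u w - b v w.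
Proof. by move=> Lu Lv Lw; rewrite bD ?bN//; exact: LN. Qed.

Let bDr u v w : L u -> L v -> L w -> b w (u + v) = b w u + b w v.
Proof. by move=> Lu Lv Lw; rewrite !(bC w) bD. Qed.

Let bBr u v w : L u -> L v -> L w -> b w (u - v) = b w u - b w v.
Proof. by move=> Lu Lv Lw; rewrite !(bC w) bB. Qed.

Let bZr (c : R) u v : L u -> L v -> b v (c *: u) = c * b v u.
Proof. by move=> Lu Lv; rewrite !(bC v) bZ. Qed.

Lemma nrm_sqr u : L u -> nrm u ^+ 2 = b u u.
Proof. by move=> Lu; rewrite sqr_sqrtr// b_ge0. Qed.

Lemma nrm_ge0 u : 0 <= nrm u.
Proof. exact: sqrtr_ge0. Qed.

Lemma cauchy_schwarz u v : L u -> L v -> `|b u v| <= nrm u * nrm v.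
Proof.
move=> Lu Lv.
have Q (t : R) : 0 <= b u u + 2 * t * b u v + t ^+ 2 * b v v.
  have L1 : L (t *: v) by exact: LZ.
  have := b_ge0 (LD Lu L1).
  have Luv : L (u + t *: v) by exact: LD.
  rewrite (bD Lu L1 Luv) (bDr Lu L1 Lu) (bDr Lu L1 L1) (bZr t Lv Lu) (bZ t Lv Lu) (bZ t Lv L1) (bZr t Lv Lv) (bC v u).
  by move=> H; apply: le_trans H _; rewrite le_eqVlt; apply/orP; left; apply/eqP; ring.
rewrite -ler_sqr ?nnegrE ?mulr_ge0 ?nrm_ge0// exprMn !nrm_sqr// real_normK ?num_real//.
have [v0|v0] := eqVneq (b v v) 0.
  have [->|c0] := eqVneq (b u v) 0; first by rewrite expr0n v0 mulr0.
  have := Q (- (b u u + 1) / (2 * b u v)).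
  rewrite v0 mulr0 addr0 (_ : 2 * _ * _ = - (b u u + 1)); last by field.
  by rewrite opprD addrA subrr add0r oppr_ge0 ler10.
have vp : 0 < b v v by rewrite lt_neqAle eq_sym v0 b_ge0.
have := mulr_ge0 (Q (- b u v / b v v)) (ltW vp).
have -> : (b u u + 2 * (- b u v / b v v) * b u v + (- b u v / b v v) ^+ 2 * b v v) * b v v
  = b u u * b v v - b u v ^+ 2 by field.
by rewrite subr_ge0.
Qed.

Lemma nrmD u v : L u -> L v -> nrm (u + v) <= nrm u + nrm v.
Proof.
move=> Lu Lv; rewrite -ler_sqr ?nnegrE ?addr_ge0 ?nrm_ge0// nrm_sqr; last exact: LD.
have Luv : L (u + v) by exact: LD.
rewrite sqrrD !nrm_sqr// (bD Lu Lv Luv) (bDr Lu Lv Lu) (bDr Lu Lv Lv) (bC v u).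
have := cauchy_schwarz Lu Lv; have := ler_norm (b u v).
by rewrite -mulr_natr; lra.
Qed.

Lemma nrmZ (c : R) u : L u -> nrm (c *: u) = `|c| * nrm u.
Proof.
move=> Lu; rewrite /nrm (bZ c Lu (LZ c Lu)) (bZr c Lu Lu).
by rewrite mulrA -expr2 sqrtrM ?sqr_ge0// sqrtr_sqr.
Qed.

Definition vder (w w' : R -> V) := forall t, 0 <= t -> forall e, 0 < e ->
  exists2 d, 0 < d & forall s, 0 <= s -> `|s - t| < d ->
    nrm (w s - w t - (s - t) *: w' t) <= e * `|s - t|.

Definition vcont (w : R -> V) := forall t, 0 <= t -> forall e, 0 < e ->
  exists2 d, 0 < d & forall s, 0 <= s -> `|s - t| < d -> nrm (w s - w t) <= e.

Lemma vder_form (w w' : R -> V) g : (forall t, 0 <= t -> L (w t)) ->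
  (forall t, 0 <= t -> L (w' t)) -> L g -> vder w w' ->
  sder (fun t => b (w t) g) (fun t => b (w' t) g).
Proof.
move=> Lw Lw' Lg dw t t0 e e0.
have c0 : 0 < nrm g + 1 by rewrite ltr_wpDl// nrm_ge0.
have [d d0 Hd] := dw t t0 (e / (nrm g + 1)) (divr_gt0 e0 c0).
exists d => // s s0 sd.
have Ld : L (w s - w t) by apply: LB; exact: Lw.
have Lz : L ((s - t) *: w' t) by apply: LZ; exact: Lw'.
have -> : b (w s) g - b (w t) g - (s - t) * b (w' t) g = b (w s - w t - (s - t) *: w' t) g.
  by rewrite bB// bB ?bZ//; [exact: Lw'|exact: Lw|exact: Lw].
apply: le_trans (cauchy_schwarz _ Lg) _; first exact: LB.
apply: (@le_trans _ _ ((e / (nrm g + 1) * `|s - t|) * (nrm g + 1))).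
  by apply: ler_pM; rewrite ?nrm_ge0//; [exact: Hd|rewrite lerDl].
by rewrite le_eqVlt; apply/orP; left; apply/eqP; field; rewrite gt_eqF.
Qed.

Lemma vder_bounded (w w' : R -> V) t : 0 <= t -> (forall t, 0 <= t -> L (w t)) ->
  (forall t, 0 <= t -> L (w' t)) -> vder w w' ->
  exists2 d, 0 < d & forall s, 0 <= s -> `|s - t| < d ->
    nrm (w s - w t) <= (nrm (w' t) + 1) * `|s - t|.
Proof.
move=> t0 Lw Lw' dw; have [d d0 Hd] := dw t t0 1 ltr01; exists d => // s s0 sd.
have Ld : L (w s - w t) by apply: LB; exact: Lw.
have Lz : L ((s - t) *: w' t) by apply: LZ; exact: Lw'.
rewrite -(subrK ((s - t) *: w' t) (w s - w t)).
apply: le_trans (nrmD _ Lz) _; first exact: LB.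
rewrite nrmZ; last exact: Lw'.
by rewrite mulrDl mul1r addrC [X in X + _]mulrC lerD2l -[leRHS]mul1r Hd.
Qed.

Lemma vder_sqr (w w' : R -> V) : (forall t, 0 <= t -> L (w t)) ->
  (forall t, 0 <= t -> L (w' t)) -> vder w w' ->
  sder (fun t => b (w t) (w t)) (fun t => 2 * b (w' t) (w t)).
Proof.
move=> Lw Lw' dw t t0 e e0.
have e20 : 0 < e / 2 by rewrite divr_gt0.
have [d1 d10 H1] := vder_form Lw Lw' (Lw t t0) dw t0 (divr_gt0 e20 (ltr0Sn _ 1)).
have [d2 d20 H2] := vder_bounded t0 Lw Lw' dw.
pose M := (nrm (w' t) + 1) ^+ 2.
have M0 : 0 < M by rewrite exprn_gt0// ltr_wpDl// nrm_ge0.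
exists (Num.min (Num.min d1 d2) (e / 2 / M)); first by rewrite !lt_min d10 d20 divr_gt0.
move=> s s0; rewrite !lt_min => /andP[/andP[sd1 sd2] sd3].
have Ls := Lw s s0; have Lt := Lw t t0.
have -> : b (w s) (w s) - b (w t) (w t) - (s - t) * (2 * b (w' t) (w t)) =
   2 * (b (w s) (w t) - b (w t) (w t) - (s - t) * b (w' t) (w t)) + b (w s - w t) (w s - w t).
  have Ld := LB Ls Lt.
  by rewrite bB// !(bC _ (w s - w t)) !bB// (bC (w t) (w s)); ring.
have := H1 s s0 sd1; set X := b (w s) (w t) - _ - _ => HX.
have HY : b (w s - w t) (w s - w t) <= e / 2 * `|s - t|.
  rewrite -nrm_sqr; last exact: LB.
  apply: (@le_trans _ _ (((nrm (w' t) + 1) * `|s - t|) ^+ 2)).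
    by rewrite ler_sqr ?nnegrE ?nrm_ge0 ?mulr_ge0 ?addr_ge0 ?nrm_ge0//; exact: H2.
  rewrite exprMn -/M expr2 mulrA ler_wpM2r// mulrC.
  by move: sd3; rewrite ltr_pdivlMr// => /ltW.
have Y0 : 0 <= b (w s - w t) (w s - w t) by apply: b_ge0; exact: LB.
apply: le_trans (ler_normD _ _) _; rewrite normrM (ger0_norm Y0) ger0_norm//.
by move: HX HY; have := normr_ge0 (s - t); lra.
Qed.

(** The wave equation: [A t] is the divergence of the stress, [- b (A t) (u t)]
    twice the elastic energy. *)
Variables (u ut utt : R -> V) (f : V) (rho : R).
Hypothesis rho_gt0 : 0 < rho.
Hypotheses (Lu : forall t, 0 <= t -> L (u t)) (Lut : forall t, 0 <= t -> L (ut t))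
  (Lutt : forall t, 0 <= t -> L (utt t)) (Lf : L f).
Hypotheses (du : vder u ut) (dut : vder ut utt) (cutt : vcont utt).
Hypotheses (u0 : nrm (u 0) = 0) (ut0 : nrm (ut 0) = 0).
Let A t := rho *: utt t - f.
Hypothesis A_sym : forall s t, 0 <= s -> 0 <= t -> b (A s) (u t) = b (A t) (u s).
Let a t := - b (A t) (u t).
Hypothesis a_ge0 : forall t, 0 <= t -> 0 <= a t.

Let LA t : 0 <= t -> L (A t).
Proof. by move=> t0; apply: LB => //; apply: LZ; exact: Lutt. Qed.

Let b_nrm0 v w : L v -> L w -> nrm v = 0 -> b v w = 0.
Proof.
move=> Lv Lw v0; apply/eqP; rewrite -normr_le0; apply: le_trans (cauchy_schwarz Lv Lw) _.
by rewrite v0 mul0r.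
Qed.

(** The symmetry [A_sym] makes the difference of [a] at times [s] and [t] equal to
    [- b (A s - A t) (u s - u t) - 2 * b (A t) (u s - u t)], so the continuity of
    [A] suffices where its derivative would be expected. *)
Let a_sder : sder a (fun t => - (2 * b (A t) (ut t))).
Proof.
move=> t t0 e e0.
have At := LA t0; have Lt := Lu t0; have Ltt := Lut t0.
have e40 : 0 < e / 4 by rewrite divr_gt0.
pose K := nrm (ut t) + 1.
have K0 : 0 < K by rewrite ltr_wpDl// nrm_ge0.
pose H := nrm (A t) + 1.
have H0 : 0 < H by rewrite ltr_wpDl// nrm_ge0.
have [d1 d10 H1] := du t0 (divr_gt0 e40 H0).
have [d2 d20 H2] := vder_bounded t0 Lu Lut du.
have [d3 d30 H3] := cutt t0 (divr_gt0 (divr_gt0 e40 K0) rho_gt0).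
exists (Num.min (Num.min d1 d2) d3); first by rewrite !lt_min d10 d20 d30.
move=> s s0; rewrite !lt_min => /andP[/andP[sd1 sd2] sd3].
have As := LA s0; have Ls := Lu s0.
have Lus : L (u s - u t) by exact: LB.
have Lz : L ((s - t) *: ut t) by exact: LZ.
have LAB : L (A s - A t) by exact: LB.
have -> : a s - a t - (s - t) * - (2 * b (A t) (ut t)) =
  - (b (A s - A t) (u s - u t) + 2 * b (A t) (u s - u t - (s - t) *: ut t)).
  rewrite /a (bB As At Lus) (bBr Ls Lt As) (bBr Ls Lt At) (bBr Lus Lz At) (bBr Ls Lt At) (bZr _ Ltt At).
  rewrite (A_sym s0 t0); ring.
rewrite normrN; apply: le_trans (ler_normD _ _) _.
have X1 : `|b (A s - A t) (u s - u t)| <= e / 4 * `|s - t|.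
  apply: le_trans (cauchy_schwarz LAB Lus) _.
  apply: (@le_trans _ _ (e / 4 / K * (K * `|s - t|))).
    apply: ler_pM; rewrite ?nrm_ge0//; last exact: H2.
    have -> : A s - A t = rho *: (utt s - utt t).
      by rewrite /A opprB addrA subrK scalerBr.
    rewrite nrmZ; last by apply: LB; exact: Lutt.
    rewrite gtr0_norm// -ler_pdivlMl// mulrC; exact: H3.
  by rewrite mulrA divfK ?gt_eqF.
have X2 : `|b (A t) (u s - u t - (s - t) *: ut t)| <= e / 4 * `|s - t|.
  apply: le_trans (cauchy_schwarz At _) _; first exact: LB.
  apply: (@le_trans _ _ (H * (e / 4 / H * `|s - t|))).
    by apply: ler_pM; rewrite ?nrm_ge0//; [rewrite lerDl|exact: H1].
  by rewrite le_eqVlt; apply/orP; left; apply/eqP; field; rewrite gt_eqF.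
rewrite normrM ger0_norm//; have := normr_ge0 (s - t); nra.
Qed.

(** The energy [En] satisfies [En' = b f ut <= K + En].  On [[0, 1/2]] the factor
    [1 - s] serves as the integrating factor of Gronwall's lemma. *)
Lemma elastic_energy_bound t : 0 <= t <= 2^-1 -> a t <= 2 * t * b f f / rho.
Proof.
move=> /andP[t0 t2].
pose En s := rho / 2 * b (ut s) (ut s) + 2^-1 * a s.
have dE : sder En (fun s => rho / 2 * (2 * b (utt s) (ut s)) + 2^-1 * - (2 * b (A s) (ut s))).
  exact: (sderD (sderZ _ (vder_sqr Lut Lutt dut)) (sderZ _ a_sder)).
have dE' s : 0 <= s -> rho / 2 * (2 * b (utt s) (ut s)) + 2^-1 * - (2 * b (A s) (ut s)) = b f (ut s).
  move=> s0; rewrite /A bB ?bZ//; [|exact: Lutt|exact: Lut|by apply: LZ; exact: Lutt|exact: Lut].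
  by field.
pose K := b f f / (2 * rho).
have K0 : 0 <= K by rewrite divr_ge0 ?b_ge0// mulr_ge0// ltW.
have En0 : En 0 = 0.
  rewrite /En -nrm_sqr ?ut0 ?expr0n ?mulr0 ?add0r; last exact: Lut.
  by rewrite /a bC b_nrm0 ?oppr0 ?mulr0//; [exact: Lu|exact: LA].
have EnK s : 0 <= s -> b f (ut s) <= K + En s.
  move=> s0; have Ls := Lut s0.
  have : b f (ut s) <= K + rho / 2 * b (ut s) (ut s).
    rewrite -!nrm_sqr// /K -nrm_sqr//.
    apply: le_trans (ler_norm _) _; apply: le_trans (cauchy_schwarz Lf Ls) _.
    rewrite -subr_ge0 (_ : _ - _ = (nrm f - rho * nrm (ut s)) ^+ 2 / (2 * rho)).
      by rewrite divr_ge0 ?sqr_ge0// mulr_ge0// ltW.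
    by field; rewrite gt_eqF.
  by have := a_ge0 s0; rewrite /En; lra.
have En_ge0 s : 0 <= s -> 0 <= En s.
  move=> s0; rewrite addr_ge0// mulr_ge0// ?divr_ge0// ?(ltW rho_gt0)//.
  - by rewrite b_ge0//; exact: Lut.
  - exact: a_ge0.
have d1 : sder (fun s : R => 1 + - s) (fun=> 0 + - 1).
  apply: sderD; last by apply: sderN; exact: sder_id.
  by move=> s _ e e0; exists 1 => // r _ _; rewrite subrr mulr0 subr0 normr0 mulr_ge0// ltW.
have dG := sderD (sderZ K sder_id) (sderN (sderM d1 dE)).
have := sder_ndecr t0 dG; rewrite /= mulr0 add0r En0 mulr0 oppr0 addr0 => H.
have {}H : 0 <= K * t - (1 - t) * En t.
  apply: H => s /andP[s0 st]; rewrite dE'// mulr1 mulN1r opprD opprK.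
  have := EnK s s0; have := En_ge0 s s0.
  have s1 : 0 <= 1 - s by lra.
  have s2 : 1 - s <= 1 by lra.
  move=> e0 e1; have : (1 - s) * b f (ut s) <= (1 - s) * (K + En s) by exact: ler_wpM2l.
  have : (1 - s) * (K + En s) <= 1 * (K + En s) by rewrite ler_wpM2r// addr_ge0.
  lra.
have E2 : 2^-1 * En t <= K * t.
  apply: (@le_trans _ _ ((1 - t) * En t)); last by move: H; lra.
  by rewrite ler_wpM2r ?En_ge0//; lra.
have : 0 <= rho / 2 * b (ut t) (ut t).
  by rewrite mulr_ge0 ?divr_ge0// ?(ltW rho_gt0)// b_ge0//; exact: Lut.
have -> : 2 * t * b f f / rho = 4 * (K * t) by rewrite /K; field; rewrite gt_eqF.
by move: E2; rewrite /En; lra.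
Qed.

(** Short times: against a fixed field, the displacement is t^2/2 times the
    source, up to an error that is small relative to the source. *)
Lemma source_bound g (k T : R) : L g -> 0 <= k -> 0 < T <= 2^-1 ->
  (forall t, 0 <= t -> `|b (A t) g| <= k * Num.sqrt (a t)) ->
  `|b f g| <= 2 / T ^+ 2 * `|rho * b (u T) g| + k * Num.sqrt (2 * T / rho) * nrm f.
Proof.
move=> Lg k0 /andP[T0 T2] Hk.
set m := k * Num.sqrt (2 * T / rho) * nrm f; set J := b f g.
have Hm t : 0 <= t <= T -> `|rho * b (utt t) g - J| <= m.
  move=> /andP[t0 tT].
  have -> : rho * b (utt t) g - J = b (A t) g.
    rewrite /A bB ?bZ//; [exact: Lutt|by apply: LZ; exact: Lutt].
  apply: le_trans (Hk t t0) _; rewrite /m -mulrA ler_wpM2l//.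
  rewrite /nrm -sqrtrM; last by rewrite divr_ge0 ?mulr_ge0// ltW.
  rewrite ler_wsqrtr//; apply: le_trans (elastic_energy_bound _) _; first by rewrite t0 (le_trans tT).
  rewrite mulrAC ler_wpM2r ?b_ge0// ler_wpM2r ?invr_ge0 ?(ltW rho_gt0)//.
  by rewrite ler_wpM2l.
have dI := sderZ rho (vder_form Lu Lut Lg du).
have dI' := sderZ rho (vder_form Lut Lutt Lg dut).
have I0 : rho * b (u 0) g = 0 by rewrite b_nrm0 ?mulr0//; exact: Lu.
have I'0 : rho * b (ut 0) g = 0 by rewrite b_nrm0 ?mulr0//; exact: Lut.
(* [c] is a sign; [B1] and [B2] integrate the bound [Hm] once and twice *)
have B1 (c : R) t : 0 <= t <= T -> `|c| = 1 -> 0 <= (m + c * J) * t - c * (rho * b (ut t) g).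
  move=> /andP[t0 tT] c1.
  have := sder_ndecr t0 (sderD (sderZ (m + c * J) sder_id) (sderN (sderZ c dI'))).
  rewrite /= mulr0 I'0 mulr0 oppr0 add0r; apply => s /andP[s0 st].
  have := Hm s; rewrite s0 (le_trans st tT) => /(_ isT) h.
  have : `|c * (rho * b (utt s) g - J)| <= m by rewrite normrM c1 mul1r.
  by rewrite ler_norml mulrBr mulr1 => /andP[_]; lra.
have B2 (c : R) : `|c| = 1 -> 0 <= (m + c * J) * (2^-1 * T ^+ 2) - c * (rho * b (u T) g).
  move=> c1.
  have := sder_ndecr (ltW T0) (sderD (sderZ (m + c * J) (sderZ 2^-1 sder_sqr)) (sderN (sderZ c dI))).
  rewrite /= expr0n /= !mulr0 I0 mulr0 oppr0 add0r; apply => s sT.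
  by have := B1 c s sT c1; rewrite (mulrA 2^-1) mulVf ?pnatr_eq0// mul1r.
have T20 : 0 < T ^+ 2 by rewrite exprn_gt0.
have K1 := B2 1 (normr1 _); have K2 := B2 (-1) (normrN1 _).
set I := rho * b (u T) g in K1 K2 *.
rewrite -(@ler_pM2r _ (T ^+ 2 / 2)) ?divr_gt0// mulrDl.
rewrite (_ : 2 / T ^+ 2 * `|I| * (T ^+ 2 / 2) = `|I|); last by field; rewrite gt_eqF.
have := ler_norm I; have := ler_norm (- I); rewrite normrN => n1 n2.
case: (lerP 0 J) => J0.
  by rewrite ger0_norm//; move: K2; lra.
by rewrite ltr0_norm//; move: K1; lra.
Qed.

End Energy.

(** * Short-time estimate for the elastic displacement *)

(** Vector and matrix fields at once: [c] gives the coordinates of a value and [p]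
    the Euclidean product of two values. *)
Section L2Fields.
Context {R : realType}.
Local Notation E := 'cV[R]_3.
Variables (U : set E) (mU : mbl U) (I : finType) (W : lmodType R).
Variables (c : I -> W -> R) (p : W -> W -> R).
Hypothesis cD : forall i v w, c i (v + w) = c i v + c i w.
Hypothesis cZ : forall i (a : R) v, c i (a *: v) = a * c i v.
Hypothesis pE : forall v w, p v w = \sum_i c i v * c i w.

Definition L2F (F : E -> W) := forall i, L2 U (fun x => c i (F x)).
Definition ip (F G : E -> W) := int3 U (fun x => p (F x) (G x)).

Lemma L2F_D (F G : E -> W) : L2F F -> L2F G -> L2F (F + G).
Proof.
move=> HF HG i; have := L2D mU (HF i) (HG i).
by congr (L2 U _); apply/funext => x; rewrite cD.
Qed.

Lemma L2F_Z (a : R) (F : E -> W) : L2F F -> L2F (a *: F).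
Proof.
move=> HF i; have := L2Z a mU (HF i).
by congr (L2 U _); apply/funext => x; rewrite cZ.
Qed.

Lemma L2F_integ (F G : E -> W) : L2F F -> L2F G -> integ U (fun x => p (F x) (G x)).
Proof.
move=> HF HG; under eq_fun do rewrite pE.
by apply: integ_sum => // i; exact: L2_mul.
Qed.

Lemma ipC (F G : E -> W) : ip F G = ip G F.
Proof.
congr (int3 U _); apply/funext => x; rewrite !pE.
by apply: eq_bigr => i _; rewrite mulrC.
Qed.

Lemma ipD (F G H : E -> W) : L2F F -> L2F G -> L2F H -> ip (F + G) H = ip F H + ip G H.
Proof.
move=> HF HG HH; rewrite /ip -int3D//; [|exact: L2F_integ..].
congr (int3 U _); apply/funext => x; rewrite !pE -big_split.
by apply: eq_bigr => i _; rewrite cD mulrDl.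
Qed.

Lemma ipZ (a : R) (F G : E -> W) : L2F F -> L2F G -> ip (a *: F) G = a * ip F G.
Proof.
move=> HF HG; rewrite /ip -int3Z//; last exact: L2F_integ.
congr (int3 U _); apply/funext => x; rewrite !pE mulr_sumr.
by apply: eq_bigr => i _; rewrite cZ mulrA.
Qed.

Lemma ip_ge0 (F : E -> W) : L2F F -> 0 <= ip F F.
Proof.
move=> HF; apply: int3_ge0 => x _; rewrite pE; apply: sumr_ge0 => i _.
by rewrite -expr2 sqr_ge0.
Qed.

End L2Fields.

Lemma subrACA (V : zmodType) (x y z t : V) : x - y - (z - t) = x - z - (y - t).
Proof. by rewrite !opprB addrACA [RHS]addrACA [- y + _]addrC. Qed.

Section Elastic.
Context {R : realType}.
Local Notation E := 'cV[R]_3.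
Implicit Types (A B : 'M[R]_3) (lambda mu rho : R).

Definition mdot A B : R := \sum_(i : 'I_3 * 'I_3) A i.1 i.2 * B i.1 i.2.

Lemma mdotE A B : mdot A B = \sum_i \sum_j A i j * B i j.
Proof. by rewrite pair_big. Qed.

Lemma I3_eqE : (((0 : 'I_3) == 1) = false) * (((0 : 'I_3) == 2%:R) = false) *
 (((1 : 'I_3) == 0) = false) * (((1 : 'I_3) == 2%:R) = false) *
 (((2%:R : 'I_3) == 0) = false) * (((2%:R : 'I_3) == 1) = false).
Proof. by []. Qed.

Lemma mxtrace3 A : \tr A = A 0 0 + A 1 1 + A 2%:R 2%:R.
Proof. by rewrite /mxtrace sum_I3. Qed.

Lemma stiff_mulE lambda mu A i j : stiff_mul lambda mu A i j =
  lambda * (i == j)%:R * \tr A + mu * (A i j + A j i).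
Proof.
rewrite mxE mxtrace3 !sum_I3 /stiffness.
move: i; apply/forall_I3; split; move: j; apply/forall_I3; split; rewrite ?eqxx ?I3_eqE /=; ring.
Qed.

Lemma stiff_mulB lambda mu A B :
  stiff_mul lambda mu (A - B) = stiff_mul lambda mu A - stiff_mul lambda mu B.
Proof.
apply/matrixP => i j; rewrite [RHS]mxE [X in _ = _ + X]mxE !stiff_mulE raddfB/= !mxE; ring.
Qed.

Lemma stiff_sym lambda mu A B :
  mdot (stiff_mul lambda mu A) B = mdot (stiff_mul lambda mu B) A.
Proof.
rewrite !mdotE !sum_I3 !stiff_mulE !mxtrace3 !(eqxx, I3_eqE) /=; ring.
Qed.

Lemma stiff_ge0 lambda mu A : 0 <= lambda -> 0 <= mu -> 0 <= mdot (stiff_mul lambda mu A) A.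
Proof.
move=> l0 m0.
rewrite (_ : mdot _ _ = lambda * (\tr A) ^+ 2 + mu / 2 * \sum_i \sum_j (A i j + A j i) ^+ 2).
  rewrite addr_ge0// mulr_ge0 ?sqr_ge0 ?divr_ge0//.
  by apply: sumr_ge0 => i _; apply: sumr_ge0 => j _; rewrite sqr_ge0.
rewrite !mdotE !sum_I3 !stiff_mulE !mxtrace3 !(eqxx, I3_eqE) /=; by field.
Qed.

(** Coercivity in the form needed: the stress is controlled by the energy. *)
Lemma stiff_norm_le lambda mu A : 0 <= lambda -> 0 <= mu ->
  mdot (stiff_mul lambda mu A) (stiff_mul lambda mu A) <=
  (3 * lambda + 4 * mu) * mdot (stiff_mul lambda mu A) A.
Proof.
move=> l0 m0; rewrite -subr_ge0.
rewrite (_ : _ - _ = (3 * lambda / 2 + mu) * mu * \sum_i \sum_j (A i j + A j i) ^+ 2).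
  rewrite mulr_ge0// ?mulr_ge0 ?addr_ge0 ?divr_ge0 ?mulr_ge0//.
  by apply: sumr_ge0 => i _; apply: sumr_ge0 => j _; rewrite sqr_ge0.
rewrite !mdotE !sum_I3 !stiff_mulE !mxtrace3 !(eqxx, I3_eqE) /=; by field.
Qed.

Lemma enorm_sqr n (x : 'cV[R]_n) : enorm x ^+ 2 = dot x x.
Proof.
rewrite sqr_sqrtr; last by apply: sumr_ge0 => i _; rewrite sqr_ge0.
by apply: eq_bigr => i _; rewrite expr2.
Qed.

Variables (Om : set E) (oOm : open Om).
Let mOm : mbl Om := mbl_open oOm.

Definition vfield := (L2F Om (fun (i : 'I_3) (v : 'cV[R]_3) => v i 0)).
Definition vip := ip Om (@dot R 3).
Definition mfield := (L2F Om (fun (i : 'I_3 * 'I_3) (A : 'M[R]_3) => A i.1 i.2)).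
Definition mip := ip Om mdot.

Let cD (i : 'I_3) (v w : 'cV[R]_3) : (v + w) i 0 = v i 0 + w i 0. Proof. by rewrite mxE. Qed.
Let cZ (i : 'I_3) (a : R) (v : 'cV[R]_3) : (a *: v) i 0 = a * v i 0. Proof. by rewrite mxE. Qed.
Let dD (i : 'I_3 * 'I_3) A B : (A + B) i.1 i.2 = A i.1 i.2 + B i.1 i.2. Proof. by rewrite mxE. Qed.
Let dZ (i : 'I_3 * 'I_3) (a : R) A : (a *: A) i.1 i.2 = a * A i.1 i.2. Proof. by rewrite mxE. Qed.
Let vpE (v w : 'cV[R]_3) : dot v w = \sum_i v i 0 * w i 0. Proof. by []. Qed.
Let mpE A B : mdot A B = \sum_i A i.1 i.2 * B i.1 i.2. Proof. by []. Qed.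

Definition vfieldD := L2F_D mOm cD.
Definition vfieldZ := L2F_Z mOm cZ.
Definition vipC := @ipC R Om _ _ _ _ vpE.
Definition vipD := ipD mOm cD vpE.
Definition vipZ := ipZ mOm cZ vpE.
Definition vip_ge0 := @ip_ge0 R Om _ _ _ _ vpE.
Definition v_integ := L2F_integ mOm vpE.
Definition mfieldD := L2F_D mOm dD.
Definition mfieldZ := L2F_Z mOm dZ.
Definition m_integ := L2F_integ mOm mpE.
Definition mip_CS := cauchy_schwarz mfieldD mfieldZ (@ipC R Om _ _ _ _ mpE)
  (ipD mOm dD mpE) (ipZ mOm dZ mpE) (@ip_ge0 R Om _ _ _ _ mpE).
Definition vnrmD := nrmD vfieldD vfieldZ vipC vipD vipZ vip_ge0.
Definition vnrmZ := nrmZ vfieldZ vipC vipZ.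

Lemma L2normE (F : E -> E) : L2norm Om F = nrm vip F.
Proof.
by congr (Num.sqrt (int3 Om _)); apply/funext => x; rewrite enorm_sqr.
Qed.

Lemma HkV_norm0E (F : E -> E) : vfield F -> HkV_norm Om 0 F = nrm vip F.
Proof.
move=> HF; congr Num.sqrt; rewrite /vip /ip /dot int3_sum//; last by move=> i; exact: L2_mul.
by apply: eq_bigr => i _; rewrite /= addr0; congr (int3 Om _); apply/funext => x; rewrite expr2.
Qed.

Lemma vfieldB (F G : E -> E) : vfield F -> vfield G -> vfield (F - G).
Proof. by move=> HF HG; rewrite -scaleN1r; apply: vfieldD => //; exact: vfieldZ. Qed.

Lemma nrm_ae0 (F : E -> E) : vfield F -> ae_on Om (fun x => F x = 0) -> nrm vip F = 0.
Proof.
move=> HF F0; rewrite /nrm (_ : vip F F = 0) ?sqrtr0// -(int3_0 Om).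
apply: ae_eq_int3 => //; first exact: (integ_measurable_on (v_integ HF HF)).
  exact: measurable_on_cst.
apply: ae_onS F0 => x _ ->; rewrite /dot big1// => i _.
by rewrite mxE mul0r.
Qed.

Lemma time_deriv_vder (u v : R -> E -> E) : (forall t, 0 <= t -> vfield (u t)) ->
  (forall t, 0 <= t -> vfield (v t)) -> time_deriv Om u v -> vder vip u v.
Proof.
move=> Hu Hv H t t0 e e0.
have := H t t0 => /cvgrPdist_le/(_ e e0).
rewrite near_withinE => /nbhs_ballP[d /= d0 Hd]; exists d => // s s0 sd.
have [->|st] := eqVneq s t.
  rewrite !subrr scale0r subrr normr0 mulr0 (_ : nrm vip 0 = 0)//.
  rewrite /nrm (_ : vip 0 0 = 0) ?sqrtr0// -(int3_0 Om); apply: int3_eq => x _.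
  by rewrite /dot big1// => i _; rewrite mxE mul0r.
have st0 : s - t != 0 by rewrite subr_eq0.
have := Hd s; rewrite /ball/= distrC => /(_ sd st s0).
rewrite sub0r normrN L2normE ger0_norm ?nrm_ge0//.
have -> : u s - u t - (s - t) *: v t =
    (s - t) *: ((fun x => (s - t)^-1 *: (u s x - u t x) - v t x) : E -> E).
  apply/funext => x; rewrite [RHS](_ : _ = (s - t) *: ((s - t)^-1 *: (u s x - u t x) - v t x))//.
  by rewrite scalerBr scalerA divff// scale1r.
rewrite vnrmZ; first by move=> h; rewrite mulrC ler_wpM2r.
have -> : ((fun x => (s - t)^-1 *: (u s x - u t x) - v t x) : E -> E) =
  (s - t)^-1 *: (u s - u t) - v t by [].
by apply: vfieldB; [apply: vfieldZ; apply: vfieldB; exact: Hu|exact: Hv].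
Qed.

Lemma C0_vcont (u : R -> E -> E) : C0_Hk Om 0 u -> vcont vip u.
Proof.
move=> H t t0 e e0; have [Ht] := H t t0.
move=> /cvgrPdist_le/(_ e e0); rewrite near_withinE => /nbhs_ballP[d /= d0 Hd].
exists d => // s s0 sd; have := Hd s; rewrite /ball/= distrC => /(_ sd s0).
rewrite sub0r normrN ger0_norm ?sqrtr_ge0//.
by rewrite (@HkV_norm0E (u s - u t))//; apply: vfieldB => //; have [] := H s s0.
Qed.

Lemma vderB (u v u' v' : R -> E -> E) :
  (forall t, 0 <= t -> vfield (u t)) -> (forall t, 0 <= t -> vfield (u' t)) ->
  (forall t, 0 <= t -> vfield (v t)) -> (forall t, 0 <= t -> vfield (v' t)) ->
  vder vip u u' -> vder vip v v' ->
  vder vip (fun t => u t - v t) (fun t => u' t - v' t).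
Proof.
move=> Hu Hu' Hv Hv' du dv t t0 e e0; have e20 : 0 < e / 2 by rewrite divr_gt0.
have [d1 d10 H1] := du t t0 _ e20; have [d2 d20 H2] := dv t t0 _ e20.
exists (Num.min d1 d2); first by rewrite lt_min d10.
move=> s s0; rewrite lt_min => /andP[sd1 sd2].
have -> : u s - v s - (u t - v t) - (s - t) *: (u' t - v' t) =
  (u s - u t - (s - t) *: u' t) + (-1) *: (v s - v t - (s - t) *: v' t).
  by rewrite scaleN1r scalerBr (subrACA (u s) (v s)) (subrACA (u s - u t)).
have Lu : vfield (u s - u t - (s - t) *: u' t).
  apply: vfieldB; first by apply: vfieldB; exact: Hu.
  by apply: vfieldZ; exact: Hu'.
have Lv : vfield (v s - v t - (s - t) *: v' t).
  apply: vfieldB; first by apply: vfieldB; exact: Hv.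
  by apply: vfieldZ; exact: Hv'.
apply: le_trans (vnrmD Lu (vfieldZ _ Lv)) _; rewrite vnrmZ// normrN1 mul1r.
by apply: le_trans (lerD (H1 s s0 sd1) (H2 s s0 sd2)) _; rewrite -mulrDl -splitr.
Qed.

Lemma vcontB (u v : R -> E -> E) :
  (forall t, 0 <= t -> vfield (u t)) -> (forall t, 0 <= t -> vfield (v t)) ->
  vcont vip u -> vcont vip v -> vcont vip (fun t => u t - v t).
Proof.
move=> Hu Hv cu cv t t0 e e0; have e20 : 0 < e / 2 by rewrite divr_gt0.
have [d1 d10 H1] := cu t t0 _ e20; have [d2 d20 H2] := cv t t0 _ e20.
exists (Num.min d1 d2); first by rewrite lt_min d10.
move=> s s0; rewrite lt_min => /andP[sd1 sd2].
have -> : u s - v s - (u t - v t) = (u s - u t) + (-1) *: (v s - v t).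
  by rewrite scaleN1r subrACA.
have Lu : vfield (u s - u t) by apply: vfieldB; exact: Hu.
have Lv : vfield (v s - v t) by apply: vfieldB; exact: Hv.
apply: le_trans (vnrmD Lu (vfieldZ _ Lv)) _; rewrite vnrmZ// normrN1 mul1r.
by apply: le_trans (lerD (H1 s s0 sd1) (H2 s s0 sd2)) _; rewrite -splitr.
Qed.

Variables (lambda mu rho : R).
Hypotheses (l0 : 0 < lambda) (m0 : 0 < mu) (r0 : 0 < rho).
Let stress (u : R -> E -> E) t x := stiff_mul lambda mu (wjac Om (u t) x).

Lemma HkV_vfield k F : HkV Om k F -> vfield F.
Proof. by move=> H i; case: k H => [|k] /(_ i) // []. Qed.

Lemma HkV_wjac k F : HkV Om k.+1 F -> mfield (wjac Om F).
Proof.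
move=> H [i j]; have [_ /(_ j) [_ ]] := H i.
have -> : (fun x => wjac Om F x (i, j).1 (i, j).2) = wderiv Om j (fun y => F y i 0).
  by apply/funext => x; rewrite mxE.
by case: k H => [|k] H // [].
Qed.

Lemma stiff_mfield (G : E -> 'M[R]_3) : mfield G -> mfield (fun x => stiff_mul lambda mu (G x)).
Proof.
move=> H i.
have -> : (fun x => stiff_mul lambda mu (G x) i.1 i.2) =
   (fun x => \sum_k \sum_l stiffness lambda mu i.1 i.2 k l * G x k l).
  by apply/funext => x; rewrite mxE.
by apply: L2_sum => // k; apply: L2_sum => // l; apply: L2Z => //; exact: (H (k, l)).
Qed.

Section Green.
Variables (f : E -> E) (Lf : vfield f) (u utt : R -> E -> E).
Hypothesis u2 : forall t, 0 <= t -> HkV Om 2 (u t).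
Hypothesis utt0 : forall t, 0 <= t -> vfield (utt t).
Hypothesis pde : forall t, 0 <= t ->
  ae_on Om (fun x => rho *: utt t x - wdiv_mx Om (stress u t) x = f x).
Hypothesis free : forall t, 0 <= t -> normal_trace_eq0 Om (stress u t).

Lemma stress_mfield t : 0 <= t -> mfield (stress u t).
Proof. by move=> t0; apply: stiff_mfield; apply: HkV_wjac; exact: u2. Qed.

(** Green's formula, with the divergence of the stress replaced by the
    square-integrable field it equals by the equation. *)
Lemma green t F : 0 <= t -> HkV Om 1 F ->
  mip (stress u t) (wjac Om F) = - vip (rho *: utt t - f) F.
Proof.
move=> t0 HF; pose A : E -> E := rho *: utt t - f.
have LA : vfield A by apply: vfieldB => //; apply: vfieldZ; exact: utt0.
have LF : vfield F := HkV_vfield HF.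
have LD : mfield (wjac Om F) := HkV_wjac HF.
have LS := stress_mfield t0.
have comp i : int3 Om (fun x => \sum_j stress u t x i j * wjac Om F x i j)
    + int3 Om (fun x => A x i 0 * F x i 0) = 0.
  have := free t0 i (HF i); rewrite /normal_trace => H0.
  have iS : integ Om (fun x => \sum_j stress u t x i j * wjac Om F x i j).
    by apply: integ_sum => // j; apply: L2_mul => //; [exact: (LS (i, j))|exact: (LD (i, j))].
  have iA : integ Om (fun x => A x i 0 * F x i 0) by exact: L2_mul.
  rewrite -int3D// -[RHS]H0; apply/esym; apply: ae_eq_int3 => //.
  - apply: measurable_onD.
      apply: (integ_measurable_on (integ_eq mOm _ iS)) => x _.
      by rewrite /dot; apply: eq_bigr => j _; rewrite !mxE.
    apply: measurable_onM; last exact: L2_measurable.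
    rewrite /measurable_on /wdiv; apply: measurable_sum => j; exact: wderiv_measurable.
  - by apply: measurable_onD; exact: integ_measurable_on.
  - apply: ae_onS (pde t0) => x _ Ax; congr (_ + _ * _).
      by rewrite /dot; apply: eq_bigr => j _; rewrite !mxE.
    have -> : A x = wdiv_mx Om (stress u t) x.
      by rewrite [LHS](_ : _ = rho *: utt t x - f x)// -Ax opprB addrC subrK.
    by rewrite mxE.
rewrite /mip /vip /ip.
rewrite (_ : (fun x => mdot _ _) = (fun x => \sum_i \sum_j stress u t x i j * wjac Om F x i j)); last first.
  by apply/funext => x; rewrite mdotE.
rewrite int3_sum//; last first.
  by move=> i; apply: integ_sum => // j; apply: L2_mul => //; [exact: (LS (i, j))|exact: (LD (i, j))].
rewrite /dot int3_sum//; last by move=> i; exact: L2_mul.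
rewrite -sumrN; apply: eq_bigr => i _.
by apply/eqP; rewrite -addr_eq0; apply/eqP; exact: comp.
Qed.

End Green.

Lemma mip_stiff_sym (A B : E -> 'M[R]_3) :
  mip (fun x => stiff_mul lambda mu (A x)) B = mip (fun x => stiff_mul lambda mu (B x)) A.
Proof.
rewrite /mip /ip (_ : (fun x => mdot (stiff_mul lambda mu (A x)) (B x)) = 
  (fun x => mdot (stiff_mul lambda mu (B x)) (A x)))//.
by apply/funext => x; rewrite stiff_sym.
Qed.

Lemma mip_stiff_ge0 (A : E -> 'M[R]_3) : 0 <= mip (fun x => stiff_mul lambda mu (A x)) A.
Proof. by apply: int3_ge0 => x _; apply: stiff_ge0; exact: ltW. Qed.

Lemma nrm_stiff_le (A : E -> 'M[R]_3) : mfield A ->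
  nrm mip (fun x => stiff_mul lambda mu (A x)) <=
  Num.sqrt (3 * lambda + 4 * mu) * Num.sqrt (mip (fun x => stiff_mul lambda mu (A x)) A).
Proof.
move=> LA; have LS := stiff_mfield LA.
have c0 : 0 <= 3 * lambda + 4 * mu by rewrite addr_ge0// mulr_ge0// ltW.
rewrite -sqrtrM// /nrm ler_wsqrtr// -int3Z//; last exact: m_integ.
apply: int3_le => //; [exact: m_integ|by apply: integZ => //; exact: m_integ|].
by move=> x _; apply: stiff_norm_le; exact: ltW.
Qed.

Lemma elastic_fields (f : E -> E) u : vfield f -> elastic_solution Om lambda mu rho f u ->
  exists ut utt : R -> E -> E,
  [/\ [/\ forall t, 0 <= t -> vfield (u t), forall t, 0 <= t -> vfield (ut t)
        & forall t, 0 <= t -> vfield (utt t)],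
      [/\ vder vip u ut, vder vip ut utt & vcont vip utt],
      nrm vip (u 0) = 0 /\ nrm vip (ut 0) = 0,
      forall t F, 0 <= t -> HkV Om 1 F ->
        mip (stress u t) (wjac Om F) = - vip (rho *: utt t - f) F &
      forall t, 0 <= t -> HkV Om 2 (u t)].
Proof.
move=> Lf [ut [utt [[c2 c1 c0] [d1 d2] pde free [u0 ut0]]]]; exists ut, utt.
have H2 t : 0 <= t -> HkV Om 2 (u t) by move=> t0; case: (c2 t t0).
have V0 t : 0 <= t -> vfield (u t) by move=> /H2; exact: HkV_vfield.
have V1 t : 0 <= t -> vfield (ut t) by move=> t0; apply: (@HkV_vfield 1); case: (c1 t t0).
have V2 t : 0 <= t -> vfield (utt t) by move=> t0; apply: (@HkV_vfield 0); case: (c0 t t0).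
split => //.
- by split; [exact: time_deriv_vder|exact: time_deriv_vder|exact: C0_vcont].
- by split; apply: nrm_ae0 => //; [exact: V0|exact: V1].
- by move=> t F t0 HF; apply: green.
Qed.

Lemma HkV_le k F : HkV Om k.+1 F -> HkV Om k F.
Proof.
move=> H i; have := H i; move: (fun x => F x i 0) => g.
elim: k g {H} => [|k IH] g; first by case.
by case=> Lg H; split => // j; have [ex /IH] := H j.
Qed.

Definition jacobian (G : E -> E) x : 'M[R]_3 :=
  \matrix_(i, j) partial j (fun y => G y i 0) x.

(** The difference of two elastic displacements solves the same equation with
    the difference of the sources; its stress is bounded by the energy, hence
    the displacement behaves like t^2/2 times the source against any fixed
    smooth field [G]. *)
Lemma elastic_source_bound (f1 f2 : E -> E) (u1 u2 : R -> E -> E) (G : E -> E) T :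
  vfield f1 -> vfield f2 ->
  elastic_solution Om lambda mu rho f1 u1 -> elastic_solution Om lambda mu rho f2 u2 ->
  (forall i, Ck 1 (fun x => G x i 0)) -> vfield G -> mfield (jacobian G) ->
  0 < T <= 2^-1 ->
  `|vip (f1 - f2) G| <= 2 / T ^+ 2 * `|rho * vip (u1 T - u2 T) G| +
    Num.sqrt (3 * lambda + 4 * mu) * nrm mip (jacobian G) * Num.sqrt (2 * T / rho)
      * nrm vip (f1 - f2).
Proof.
move=> Lf1 Lf2 S1 S2 CG LG LJ T2.
have [ut1 [utt1 [[V10 V11 V12] [d11 d12 c1] [z1 z1'] g1 H1]]] := elastic_fields Lf1 S1.
have [ut2 [utt2 [[V20 V21 V22] [d21 d22 c2] [z2 z2'] g2 H2]]] := elastic_fields Lf2 S2.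
pose u t := u1 t - u2 t; pose ut t := ut1 t - ut2 t; pose utt t := utt1 t - utt2 t.
pose f := f1 - f2.
pose D t : E -> 'M[R]_3 := wjac Om (u1 t) - wjac Om (u2 t).
pose S t : E -> 'M[R]_3 := fun x => stiff_mul lambda mu (D t x).
have LD t : 0 <= t -> mfield (D t).
  move=> t0; rewrite /D -scaleN1r; apply: mfieldD; first by apply: HkV_wjac; exact: H1.
  by apply: mfieldZ; apply: HkV_wjac; exact: H2.
have LS t : 0 <= t -> mfield (S t) by move=> t0; apply: stiff_mfield; exact: LD.
have SE t : S t = stress u1 t - stress u2 t.
  by apply/funext => x; rewrite /S /D /stress [wjac _ _ - _]fctE stiff_mulB.
have LA t : 0 <= t -> vfield (rho *: utt t - f).
  move=> t0; apply: vfieldB; last exact: vfieldB.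
  by apply: vfieldZ; apply: vfieldB; [exact: V12|exact: V22].
have AE t : rho *: utt t - f = (rho *: utt1 t - f1) - (rho *: utt2 t - f2).
  by rewrite /utt /f scalerBr subrACA.
have mipB (A1 A2 B : E -> 'M[R]_3) : mfield A1 -> mfield A2 -> mfield B -> mip (A1 - A2) B = mip A1 B - mip A2 B.
  move=> h1 h2 h3; rewrite -scaleN1r /mip (ipD mOm dD mpE)//; last exact: mfieldZ.
  by rewrite (ipZ mOm dZ mpE)// mulN1r.
have vipB (A1 A2 B : E -> E) : vfield A1 -> vfield A2 -> vfield B -> vip (A1 - A2) B = vip A1 B - vip A2 B.
  move=> h1 h2 h3; rewrite -scaleN1r /vip (ipD mOm cD vpE)//; last exact: vfieldZ.
  by rewrite (ipZ mOm cZ vpE)// mulN1r.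
have greenS t (F : E -> E) : 0 <= t -> HkV Om 1 F -> mip (S t) (wjac Om F) = - vip (rho *: utt t - f) F.
  move=> t0 HF; have LF := HkV_vfield HF; have LJF := HkV_wjac HF.
  have LS1 : mfield (stress u1 t) by apply: stiff_mfield; apply: HkV_wjac; exact: H1.
  have LS2 : mfield (stress u2 t) by apply: stiff_mfield; apply: HkV_wjac; exact: H2.
  have LA1 : vfield (rho *: utt1 t - f1).
    by apply: vfieldB => //; apply: vfieldZ; exact: V12.
  have LA2 : vfield (rho *: utt2 t - f2).
    by apply: vfieldB => //; apply: vfieldZ; exact: V22.
  rewrite SE AE (mipB _ _ _ LS1 LS2 LJF) (vipB _ _ _ LA1 LA2 LF) (g1 t F t0 HF) (g2 t F t0 HF).
  by rewrite opprB opprK addrC.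
have mipC (A B : E -> 'M[R]_3) : mip A B = mip B A.
  by congr (int3 Om _); apply/funext => x; rewrite !mdotE; apply: eq_bigr => i _; apply: eq_bigr => j _; rewrite mulrC.
have vC (A B : E -> E) : vip A B = vip B A by exact: vipC.
have greenU s t : 0 <= s -> 0 <= t -> mip (S s) (D t) = - vip (rho *: utt s - f) (u t).
  move=> s0 t0; have h1 := HkV_le (H1 t t0); have h2 := HkV_le (H2 t t0).
  rewrite /D mipC mipB ?(mipC (wjac _ _)) ?greenS//; [|exact: HkV_wjac h1|exact: HkV_wjac h2|exact: LS].
  have Ls := LA s s0; have L1 := V10 t t0; have L2 := V20 t t0.
  rewrite (vC _ (u t)) /u (vipB _ _ _ L1 L2 Ls) (vC (u1 t)) (vC (u2 t)).
  by rewrite [RHS]opprD.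
have symS s t : mip (S s) (D t) = mip (S t) (D s) by exact: mip_stiff_sym.
have HG : HkV Om 1 G.
  by move=> i; apply: Hk_C1 => // j; have := LJ (i, j); congr (L2 Om _); apply/funext => x; rewrite mxE.
have JG : ae_on Om (fun x => wjac Om G x = jacobian G x).
  have h (ij : 'I_3 * 'I_3) : ae_on Om (fun x => wjac Om G x ij.1 ij.2 = jacobian G x ij.1 ij.2).
    by apply: ae_onS (wderiv_C1 ij.2 oOm (CG ij.1)) => x _; rewrite !mxE.
  have : ae_on Om (fun x => forall ij : 'I_3 * 'I_3, wjac Om G x ij.1 ij.2 = jacobian G x ij.1 ij.2).
    have : {ae @leb3 R, forall p, forall ij : 'I_3 * 'I_3, Om (vec3 p) -> wjac Om G (vec3 p) ij.1 ij.2 = jacobian G (vec3 p) ij.1 ij.2}.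
      by apply: filter_forall => ij; exact: h.
    by rewrite /ae_on; apply: filterS => p Hp Op ij; exact: Hp.
  by apply: ae_onS => x _ H; apply/matrixP => i j; exact: (H (i, j)).
have mipG t : 0 <= t -> mip (S t) (wjac Om G) = mip (S t) (jacobian G).
  move=> t0; apply: ae_eq_int3 => //.
  - by apply: integ_measurable_on; apply: m_integ; [exact: LS|exact: HkV_wjac HG].
  - by apply: integ_measurable_on; apply: m_integ => //; exact: LS.
  - by apply: ae_onS JG => x _ ->.
have LU t : 0 <= t -> vfield (u t) by move=> t0; apply: vfieldB; [exact: V10|exact: V20].
have LUt t : 0 <= t -> vfield (ut t) by move=> t0; apply: vfieldB; [exact: V11|exact: V21].
have LUtt t : 0 <= t -> vfield (utt t) by move=> t0; apply: vfieldB; [exact: V12|exact: V22].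
have Lf : vfield f by exact: vfieldB.
have dU : vder vip u ut by exact: vderB.
have dUt : vder vip ut utt by exact: vderB.
have cU : vcont vip utt by exact: vcontB.
have zB (A B : E -> E) : vfield A -> vfield B -> nrm vip A = 0 -> nrm vip B = 0 -> nrm vip (A - B) = 0.
  move=> LA' LB' zA zB; apply/le_anti; rewrite nrm_ge0 andbT -scaleN1r.
  by apply: le_trans (vnrmD LA' (vfieldZ _ LB')) _; rewrite vnrmZ ?zA ?zB ?mulr0 ?addr0.
have u0 : nrm vip (u 0) = 0 by apply: zB => //; [exact: V10|exact: V20].
have ut0 : nrm vip (ut 0) = 0 by apply: zB => //; [exact: V11|exact: V21].
have SD0 t : 0 <= mip (S t) (D t) by exact: mip_stiff_ge0.
have SDn t : 0 <= t -> nrm mip (S t) <= Num.sqrt (3 * lambda + 4 * mu) * Num.sqrt (mip (S t) (D t)).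
  by move=> t0; apply: nrm_stiff_le; exact: LD.
have gG t : 0 <= t -> mip (S t) (jacobian G) = - vip (rho *: utt t - f) G.
  by move=> t0; rewrite -mipG// greenS.
rewrite -[f1 - f2]/f -[u1 T - u2 T]/(u T).
clearbody u ut utt f S D.
apply: (@source_bound _ _ _ _ vfieldD vfieldZ vipC vipD vipZ vip_ge0 u ut utt f rho r0
  LU LUt LUtt Lf dU dUt cU u0 ut0) => //.
- by move=> s t s0 t0; apply: oppr_inj; rewrite -!greenU// symS.
- by move=> t t0; rewrite -greenU.
- by rewrite mulr_ge0 ?sqrtr_ge0 ?nrm_ge0.
- move=> t t0; rewrite -greenU// -normrN -gG//.
  apply: le_trans (mip_CS (LS t t0) LJ) _.
  by rewrite mulrAC ler_wpM2r ?nrm_ge0// SDn.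
Qed.

End Elastic.

(** * Recovering a point source from its field *)

Section Euclidean.
Context {R : realType}.
Local Notation E := 'cV[R]_3.
Implicit Types (x y z e s v : E) (M : 'M[R]_3).

Lemma dotC x y : dot x y = dot y x.
Proof. by apply: eq_bigr => i _; rewrite mulrC. Qed.

Lemma dotDl x y z : dot (x + y) z = dot x z + dot y z.
Proof. by rewrite /dot -big_split; apply: eq_bigr => i _; rewrite mxE mulrDl. Qed.

Lemma dotDr x y z : dot x (y + z) = dot x y + dot x z.
Proof. by rewrite dotC dotDl !(dotC x). Qed.

Lemma dotZl (c : R) x y : dot (c *: x) y = c * dot x y.
Proof. by rewrite /dot mulr_sumr; apply: eq_bigr => i _; rewrite mxE mulrA. Qed.

Lemma dotZr (c : R) x y : dot x (c *: y) = c * dot x y.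
Proof. by rewrite dotC dotZl dotC. Qed.

Lemma dotBl x y z : dot (x - y) z = dot x z - dot y z.
Proof. by rewrite dotDl -scaleN1r dotZl mulN1r. Qed.

Lemma dotBr x y z : dot x (y - z) = dot x y - dot x z.
Proof. by rewrite dotC dotBl !(dotC x). Qed.

Lemma dot0l x : dot 0 x = 0.
Proof. by rewrite -(scale0r 0) dotZl mul0r. Qed.

Lemma dot_ge0 x : 0 <= dot x x.
Proof. by apply: sumr_ge0 => i _; rewrite -expr2 sqr_ge0. Qed.

Lemma dot_mulmxr M x y : dot x (M *m y) = dot (M^T *m x) y.
Proof.
rewrite /dot; under eq_bigr do rewrite mxE mulr_sumr.
rewrite exchange_big; apply: eq_bigr => j _; rewrite mxE mulr_suml.
by apply: eq_bigr => i _; rewrite mxE; ring.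
Qed.

Lemma enorm_ge0 x : 0 <= enorm x.
Proof. exact: sqrtr_ge0. Qed.

Let T (_ : E) := True.
Let TD : forall x y, T x -> T y -> T (x + y). Proof. by []. Qed.
Let TZ : forall (c : R) x, T x -> T (c *: x). Proof. by []. Qed.
Let bD : forall x y z, T x -> T y -> T z -> dot (x + y) z = dot x z + dot y z.
Proof. by move=> *; exact: dotDl. Qed.
Let bZ : forall (c : R) x y, T x -> T y -> dot (c *: x) y = c * dot x y.
Proof. by move=> *; exact: dotZl. Qed.
Let b0 : forall x, T x -> 0 <= dot x x. Proof. by move=> *; exact: dot_ge0. Qed.

Lemma dot_le x y : `|dot x y| <= enorm x * enorm y.
Proof. exact: (cauchy_schwarz TD TZ dotC bD bZ b0). Qed.

Lemma enormD x y : enorm (x + y) <= enorm x + enorm y.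
Proof. exact: (nrmD TD TZ dotC bD bZ b0). Qed.

Lemma enormZ (c : R) x : enorm (c *: x) = `|c| * enorm x.
Proof. exact: (nrmZ TZ dotC bZ). Qed.

Lemma enormN x : enorm (- x) = enorm x.
Proof. by rewrite -scaleN1r enormZ normrN1 mul1r. Qed.

Lemma enorm_sub x y : enorm (x - y) = enorm (y - x).
Proof. by rewrite -enormN opprB. Qed.

Lemma enorm0 : enorm (0 : E) = 0.
Proof. by rewrite -(scale0r 0) enormZ normr0 mul0r. Qed.

Lemma enorm_lipschitz x y : `|enorm x - enorm y| <= enorm (x - y).
Proof.
rewrite ler_norml; apply/andP; split.
  by have := enormD (y - x) x; rewrite subrK (enorm_sub x); lra.
by have := enormD (x - y) y; rewrite subrK; lra.
Qed.

Lemma coord_le_enorm x i : `|x i 0| <= enorm x.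
Proof.
rewrite -sqrtr_sqr ler_wsqrtr// (bigD1 i)//= lerDl.
by apply: sumr_ge0 => j _; exact: sqr_ge0.
Qed.

Lemma enorm_le_coord x (k : R) : (forall i, `|x i 0| <= k) -> enorm x <= 2 * k.
Proof.
move=> H; have k0 : 0 <= k := le_trans (normr_ge0 _) (H 0).
rewrite -ler_sqr ?nnegrE ?enorm_ge0 ?mulr_ge0// enorm_sqr /dot.
apply: (@le_trans _ _ (\sum_(i < 3) k ^+ 2)); last first.
  by rewrite sumr_const card_ord exprMn; have := sqr_ge0 k; nra.
by apply: ler_sum => i _; rewrite -expr2 -real_normK ?num_real// ler_sqr ?nnegrE.
Qed.

Lemma enorm_eq0 x : enorm x = 0 -> x = 0.
Proof.
move=> H; apply/colP => i; rewrite mxE; apply/eqP.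
by rewrite -normr_le0 -H coord_le_enorm.
Qed.

Lemma fnorm_ge0 M : 0 <= fnorm M.
Proof. exact: sqrtr_ge0. Qed.

Lemma coord_le_fnorm M i j : `|M i j| <= fnorm M.
Proof.
rewrite -sqrtr_sqr ler_wsqrtr// (bigD1 i)//= (bigD1 j)//= expr2 -addrA lerDl.
apply: addr_ge0; first by apply: sumr_ge0 => k _; rewrite -expr2 sqr_ge0.
by apply: sumr_ge0 => k _; apply: sumr_ge0 => l _; rewrite -expr2 sqr_ge0.
Qed.

Lemma fnorm_le_coord M (k : R) : (forall i j, `|M i j| <= k) -> fnorm M <= 3 * k.
Proof.
move=> H; have k0 : 0 <= k := le_trans (normr_ge0 _) (H 0 0).
rewrite -ler_sqr ?nnegrE ?fnorm_ge0 ?mulr_ge0// sqr_sqrtr; last first.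
  by apply: sumr_ge0 => i _; apply: sumr_ge0 => j _; rewrite -expr2 sqr_ge0.
apply: (@le_trans _ _ (\sum_(i < 3) \sum_(j < 3) k ^+ 2)); last first.
  by rewrite !sumr_const !card_ord exprMn; have := sqr_ge0 k; nra.
apply: ler_sum => i _; apply: ler_sum => j _.
by rewrite -expr2 -real_normK ?num_real// ler_sqr ?nnegrE.
Qed.

Lemma enorm_mulmx M x : enorm (M *m x) <= 6 * fnorm M * enorm x.
Proof.
rewrite -mulrA (_ : 6 = 2 * 3 :> R) -?mulrA; last by ring.
apply: enorm_le_coord => i; rewrite mxE.
apply: le_trans (ler_norm_sum _ _ _) _.
apply: (@le_trans _ _ (\sum_(j < 3) fnorm M * enorm x)).
  by apply: ler_sum => j _; rewrite normrM ler_pM// ?coord_le_fnorm ?coord_le_enorm.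
by rewrite sumr_const card_ord mulr_natl.
Qed.

Lemma quad_sym M x y : M^T = M -> dot (M *m x) y = dot (M *m y) x.
Proof. by move=> sM; rewrite dotC dot_mulmxr sM. Qed.

Lemma dot_delta M i j : dot (M *m delta_mx i 0) (delta_mx j 0) = M j i.
Proof.
rewrite /dot (bigD1 j)//= big1; last first.
  by move=> k /negbTE kj; rewrite [X in _ * X]mxE kj mulr0.
rewrite addr0 [X in _ * X]mxE !eqxx mulr1 mxE (bigD1 i)//= big1.
  by rewrite mxE !eqxx mulr1 addr0.
by move=> k /negbTE ki; rewrite mxE ki mulr0.
Qed.

Lemma enorm_delta i : enorm (delta_mx i 0 : E) = 1.
Proof.
rewrite /enorm (bigD1 i)//= big1; last first.
  by move=> k /negbTE ki; rewrite mxE ki expr0n.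
by rewrite mxE !eqxx expr1n addr0 sqrtr1.
Qed.

(** A symmetric matrix is recovered from its quadratic form by polarization. *)
Lemma fnorm_le_quad M (k : R) : M^T = M -> (forall z, `|dot (M *m z) z| <= k * enorm z ^+ 2) ->
  fnorm M <= 9 * k.
Proof.
(* each entry is at most [(4 + 1 + 1) / 2 * k], from two basis vectors and their sum *)
move=> sM H; rewrite (_ : 9 = 3 * 3 :> R) -?mulrA; last by ring.
apply: fnorm_le_coord => i j.
have Hi := H (delta_mx i 0); have Hj := H (delta_mx j 0).
have Hij := H (delta_mx i 0 + delta_mx j 0).
move: Hi Hj Hij; rewrite mulmxDr !(dotDl, dotDr) !dot_delta !enorm_delta expr1n.
have -> : M i j = M j i by rewrite -[in LHS]sM mxE.
have : enorm (delta_mx i 0 + delta_mx j 0 : E) ^+ 2 <= 4.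
  have := enormD (delta_mx i 0 : E) (delta_mx j 0); rewrite !enorm_delta => h.
  have h0 := enorm_ge0 (delta_mx i 0 + delta_mx j 0 : E); nra.
move: (enorm _ ^+ 2) => q q4 h1 h2 h3.
have k0 : 0 <= k by have := le_trans (normr_ge0 _) h1; rewrite mulr1.
have h4 : `|M j j + M j i + (M j i + M i i)| <= k * 4.
  by rewrite (_ : _ + _ = M i i + M j i + (M j i + M j j)); [apply: le_trans h3 _; rewrite ler_wpM2l|ring].
move: h1 h2 h4; rewrite !ler_norml => /andP[? ?] /andP[? ?] /andP[? ?]; apply/andP; lra.
Qed.

End Euclidean.

(** The field of a point source with moment [M] is, up to a constant, the
    gradient of [pole0 M y = (M y . y) / |y|^5], homogeneous of degree -3 in
    the position [y] of the source seen from the observation point; [pole1]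
    and [pole2] are its first and second derivatives. *)
Section Poles.
Context {R : realType}.
Local Notation E := 'cV[R]_3.
Implicit Types (x y z e s v : E) (M : 'M[R]_3).

Definition pole0 M y : R := dot (M *m y) y * (enorm y)^-1 ^+ 5.

Definition pole1 M y (i : 'I_3) : R :=
  2 * (M *m y) i 0 * (enorm y)^-1 ^+ 5
  - 5 * dot (M *m y) y * y i 0 * (enorm y)^-1 ^+ 7.

Definition pole2 M y (i j : 'I_3) : R :=
  2 * M i j * (enorm y)^-1 ^+ 5
  - 10 * ((M *m y) i 0 * y j 0 + (M *m y) j 0 * y i 0) * (enorm y)^-1 ^+ 7
  - 5 * dot (M *m y) y * (i == j)%:R * (enorm y)^-1 ^+ 7
  + 35 * dot (M *m y) y * (y i 0 * y j 0) * (enorm y)^-1 ^+ 9.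

Lemma pole2_sym M y i j : M^T = M -> pole2 M y i j = pole2 M y j i.
Proof.
move=> sM; rewrite /pole2 (_ : M i j = M j i); last by rewrite -[in LHS]sM mxE.
by rewrite eq_sym [(M *m y) i 0 * _ + _]addrC [y i 0 * y j 0]mulrC.
Qed.

Lemma pole1_dot M y z : \sum_i z i 0 * pole1 M y i =
  2 * dot (M *m y) z * (enorm y)^-1 ^+ 5
  - 5 * dot (M *m y) y * dot y z * (enorm y)^-1 ^+ 7.
Proof.
rewrite /pole1; move: (dot (M *m y) y) (_ ^-1) => d k.
rewrite /dot !sum_I3; ring.
Qed.

Lemma pole2_dot M y z i : \sum_j z j 0 * pole2 M y i j =
  2 * (M *m z) i 0 * (enorm y)^-1 ^+ 5
  - 10 * ((M *m y) i 0 * dot y z + dot (M *m y) z * y i 0) * (enorm y)^-1 ^+ 7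
  - 5 * dot (M *m y) y * z i 0 * (enorm y)^-1 ^+ 7
  + 35 * dot (M *m y) y * y i 0 * dot y z * (enorm y)^-1 ^+ 9.
Proof.
rewrite /pole2; move: (dot (M *m y) y) (_ ^-1) => d k.
rewrite /dot [(M *m z) i 0]mxE !sum_I3.
by move: i; apply/forall_I3; split; rewrite ?eqxx ?I3_eqE /=; ring.
Qed.

Lemma euler_pole1 M y : 0 < enorm y -> \sum_i y i 0 * pole1 M y i = -3 * pole0 M y.
Proof.
move=> y0; rewrite pole1_dot /pole0 -enorm_sqr; field.
by rewrite gt_eqF.
Qed.

Lemma euler_pole2 M y i : 0 < enorm y -> \sum_j y j 0 * pole2 M y i j = -4 * pole1 M y i.
Proof.
move=> y0; rewrite pole2_dot /pole1 -enorm_sqr; field.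
by rewrite gt_eqF.
Qed.

Lemma sum_le_mul (z a : 'I_3 -> R) (r eta : R) :
  (forall i, `|z i| <= r) -> (forall i, `|a i| <= eta) -> `|\sum_i z i * a i| <= 3 * r * eta.
Proof.
move=> Hz Ha; apply: le_trans (ler_norm_sum _ _ _) _.
apply: (@le_trans _ _ (\sum_(i < 3) r * eta)).
  by apply: ler_sum => i _; rewrite normrM ler_pM.
by rewrite sumr_const card_ord -[3 * r * eta]mulrA mulr_natl.
Qed.

(** The derivative of [pole0 M] at [v] in direction [e], multiplied by [|v|^7] to
    become a cubic form in [v]. *)
Definition pole_cubic M e v : R :=
  2 * dot (M *m v) e * dot v v - 5 * dot (M *m v) v * dot v e.

Section TwoPoles.
Variables (M1 M2 : 'M[R]_3) (y1 y2 : E) (rmin rmax eta : R).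
Hypotheses (s1 : M1^T = M1) (s2 : M2^T = M2) (rmin0 : 0 < rmin).
Hypotheses (y1r : rmin <= enorm y1 <= rmax) (y2r : rmin <= enorm y2 <= rmax).
Hypothesis near1 : forall i, `|pole1 M1 y1 i - pole1 M2 y2 i| <= eta.
Hypothesis near2 : forall i j, `|pole2 M1 y1 i j - pole2 M2 y2 i j| <= eta.

Let y10 : 0 < enorm y1. Proof. by case/andP: y1r => + _; exact: lt_le_trans. Qed.
Let y20 : 0 < enorm y2. Proof. by case/andP: y2r => + _; exact: lt_le_trans. Qed.
Let y1c i : `|y1 i 0| <= rmax.
Proof. by apply: le_trans (coord_le_enorm _ _) _; case/andP: y1r. Qed.
Let y2c i : `|y2 i 0| <= rmax.
Proof. by apply: le_trans (coord_le_enorm _ _) _; case/andP: y2r. Qed.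

(** Euler's identity for homogeneous functions turns a small change of the
    field into a small derivative of the field along the displacement of the
    source. *)
Lemma pole1_dir_le : `|\sum_i (y1 - y2) i 0 * pole1 M1 y1 i| <=
  rmax * (4 + 3 * rmax) * eta.
Proof.
have rmax0 : 0 <= rmax := le_trans (normr_ge0 _) (y1c 0).
have eta0 : 0 <= eta := le_trans (normr_ge0 _) (near1 0).
have H i : `|\sum_j (y1 - y2) j 0 * pole2 M1 y1 i j| <= (4 + 3 * rmax) * eta.
  have -> : \sum_j (y1 - y2) j 0 * pole2 M1 y1 i j =
      -4 * (pole1 M1 y1 i - pole1 M2 y2 i)
      - \sum_j y2 j 0 * (pole2 M1 y1 i j - pole2 M2 y2 i j).
    rewrite mulrBr -!euler_pole2// -!sumrB; apply: eq_bigr => j _; rewrite !mxE; ring.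
  apply: le_trans (ler_normB _ _) _; rewrite mulrDl; apply: lerD.
    by rewrite normrM normrN (gtr0_norm (_ : 0 < 4))// ler_wpM2l.
  exact: sum_le_mul.
have E0 : -4 * (\sum_i (y1 - y2) i 0 * pole1 M1 y1 i) =
    \sum_i y1 i 0 * (\sum_j (y1 - y2) j 0 * pole2 M1 y1 i j).
  under [RHS]eq_bigr do rewrite mulr_sumr.
  rewrite exchange_big mulr_sumr; apply: eq_bigr => j _.
  rewrite mulrCA -euler_pole2// mulr_sumr; apply: eq_bigr => i _.
  by rewrite (pole2_sym _ i)// mulrCA.
have := sum_le_mul y1c H; rewrite -E0 normrM normrN (gtr0_norm (_ : 0 < 4))//.
have : 0 <= rmax * ((4 + 3 * rmax) * eta) by rewrite !mulr_ge0// addr_ge0// mulr_ge0.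
by rewrite -!mulrA; move: (rmax * _) => w w0; lra.
Qed.

Lemma pole_cubic_le : `|pole_cubic M1 (y1 - y2) y1| <=
  rmax ^+ 7 * (rmax * (4 + 3 * rmax) * eta).
Proof.
have -> : pole_cubic M1 (y1 - y2) y1 =
    enorm y1 ^+ 7 * \sum_i (y1 - y2) i 0 * pole1 M1 y1 i.
  by rewrite pole1_dot /pole_cubic -enorm_sqr; field; rewrite gt_eqF.
rewrite normrM ger0_norm ?exprn_ge0 ?enorm_ge0// ler_pM ?exprn_ge0 ?enorm_ge0//.
  by rewrite lerXn2r ?nnegrE ?enorm_ge0//; [exact: le_trans (normr_ge0 _) (y1c 0)|case/andP: y1r].
exact: pole1_dir_le.
Qed.

(** Once the positions are close, Euler's identity passes from the first
    derivatives to the fields themselves. *)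
Lemma pole0_diff_le : `|pole0 M1 y1 - pole0 M2 y2| <= rmax * (3 + 2 * rmax) * eta.
Proof.
have rmax0 : 0 <= rmax := le_trans (normr_ge0 _) (y1c 0).
have eta0 : 0 <= eta := le_trans (normr_ge0 _) (near1 0).
have E0 : -3 * (pole0 M1 y1 - pole0 M2 y2) =
    \sum_i (y1 - y2) i 0 * pole1 M1 y1 i + \sum_i y2 i 0 * (pole1 M1 y1 i - pole1 M2 y2 i).
  rewrite mulrBr -!euler_pole1// -sumrB -big_split; apply: eq_bigr => i _; rewrite !mxE /=; ring.
have := le_trans (ler_normD _ _) (lerD pole1_dir_le (sum_le_mul y2c near1)).
rewrite -E0 normrM normrN (gtr0_norm (_ : 0 < 3))//.
have := mulr_ge0 rmax0 eta0; have := mulr_ge0 rmax0 (mulr_ge0 rmax0 eta0).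
rewrite (_ : rmax * (4 + 3 * rmax) * eta = 4 * (rmax * eta) + 3 * (rmax * (rmax * eta))); last by ring.
rewrite (_ : rmax * (3 + 2 * rmax) * eta = 3 * (rmax * eta) + 2 * (rmax * (rmax * eta))); last by ring.
rewrite -[3 * rmax * eta]mulrA; move: (rmax * eta) (rmax * (rmax * eta)) => a b; lra.
Qed.

End TwoPoles.

Lemma pole_cubicD M e s v (t : R) : M^T = M ->
  pole_cubic M e (s + t *: v) =
  2 * (dot (M *m s) e + t * dot (M *m v) e) * (dot s s + 2 * t * dot s v + t ^+ 2 * dot v v)
  - 5 * (dot (M *m s) s + 2 * t * dot (M *m s) v + t ^+ 2 * dot (M *m v) v)
      * (dot s e + t * dot v e).
Proof.
move=> sM; rewrite /pole_cubic mulmxDr -scalemxAr !(dotDl, dotDr, dotZl, dotZr).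
rewrite (quad_sym v s sM) (dotC v s); ring.
Qed.

Lemma pole_cubicZ M e v (t : R) : pole_cubic M e (t *: v) = t ^+ 3 * pole_cubic M e v.
Proof. rewrite /pole_cubic -scalemxAr !(dotZl, dotZr); ring. Qed.

(** The third difference of a cubic form recovers the form. *)
Lemma pole_cubic_growth M e c (r k : R) : M^T = M -> 0 < r ->
  (forall s, enorm (s - c) < r -> `|pole_cubic M e s| <= k) ->
  forall v, `|pole_cubic M e v| <= (4 / r) ^+ 3 * (4 / 3 * k) * enorm v ^+ 3.
Proof.
move=> sM r0 H v.
have [v0|v0] := eqVneq (enorm v) 0.
  have /eqP := enorm_eq0 v0; move/eqP => ->.
  by rewrite /pole_cubic mulmx0 !dot0l !(mulr0, mul0r) subrr enorm0 expr0n mulr0 normr0.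
have vp : 0 < enorm v by rewrite lt_neqAle eq_sym v0 enorm_ge0.
(* three steps of length [r / 4] stay in the ball *)
pose w := (r / 4 / enorm v) *: v.
have wr : enorm w = r / 4.
  by rewrite enormZ ger0_norm ?divrK ?unitfE// !divr_ge0// ltW.
have Hw (t : R) : 0 <= t <= 3 -> `|pole_cubic M e (c + t *: w)| <= k.
  move=> /andP[t0 t3]; apply: H; rewrite addrC addKr enormZ ger0_norm// wr.
  by have := ler_wpM2r (ltW r0) t3; lra.
have E6 : 6 * pole_cubic M e w = pole_cubic M e (c + 3 *: w) - 3 * pole_cubic M e (c + 2 *: w)
    + 3 * pole_cubic M e (c + 1 *: w) - pole_cubic M e (c + 0 *: w).
  rewrite !pole_cubicD// /pole_cubic; ring.
have Hwk : `|pole_cubic M e w| <= 4 / 3 * k.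
  have h t : 0 <= t <= 3 -> - k <= pole_cubic M e (c + t *: w) <= k.
    by move=> /Hw; rewrite ler_norml.
  have /andP[? ?] := h 0 ltac:(lra); have /andP[? ?] := h 1 ltac:(lra).
  have /andP[? ?] := h 2 ltac:(lra); have /andP[? ?] := h 3 ltac:(lra).
  by rewrite ler_norml; apply/andP; lra.
have -> : v = (4 / r * enorm v) *: w.
  by rewrite /w scalerA (_ : _ * _ = 1) ?scale1r//; field; rewrite v0 gt_eqF.
have t0 : 0 <= 4 / r * enorm v by rewrite mulr_ge0 ?divr_ge0 ?enorm_ge0// ltW.
rewrite pole_cubicZ normrM enormZ wr (ger0_norm (exprn_ge0 3 t0)) (ger0_norm t0).
rewrite (_ : 4 / r * enorm v * (r / 4) = enorm v); last by field; rewrite gt_eqF.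
rewrite exprMn mulrAC ler_wpM2r ?exprn_ge0 ?enorm_ge0//.
by rewrite ler_wpM2l// exprn_ge0// divr_ge0// ltW.
Qed.

(** The cubic form [pole_cubic M e] determines the tensor product of [M] and
    [e]: testing it on [e], on vectors orthogonal to [e] and on their sums
    controls the quadratic form of [M], scaled by the length of [e]. *)
Lemma pole_cubic_moment M e (k : R) : M^T = M -> 0 <= k ->
  (forall v, `|pole_cubic M e v| <= k * enorm v ^+ 3) ->
  fnorm M * enorm e <= 36 * k.
Proof.
move=> sM k0 H.
have [e0|e0] := eqVneq (enorm e) 0; first by rewrite e0 mulr0 mulr_ge0.
have n0 : 0 < enorm e by rewrite lt_neqAle eq_sym e0 enorm_ge0.
set n := enorm e in e0 n0 *; set a := dot (M *m e) e.
have ee : dot e e = n ^+ 2 by rewrite -enorm_sqr.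
have Ha : `|a| <= k * n / 3.
  have := H e; rewrite /pole_cubic -/a ee -/n.
  rewrite (_ : 2 * a * n ^+ 2 - _ = - 3 * n ^+ 2 * a); last by ring.
  rewrite normrM normrM normrN (gtr0_norm (_ : 0 < 3))// (ger0_norm (sqr_ge0 _)).
  rewrite (_ : k * n ^+ 3 = 3 * n ^+ 2 * (k * n / 3)); last by field.
  by rewrite ler_pM2l// mulr_gt0// exprn_gt0.
have Hb x : dot x e = 0 -> `|dot (M *m x) e| <= k * enorm x / 2.
  move=> xe; have [x0|x0] := eqVneq (enorm x) 0.
    by rewrite (enorm_eq0 x0) mulmx0 dot0l normr0 enorm0 mulr0 mul0r.
  have := H x; rewrite /pole_cubic xe mulr0 subr0 -enorm_sqr normrM normrM.
  rewrite (gtr0_norm (_ : 0 < 2))// (ger0_norm (sqr_ge0 _)) mulrAC.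
  rewrite (_ : k * enorm x ^+ 3 = 2 * enorm x ^+ 2 * (k * enorm x / 2)); last by field.
  by rewrite ler_pM2l// mulr_gt0// exprn_gt0// lt_neqAle eq_sym x0 enorm_ge0.
(* [x] is rescaled to the length of [e] so that [e + x] has norm at most [2 n];
   the three terms contribute [8 + 1 / 3 + 3 <= 12] times [k n], divided by 5 *)
have Hc1 x : dot x e = 0 -> enorm x = n -> `|dot (M *m x) x| <= 12 / 5 * k * n.
  move=> xe xn; have := H (e + x); have := Hb x xe; rewrite xn.
  have -> : pole_cubic M e (e + x) =
      n ^+ 2 * (- a - 6 * dot (M *m x) e - 5 * dot (M *m x) x).
    rewrite /pole_cubic mulmxDr !(dotDl, dotDr) xe (dotC e x) xe ee -(enorm_sqr x) xn.
    rewrite (quad_sym e x sM) -/a; ring.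
  have : enorm (e + x) ^+ 3 <= (2 * n) ^+ 3.
    rewrite lerXn2r ?nnegrE ?enorm_ge0 ?mulr_ge0 ?(ltW n0)//.
    by apply: le_trans (enormD _ _) _; rewrite xn -/n; lra.
  move=> /(ler_wpM2l k0); rewrite (_ : k * (2 * n) ^+ 3 = n ^+ 2 * (8 * (k * n))); last by ring.
  move=> h1 h2 h3; have := le_trans h3 h1.
  rewrite normrM (ger0_norm (sqr_ge0 _)) ler_pM2l ?exprn_gt0//.
  move: h2 Ha; rewrite -[12 / 5 * k * n]mulrA !ler_norml; move: (k * n) => kn.
  by move=> /andP[? ?] /andP[? ?] /andP[? ?]; apply/andP; lra.
have Hc x : dot x e = 0 -> n * `|dot (M *m x) x| <= 12 / 5 * k * enorm x ^+ 2.
  move=> xe; have [x0|x0] := eqVneq (enorm x) 0.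
    by rewrite (enorm_eq0 x0) mulmx0 dot0l normr0 enorm0 expr0n !mulr0.
  have xp : 0 < enorm x by rewrite lt_neqAle eq_sym x0 enorm_ge0.
  have nx0 : 0 <= n / enorm x by rewrite divr_ge0// ltW.
  have := Hc1 ((n / enorm x) *: x); rewrite dotZl xe mulr0 enormZ ger0_norm// divfK//.
  move=> /(_ erefl erefl); rewrite -scalemxAr dotZl dotZr mulrA normrM -expr2 (ger0_norm (sqr_ge0 _)).
  have xn0 : 0 <= enorm x ^+ 2 / n by rewrite divr_ge0 ?sqr_ge0 ?(ltW n0).
  move=> /(ler_wpM2l xn0).
  rewrite (_ : enorm x ^+ 2 / n * ((n / enorm x) ^+ 2 * `|dot (M *m x) x|) = n * `|dot (M *m x) x|); last first.
    by field; rewrite e0 x0.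
  by rewrite (_ : _ / n * (_ * n) = 12 / 5 * k * enorm x ^+ 2)//; field.
(* an arbitrary vector splits into a multiple of [e] and an orthogonal part *)
have Hz z : `|dot (M *m z) z| <= 4 * k / n * enorm z ^+ 2.
  pose al := dot z e / n ^+ 2; pose x := z - al *: e.
  have xe : dot x e = 0 by rewrite dotBl dotZl ee divfK ?subrr// expf_neq0.
  have zE : z = al *: e + x by rewrite addrC subrK.
  clearbody x.
  have zn : enorm z ^+ 2 = (al * n) ^+ 2 + enorm x ^+ 2.
    by rewrite !enorm_sqr zE !(dotDl, dotDr, dotZl, dotZr) xe (dotC e x) xe ee; ring.
  have -> : dot (M *m z) z = al ^+ 2 * a + 2 * al * dot (M *m x) e + dot (M *m x) x.
    by rewrite zE mulmxDr -scalemxAr !(dotDl, dotDr, dotZl, dotZr) (quad_sym e x sM) -/a; ring.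
  rewrite -(ler_pM2l n0) (_ : n * (4 * k / n * _) = 4 * k * enorm z ^+ 2); last by field.
  rewrite zn -[n in n * `|_|]gtr0_norm// -normrM mulrDr mulrDr.
  apply: le_trans (ler_normD _ _) _; apply: le_trans (lerD (ler_normD _ _) (lexx _)) _.
  have h3 := Hc x xe; rewrite -[n in n * `|_|]gtr0_norm// -normrM in h3.
  have h2 : `|n * (2 * al * dot (M *m x) e)| <= k * ((al * n) ^+ 2 + enorm x ^+ 2).
    rewrite (_ : n * _ = 2 * (al * n) * dot (M *m x) e); last by ring.
    rewrite normrM normrM (gtr0_norm (_ : 0 < 2))//.
    apply: le_trans (ler_wpM2l _ (Hb x xe)) _; first by rewrite mulr_ge0.
    rewrite (_ : _ * (k * _ / 2) = k * (`|al * n| * enorm x)); last by field.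
    rewrite ler_wpM2l// -(real_normK (num_real (al * n))).
    by have := sqr_ge0 (`|al * n| - enorm x); have := sqr_ge0 `|al * n|; have := sqr_ge0 (enorm x); nra.
  have h1 : `|n * (al ^+ 2 * a)| <= k * (al * n) ^+ 2 / 3.
    rewrite (_ : n * _ = n * al ^+ 2 * a); last by ring.
    rewrite normrM (ger0_norm (_ : 0 <= n * al ^+ 2)); last by rewrite mulr_ge0 ?sqr_ge0// ltW.
    apply: le_trans (ler_wpM2l _ Ha) _; first by rewrite mulr_ge0 ?sqr_ge0// ltW.
    by rewrite le_eqVlt; apply/orP; left; apply/eqP; field.
  have := mulr_ge0 k0 (sqr_ge0 (al * n)); have := mulr_ge0 k0 (sqr_ge0 (enorm x)).
  move: h1 h2 h3; rewrite -[12 / 5 * k * _]mulrA -[4 * k * _]mulrA mulrDr.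
  move: (k * (al * n) ^+ 2) (k * enorm x ^+ 2) => p q; lra.
have := fnorm_le_quad sM Hz; move=> /(ler_wpM2r (ltW n0)).
by rewrite (_ : 9 * _ * n = 36 * k)//; field.
Qed.

(** As [pole_cubic_growth], by the second difference of a quadratic form. *)
Lemma quad_growth M c (r k : R) : M^T = M -> 0 < r ->
  (forall s, enorm (s - c) < r -> `|dot (M *m s) s| <= k) ->
  fnorm M <= 9 * ((4 / r) ^+ 2 * (2 * k)).
Proof.
move=> sM r0 H; apply: fnorm_le_quad => // v.
have [v0|v0] := eqVneq (enorm v) 0.
  by rewrite (enorm_eq0 v0) mulmx0 dot0l normr0 enorm0 expr0n mulr0.
have vp : 0 < enorm v by rewrite lt_neqAle eq_sym v0 enorm_ge0.
pose w := (r / 4 / enorm v) *: v.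
have wr : enorm w = r / 4.
  by rewrite enormZ ger0_norm ?divrK ?unitfE// !divr_ge0// ltW.
have Hw (t : R) : 0 <= t <= 3 -> `|dot (M *m (c + t *: w)) (c + t *: w)| <= k.
  move=> /andP[t0 t3]; apply: H; rewrite addrC addKr enormZ ger0_norm// wr.
  by have := ler_wpM2r (ltW r0) t3; lra.
have qD z (t : R) : dot (M *m (c + t *: z)) (c + t *: z) =
    dot (M *m c) c + 2 * t * dot (M *m c) z + t ^+ 2 * dot (M *m z) z.
  by rewrite mulmxDr -scalemxAr !(dotDl, dotDr, dotZl, dotZr) (quad_sym z c sM); ring.
have Hwk : `|dot (M *m w) w| <= 2 * k.
  have := Hw 0 ltac:(lra); have := Hw 1 ltac:(lra); have := Hw 2 ltac:(lra).
  rewrite !qD !ler_norml => /andP[? ?] /andP[? ?] /andP[? ?]; apply/andP; lra.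
have -> : v = (4 / r * enorm v) *: w.
  by rewrite /w scalerA (_ : _ * _ = 1) ?scale1r//; field; rewrite v0 gt_eqF.
have t0 : 0 <= 4 / r * enorm v by rewrite mulr_ge0 ?divr_ge0 ?enorm_ge0// ltW.
rewrite -scalemxAr dotZl dotZr mulrA -expr2 normrM (ger0_norm (sqr_ge0 _)) enormZ wr (ger0_norm t0).
rewrite (_ : 4 / r * enorm v * (r / 4) = enorm v); last by field; rewrite gt_eqF.
by rewrite exprMn mulrAC ler_wpM2r ?sqr_ge0// ler_wpM2l// sqr_ge0.
Qed.

Lemma pole0_lipschitz M y1 y2 (rmin rmax : R) : 0 < rmin ->
  rmin <= enorm y1 <= rmax -> rmin <= enorm y2 <= rmax ->
  `|pole0 M y1 - pole0 M y2| <=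
  (12 * rmax * rmin^-1 ^+ 5 + 30 * rmax ^+ 2 * rmin^-1 ^+ 6) * fnorm M * enorm (y1 - y2).
Proof.
move=> r0 /andP[a1 b1] /andP[a2 b2].
have y10 := lt_le_trans r0 a1; have y20 := lt_le_trans r0 a2.
have rmax0 : 0 <= rmax := ltW (lt_le_trans y10 b1).
have F0 := fnorm_ge0 M; have e0 := enorm_ge0 (y1 - y2).
set k1 := (enorm y1)^-1; set k2 := (enorm y2)^-1; set K := rmin^-1.
have k10 : 0 <= k1 <= K by rewrite invr_ge0 enorm_ge0 lef_pV2.
have k20 : 0 <= k2 <= K by rewrite invr_ge0 enorm_ge0 lef_pV2.
have /andP[k1p k1K] := k10; have /andP[k2p k2K] := k20.
have K0 : 0 <= K := le_trans k1p k1K.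
have -> : pole0 M y1 - pole0 M y2 =
    (dot (M *m (y1 - y2)) y1 + dot (M *m y2) (y1 - y2)) * k1 ^+ 5
    + dot (M *m y2) y2 * (k1 ^+ 5 - k2 ^+ 5).
  by rewrite /pole0 -/k1 -/k2 mulmxBr dotBl dotBr; ring.
have dle x y : `|dot (M *m x) y| <= 6 * fnorm M * (enorm x * enorm y).
  by apply: le_trans (dot_le _ _) _; rewrite mulrA ler_wpM2r ?enorm_ge0// enorm_mulmx.
rewrite [(_ + _) * fnorm M]mulrDl [(_ + _) * enorm _]mulrDl.
apply: le_trans (ler_normD _ _) _; apply: lerD.
  rewrite normrM (ger0_norm (exprn_ge0 _ k1p)).
  apply: (@le_trans _ _ (12 * fnorm M * (enorm (y1 - y2) * rmax) * K ^+ 5)); last first.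
    by rewrite le_eqVlt; apply/orP; left; apply/eqP; ring.
  apply: ler_pM => //; [exact: exprn_ge0| |by rewrite lerXn2r ?nnegrE].
  apply: le_trans (ler_normD _ _) _.
  apply: le_trans (lerD (dle _ _) (dle _ _)) _.
  rewrite [enorm y2 * _]mulrC -mulrDr -mulrDr.
  rewrite (_ : 12 * fnorm M * (enorm (y1 - y2) * rmax) = 6 * fnorm M * (enorm (y1 - y2) * (2 * rmax))); last by ring.
  by rewrite ler_wpM2l ?mulr_ge0// ler_wpM2l//; lra.
rewrite normrM.
apply: (@le_trans _ _ (6 * fnorm M * (rmax * rmax) * (5 * K ^+ 6 * enorm (y1 - y2)))); last first.
  by rewrite le_eqVlt; apply/orP; left; apply/eqP; ring.
apply: ler_pM => //.
  by apply: le_trans (dle _ _) _; rewrite ler_wpM2l ?mulr_ge0// ler_pM ?enorm_ge0.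
have -> : k1 ^+ 5 - k2 ^+ 5 = (enorm y2 - enorm y1) *
    (k1 * k2 * (k1 ^+ 4 + k1 ^+ 3 * k2 + k1 ^+ 2 * k2 ^+ 2 + k1 * k2 ^+ 3 + k2 ^+ 4)).
  by rewrite /k1 /k2; field; rewrite !gt_eqF.
rewrite normrM [X in _ <= X]mulrC; apply: ler_pM => //.
  by rewrite (enorm_sub y1); exact: enorm_lipschitz.
have P i j : 0 <= k1 ^+ i * k2 ^+ j <= K ^+ i * K ^+ j.
  by rewrite mulr_ge0 ?exprn_ge0//= ler_pM ?exprn_ge0// lerXn2r ?nnegrE.
rewrite (_ : k1 * k2 * _ = k1 ^+ 5 * k2 ^+ 1 + k1 ^+ 4 * k2 ^+ 2 + k1 ^+ 3 * k2 ^+ 3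
   + k1 ^+ 2 * k2 ^+ 4 + k1 ^+ 1 * k2 ^+ 5); last by ring.
have /andP[? h1] := P 5%N 1%N; have /andP[? h2] := P 4%N 2%N; have /andP[? h3] := P 3%N 3%N.
have /andP[? h4] := P 2%N 4%N; have /andP[? h5] := P 1%N 5%N.
rewrite ger0_norm ?addr_ge0// (_ : 5 * K ^+ 6 = K ^+ 5 * K ^+ 1 + K ^+ 4 * K ^+ 2 + K ^+ 3 * K ^+ 3
  + K ^+ 2 * K ^+ 4 + K ^+ 1 * K ^+ 5); last by ring.
by rewrite !lerD.
Qed.

(** Stability of the inverse problem for a single source: first the position
    is recovered, by [pole_cubic_moment], because [M] is bounded below; then
    the moment, at a position which is known up to the same error. *)
Lemma pole_stability (rmin rmax r m0 M0 : R) :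
  0 < rmin -> 0 < rmax -> 0 < r -> 0 < m0 -> 0 < M0 ->
  exists2 C : R, 0 < C & forall (M1 M2 : 'M[R]_3) (P1 P2 b : E) (eta : R),
    M1^T = M1 -> M2^T = M2 -> m0 <= fnorm M1 -> fnorm M2 <= M0 ->
    (forall a, enorm (a - b) < r ->
      [/\ rmin <= enorm (P1 - a) <= rmax, rmin <= enorm (P2 - a) <= rmax,
          forall i, `|pole1 M1 (P1 - a) i - pole1 M2 (P2 - a) i| <= eta &
          forall i j, `|pole2 M1 (P1 - a) i j - pole2 M2 (P2 - a) i j| <= eta]) ->
    enorm (P1 - P2) + fnorm (M1 - M2) <= C * eta.
Proof.
move=> rmin0 rmax0 r0 m00 M00.
pose K1 := rmax ^+ 7 * (rmax * (4 + 3 * rmax)).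
pose K2 := (4 / r) ^+ 3 * (4 / 3 * K1).
pose K3 := 36 * K2 / m0.
pose K4 := 12 * rmax * rmin^-1 ^+ 5 + 30 * rmax ^+ 2 * rmin^-1 ^+ 6.
pose K5 := rmax ^+ 5 * (rmax * (3 + 2 * rmax) + K4 * M0 * K3).
pose K6 := 9 * ((4 / r) ^+ 2 * (2 * K5)).
have K10 : 0 < K1 by rewrite !mulr_gt0 ?exprn_gt0// addr_gt0// mulr_gt0.
have r40 : 0 < 4 / r by rewrite divr_gt0.
have K20 : 0 < K2 by apply: mulr_gt0; [exact: exprn_gt0|exact: mulr_gt0].
have K30 : 0 < K3 by rewrite divr_gt0// mulr_gt0.
have K40 : 0 < K4 by rewrite addr_gt0// !mulr_gt0 ?exprn_gt0 ?invr_gt0.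
have K50 : 0 < K5.
  apply: mulr_gt0; first exact: exprn_gt0.
  apply: addr_gt0; last by apply: mulr_gt0 => //; exact: mulr_gt0.
  by apply: mulr_gt0 => //; apply: addr_gt0 => //; exact: mulr_gt0.
have K60 : 0 < K6.
  by apply: mulr_gt0 => //; apply: mulr_gt0; [exact: exprn_gt0|exact: mulr_gt0].
exists (K3 + K6); first exact: addr_gt0.
move=> M1 M2 P1 P2 b eta s1 s2 lM1 lM2 H.
have eta0 : 0 <= eta.
  have /H[_ _ /(_ 0) h _] : enorm (b - b) < r by rewrite subrr enorm0.
  exact: le_trans (normr_ge0 _) h.
have PE a : (P1 - a) - (P2 - a) = P1 - P2 by rewrite opprB addrA subrK.
have Hs s : enorm (s - (P1 - b)) < r -> enorm (P1 - s - b) < r.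
  by rewrite enorm_sub (_ : P1 - b - s = P1 - s - b)// addrAC.
(* the observation point ranges over a ball, hence so does [P1 - a] *)
have C1 v : `|pole_cubic M1 (P1 - P2) v| <= K2 * eta * enorm v ^+ 3.
  have -> : K2 * eta = (4 / r) ^+ 3 * (4 / 3 * (K1 * eta)) by rewrite /K2; ring.
  apply: (pole_cubic_growth (c := P1 - b)) => // s /Hs /H[h1 h2 h3 h4].
  have := pole_cubic_le s1 rmin0 h1 h2 h3 h4.
  by rewrite PE subKr /K1 !mulrA.
have De : enorm (P1 - P2) <= K3 * eta.
  have := pole_cubic_moment s1 (mulr_ge0 (ltW K20) eta0) C1.
  move=> h; rewrite (_ : K3 * eta = 36 * (K2 * eta) / m0); last by rewrite /K3; ring.
  rewrite ler_pdivlMr//; apply: le_trans h.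
  by rewrite mulrC ler_wpM2r ?enorm_ge0.
rewrite mulrDl; apply: lerD => //.
have sD : (M1 - M2)^T = M1 - M2 by rewrite linearB /= s1 s2.
have -> : K6 * eta = 9 * ((4 / r) ^+ 2 * (2 * (K5 * eta))) by rewrite /K6; ring.
apply: (quad_growth (c := P1 - b)) => // s /Hs /H[h1 h2 h3 h4].
have := pole0_diff_le s1 rmin0 h1 h2 h3 h4.
have := pole0_lipschitz M2 rmin0 h1 h2; rewrite PE.
move: h1 h2 {h3 h4}; rewrite subKr => /andP[l1 u1] _ h5 h6.
have y0 : 0 < enorm s := lt_le_trans rmin0 l1.
have -> : dot ((M1 - M2) *m s) s = enorm s ^+ 5 * ((pole0 M1 s - pole0 M2 (P2 - (P1 - s)))
    - (pole0 M2 s - pole0 M2 (P2 - (P1 - s)))).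
  move: (pole0 M2 (P2 - _)) => w; rewrite mulmxBl dotBl /pole0; field.
  by rewrite gt_eqF.
rewrite normrM ger0_norm ?exprn_ge0 ?enorm_ge0// /K5 -mulrA.
apply: ler_pM => //; first by rewrite exprn_ge0 ?enorm_ge0.
  by rewrite lerXn2r ?nnegrE ?enorm_ge0// ltW.
apply: le_trans (ler_normB _ _) _; rewrite mulrDl; apply: lerD => //.
apply: le_trans h5 _; rewrite -/K4 -[_ * fnorm M2 * _]mulrA.
clearbody K3 K4; rewrite -!mulrA ler_wpM2l ?(ltW K40)//.
by apply: ler_pM; rewrite ?fnorm_ge0 ?enorm_ge0.
Qed.

End Poles.

(** * Mixed partial derivatives and the mean value property *)

Section Schwarz.
Context {R : realType} {n : nat}.
Local Notation E := 'cV[R]_n.+1.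
Implicit Types (f g : E -> R) (x y w : E) (i j : 'I_n.+1).
Local Notation e_ i := (delta_mx i 0 : E).

(** The mean value theorem in each of the two directions. *)
Lemma second_difference f i j x (h : R) : Ck 2 f ->
  exists2 z, `|z - x| <= `|h| * (`|e_ i| + `|e_ j|) &
    f (x + h *: e_ i + h *: e_ j) - f (x + h *: e_ i) - (f (x + h *: e_ j) - f x)
    = h * (h * partial j (partial i f) z).
Proof.
move=> Cf; have Ci : Ck 1 (partial i f) := Ck_partial i Cf.
pose g y := f (y - - (h *: e_ j)) - f y.
have Cg : Ck 2 g := CkB (Ck_shift (- (h *: e_ j)) Cf) Cf.
have dg y : partial i g y = partial i f (y + h *: e_ j) - partial i f y.
  rewrite -[h *: e_ j in RHS]opprK -[partial i f (y - _)]partial_shift.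
  by apply: derive_val; apply: is_deriveB; apply: CkS_derive; [exact: Ck_shift Cf|exact: Cf].
have [t t01] : exists2 t : R, 0 <= t <= 1 &
    g (x + h *: e_ i) - g x = h * partial i g (x + t *: (h *: e_ i)).
  apply: (is_derive_line_MVT (df := fun t => h * partial i g (x + t *: (h *: e_ i)))) => t.
  exact: (is_deriveZv h (CkS_derive i Cg _)).
rewrite dg; set y := x + t *: _ => Hg.
have [s s01] : exists2 s : R, 0 <= s <= 1 &
    partial i f (y + h *: e_ j) - partial i f y = h * partial j (partial i f) (y + s *: (h *: e_ j)).
  apply: (is_derive_line_MVT (df := fun s => h * partial j (partial i f) (y + s *: (h *: e_ j)))) => s.
  exact: (is_deriveZv h (CkS_derive j Ci _)).
move=> Hf; exists (y + s *: (h *: e_ j)).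
  rewrite addrAC /y [x + _]addrC addrK; apply: le_trans (ler_normD _ _) _; rewrite !normrZ mulrDr.
  have ht (r a : R) : 0 <= r <= 1 -> 0 <= a -> `|r| * (`|h| * a) <= `|h| * a.
    move=> /andP[r0 r1] a0; rewrite -[leRHS]mul1r ler_wpM2r ?mulr_ge0//.
    by rewrite ger0_norm.
  by apply: lerD; apply: ht.
by rewrite -Hf -Hg /g !opprK.
Qed.

(** Both mixed derivatives at nearby points equal the same second difference
    quotient. *)
Lemma partial_comm f i j x : Ck 2 f -> partial i (partial j f) x = partial j (partial i f) x.
Proof.
move=> Cf; apply/eqP; rewrite -subr_eq0 -normr_le0; apply/ler_addgt0Pl => eps eps0.
rewrite addr0; have e20 : 0 < eps / 2 by rewrite divr_gt0.
have cij k l : continuous (partial k (partial l f)).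
  by apply: (@Ck_continuous _ _ 0); apply: Ck_partial; exact: Ck_partial.
have near k l : exists2 d : R, 0 < d & forall z, `|z - x| < d ->
    `|partial k (partial l f) x - partial k (partial l f) z| <= eps / 2.
  have /cvgrPdist_le/(_ _ e20)/nbhs_ballP[d d0 H] := cij k l x.
  by exists d => // z zx; apply: H; rewrite mx_norm_ball /ball_/= distrC.
have [d1 d10 H1] := near i j; have [d2 d20 H2] := near j i.
pose K := `|e_ i| + `|e_ j| + 1; have K0 : 0 < K by rewrite ltr_wpDl ?addr_ge0.
pose h := Num.min d1 d2 / (2 * K).
have m0 : 0 < Num.min d1 d2 by rewrite lt_min d10.
have h0 : 0 < h by rewrite divr_gt0// mulr_gt0.
have hK z : `|z - x| <= `|h| * (`|e_ i| + `|e_ j|) -> `|z - x| < Num.min d1 d2.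
  move=> /le_lt_trans; apply; rewrite gtr0_norm//.
  apply: (@lt_le_trans _ _ (h * (2 * K))); last by rewrite /h divfK// gt_eqF ?mulr_gt0.
  by rewrite ltr_pM2l// /K; have := normr_ge0 (e_ i); have := normr_ge0 (e_ j); lra.
have [z1 /hK z1x E1] := second_difference i j x h Cf.
have [z2 + E2] := second_difference j i x h Cf.
rewrite [`|e_ j| + _]addrC => /hK z2x.
move: z1x z2x; rewrite !lt_min => /andP[_ /H2 h2] /andP[/H1 h1 _].
move: E1 E2 h1 h2; move: (partial j (partial i f) z1) (partial i (partial j f) z2) => A B E1 E2.
have -> : A = B.
  have hn0 : h != 0 by rewrite gt_eqF.
  apply: (mulfI hn0); apply: (mulfI hn0).
  by rewrite -E1 -E2 (addrAC x (h *: e_ j)) subrACA.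
move=> h1 h2; apply: le_trans (ler_distD B _ _) _; rewrite [eps]splitr; apply: lerD; first exact: h1.
by rewrite distrC; exact: h2.
Qed.

Lemma dilation_is_derive g x y (c : R) w b :
  is_derive (y + c *: (x - y)) w g b ->
  is_derive x w (fun x => g (y + c *: (x - y))) (c * b).
Proof.
move=> dg; have x0 v (z : E) : z = z + 0 *: v by rewrite scale0r addr0.
have := is_deriveZv c dg; rewrite (x0 (c *: w) (y + _)) => /is_derive_line d1.
rewrite (x0 w x); apply/is_derive_line.
rewrite (_ : (fun s : R => _) = (fun s : R => g (y + c *: (x - y) + s *: (c *: w))))//.
apply/funext => s; congr g.
by rewrite addrAC scalerDr addrA !scalerA mulrC.
Qed.

Lemma Ck_dilation k g y (c : R) : Ck k g -> Ck k (fun x => g (y + c *: (x - y))).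
Proof.
have cs : continuous (fun x : E => y + c *: (x - y)).
  move=> x; apply: (@cvgD _ _ _ (nbhs x) _ (cst y) (fun x => c *: (x - y))); first exact: cvg_cst.
  apply: (@cvgZl_tmp R E _ (nbhs x) _ c (fun x => x - y)).
  exact: (cvgB (@cvg_id _ (nbhs x)) (cvg_cst y)).
elim: k g => [|k IH] g Hg.
  by move=> x; apply: (@continuous_comp _ _ _ (fun x : E => y + c *: (x - y)) g); [exact: cs|exact: (Hg : continuous g)].
apply: (@CkS_is_derive _ _ _ _ (fun i x => c * partial i g (y + c *: (x - y)))).
- move=> x; apply: (@continuous_comp _ _ _ (fun x : E => y + c *: (x - y)) g); first exact: cs.
  exact: (Ck_continuous Hg).
- by move=> i x; exact: (dilation_is_derive (CkS_derive i Hg _)).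
- by move=> i; apply: CkZ; apply: IH; exact: Ck_partial.
Qed.

Lemma partial_dilation k g y (c : R) i x : Ck k.+1 g ->
  partial i (fun x => g (y + c *: (x - y))) x = c * partial i g (y + c *: (x - y)).
Proof. by move=> Hg; apply: derive_val; exact: (dilation_is_derive (CkS_derive i Hg _)). Qed.

End Schwarz.

Section MeanValue.
Context {R : realType}.
Local Notation E := 'cV[R]_3.
Implicit Types (f g : E -> R) (x y P : E) (i j : 'I_3) (r : R).

(** Differentiation under the integral sign, on an open interval of parameters
    around [[0, 1]] so that both ends are interior. *)
Lemma int3_param_const (f f' : R -> E -> R) (u v r B : R) :
  u < 0 -> 1 < v ->
  (forall t : R, u < t < v -> continuous (f t)) ->
  (forall (t : R) x, u < t < v -> r <= `|x| -> f t x = 0) ->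
  (forall (t : R) x, u < t < v -> is_derive t 1 (f ^~ x) (f' t x)) ->
  (forall (t : R) x, u < t < v -> `|f' t x| <= B) ->
  (forall (t : R) x, u < t < v -> r <= `|x| -> f' t x = 0) ->
  (forall t : R, u < t < v -> int3 setT (f' t) = 0) ->
  int3 setT (f 0) = int3 setT (f 1).
Proof.
move=> u0 v1 cf f0 df fB f'0 I0.
pose G (x : E) : R := Num.max 0 B * \1_(cube `|r|) x.
have B0 : 0 <= Num.max 0 B by rewrite le_max lexx.
have intG : integ setT G.
  apply: (@integ_bounded _ _ _ (Num.max 0 B) (`|r| + 1)) => //.
  - exact: mblT.
  - apply: measurable_onM; first exact: measurable_on_cst.
    rewrite /measurable_on (_ : (fun p => _) = \1_(@vec3 R @^-1` cube `|r|) :> (_ -> R))//.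
    by apply: measurable_indic; exact: mbl_cube.
  - move=> x _; rewrite /G normrM ger0_norm//; rewrite -[leRHS]mulr1 ler_wpM2l// indicE.
    by case: (_ \in _); rewrite ?normr1 ?normr0.
  - move=> x _ rx; rewrite /G indicE memNset ?mulr0// => /cubeE; lra.
pose I := `]u, v[%classic : set R.
have IE (t : R) : I t -> u < t < v by rewrite /I/= in_itv.
have D (t : R) : u < t < v -> is_derive t 1 (fun s => int3 setT (f s)) 0.
  move=> tuv.
  have It : I t by rewrite /I/= in_itv.
  have intf (s : R) : I s -> (@leb3 R).-integrable (@vec3 R @^-1` setT) (EFin \o (fun p => f s (vec3 p))).
    move=> /IE suv; apply: (@integ_continuous _ _ _ r); [exact: mblT|exact: cf|].
    by move=> x _; exact: f0.
  have derf (s : R) p : I s -> (@vec3 R @^-1` setT) p -> derivable ((fun s p => f s (vec3 p)) ^~ p) s 1.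
    by move=> /IE suv _; have [] := df s (vec3 p) suv.
  have d1 (s : R) p : I s -> partial1of2 (fun s p => f s (vec3 p)) s p = f' s (vec3 p).
    by move=> /IE suv; rewrite partial1of2E; have d := df s (vec3 p) suv; exact: derive_val.
  have G0 p : 0 <= G (vec3 p) by rewrite mulr_ge0// indicE.
  have Gub (s : R) p : I s -> (@vec3 R @^-1` setT) p ->
      `|partial1of2 (fun s p => f s (vec3 p)) s p| <= G (vec3 p).
    move=> Is _; rewrite d1//; have suv := IE _ Is.
    have [rx|xr] := leP r `|vec3 p|; first by rewrite f'0// normr0.
    rewrite /G indicE mem_set ?mulr1.
      by apply: le_trans (fB _ _ suv) _; rewrite le_max lexx orbT.
    by apply: in_cube; apply: lt_le_trans xr _; exact: ler_norm.
  have mT : measurable (@vec3 R @^-1` setT) by exact: mblT.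
  apply: DeriveDef.
    exact: (derivable_under_integral mT It intf derf G0 intG Gub).
  have := differentiation_under_integral mT It intf derf G0 intG Gub.
  rewrite derive1E => ->; rewrite -[RHS](I0 t tuv).
  by apply: eq_Rintegral => p _; rewrite /= d1.
have in01 (t : R) : 0 <= t <= 1 -> u < t < v.
  by move=> /andP[t0 t1]; rewrite (lt_le_trans u0)//= (le_lt_trans t1).
have [] := @MVT_segment R (fun s => int3 setT (f s)) (fun=> 0) 0 1 ler01.
- by move=> t; rewrite in_itv/= => /andP[t0 t1]; apply: D; apply: in01; rewrite !ltW.
- apply: derivable_within_continuous => t; rewrite in_itv/= => /in01 /D dt.
  exact: ex_derive.
- by move=> t _; rewrite mul0r => /eqP; rewrite subr_eq0 => /eqP.
Qed.

Lemma cv_norm_enorm x : `|x| <= enorm x.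
Proof.
rewrite cv_norm_le ?enorm_ge0//; apply/forallP => i; exact: coord_le_enorm.
Qed.

Lemma vanishing_far g r P : (forall x, r <= enorm (x - P) -> g x = 0) -> vanishing (r + `|P|) g.
Proof.
move=> H x Hx; apply: H; apply: le_trans (cv_norm_enorm _).
by have := ler_normB (x - P) (- P); rewrite opprK subrK normrN; lra.
Qed.

(** The derivative along the translation is a sum of partial derivatives, whose
    integrals vanish by the divergence theorem. *)
Lemma int3_translate f r P : Ck 1 f -> vanishing r f ->
  int3 setT (fun x => f (x - P)) = int3 setT f.
Proof.
move=> Cf f0.
pose F (t : R) x := f (x - t *: P).
pose F' (t : R) x := - \sum_i P i 0 * partial i f (x - t *: P).
have CF (t : R) : Ck 1 (F t) by exact: Ck_shift.
pose s := r + 2 * `|P|.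
have far (t : R) x : -1 < t < 2 -> s <= `|x| -> r <= `|x - t *: P|.
  move=> /andP[t1 t2] sx; have := ler_normB (x - t *: P) (- (t *: P)).
  rewrite opprK subrK normrN normrZ.
  have : `|t| * `|P| <= 2 * `|P| by rewrite ler_wpM2r// ler_norml; lra.
  by rewrite /s in sx; lra.
have dF (t : R) x : is_derive t 1 (F ^~ x) (F' t x).
  have /is_derive_line := C1_is_derive (x + t *: (- P)) (- P) Cf.
  rewrite (_ : (fun u : R => _) = F ^~ x); last by apply/funext => u; rewrite /F scalerN.
  by rewrite /F' -sumrN scalerN; congr (is_derive _ _ _ _); apply: eq_bigr => i _; rewrite !mxE mulNr.
have s1 (t : R) x : -1 < t < 2 -> s + 1 <= `|x| -> r + 1 <= `|x - t *: P|.
  move=> /andP[t1 t2] sx; have := ler_normB (x - t *: P) (- (t *: P)).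
  rewrite opprK subrK normrN normrZ.
  have : `|t| * `|P| <= 2 * `|P| by rewrite ler_wpM2r// ler_norml; lra.
  by rewrite /s in sx; lra.
have [B0 B0p HB0] : exists2 B, 0 <= B & forall i x, `|partial i f x| <= B.
  have bd i : exists2 B, 0 <= B & forall x, `|partial i f x| <= B.
    have [B B0 HB] := continuous_bounded_on (r + 1) (Ck_continuous (Ck_partial i Cf)).
    exists B => // x; have [rx|/ltW/HB//] := leP (r + 1) `|x|.
    by rewrite (partial_vanishing i f0 rx) normr0.
  have [b0 p0 h0] := bd 0; have [b1 p1 h1] := bd 1; have [b2 p2 h2] := bd 2%:R.
  exists (b0 + b1 + b2); first by rewrite !addr_ge0.
  move=> i x; move: i; apply/forall_I3; split.
  - by have := h0 x; lra.
  - by have := h1 x; lra.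
  - by have := h2 x; lra.
have := @int3_param_const F F' (-1) 2 (s + 1) (3 * `|P| * B0).
rewrite (_ : F 0 = f); last by apply/funext => x; rewrite /F scale0r subr0.
rewrite (_ : F 1 = fun x => f (x - P)); last by apply/funext => x; rewrite /F scale1r.
move=> -> //.
- by lra.
- by move=> t _; exact: (Ck_continuous (CF t)).
- by move=> t x tt sx; apply: f0; apply: far tt _; lra.
- move=> t x _; rewrite /F' normrN; apply: sum_le_mul => i //; exact: cv_coord_le.
- move=> t x tt sx; rewrite /F' big1 ?oppr0// => i _.
  by rewrite (partial_vanishing i f0 (s1 t x tt sx)) mulr0.
- move=> t tt; rewrite /F'.
  have cp i : continuous (fun x => partial i f (x - t *: P)).
    by apply: (@Ck_continuous _ _ 0); apply: Ck_shift; exact: Ck_partial.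
  have p0 i x : s + 1 <= `|x| -> partial i f (x - t *: P) = 0.
    by move=> sx; rewrite (partial_vanishing i f0 (s1 t x tt sx)).
  have ip i : integ setT (fun x => partial i f (x - t *: P)).
    apply: (@integ_continuous _ _ _ (s + 1)) => //; first exact: mblT.
    by move=> x _; exact: p0.
  rewrite int3N; [|exact: mblT|]; last by apply: integ_sum => [|i]; [exact: mblT|apply: integZ => //; exact: mblT].
  rewrite int3_sum; [|exact: mblT|by move=> i; apply: integZ => //; exact: mblT].
  rewrite big1 ?oppr0// => i _; rewrite int3Z//; last exact: mblT.
  have -> : int3 setT (fun x => partial i f (x - t *: P)) = 0; last by rewrite mulr0.
  apply: (int3_partial_eq0 (g := F t) (i := i) (r := s + 1)) => //.
  + by move=> x; have := CkS_derive i (CF t) x; rewrite /F partial_shift.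
  + by move=> x sx; apply: f0; apply: far tt _; lra.
Qed.

Lemma Ck_sub_coord k P i : Ck k (fun x : E => (x - P) i 0).
Proof.
rewrite (_ : (fun x : E => _) = (fun x => x i 0 - P i 0)); last by apply/funext => x; rewrite !mxE.
by apply: CkB; [exact: Ck_coord|exact: Ck_cst].
Qed.

Lemma Ck_sqdist k P : Ck k (fun x : E => dot (x - P) (x - P)).
Proof.
by apply: Ck_sum => i _; apply: CkM; exact: Ck_sub_coord.
Qed.

Lemma sub_coord_is_derive P i x v : is_derive x v (fun x : E => (x - P) i 0) (v i 0).
Proof.
rewrite (_ : (fun x : E => _) = (fun x => x i 0 - P i 0)); last by apply/funext => y; rewrite !mxE.
by have := is_deriveB (coord_is_derive i x v) (is_derive_cst (P i 0) x v); rewrite subr0.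
Qed.

Lemma sqdist_is_derive P i x :
  is_derive x (delta_mx i 0) (fun x : E => dot (x - P) (x - P)) (2 * (x - P) i 0).
Proof.
rewrite /dot; under eq_fun do rewrite sum_I3.
have d j := is_deriveM (sub_coord_is_derive P j x (delta_mx i 0)) (sub_coord_is_derive P j x (delta_mx i 0)).
apply: is_derive_eq (is_deriveD (is_deriveD (d 0) (d 1)) (d 2%:R)) _.
move: i {d}; apply/forall_I3; split; rewrite /GRing.scale /= !mxE !(eqxx, I3_eqE) /=; ring.
Qed.

(** A radial function times the position vector is a gradient, of a radial
    function with the same support. *)
Lemma radial_antiderivative (q : R -> R) (rho : R) P :
  0 < rho -> continuous (fun x : E => q (enorm x)) -> (forall t, rho <= t -> q t = 0) ->
  exists W : E -> R, [/\ Ck 1 W, forall x, rho <= enorm (x - P) -> W x = 0 &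
    forall i x, partial i W x = q (enorm (x - P)) * (x - P) i 0].
Proof.
move=> rho0 cq q0.
pose k (s : R) : R := q (Num.sqrt s) / 2.
have ck : continuous k.
  pose line (s : R) : E := Num.sqrt s *: delta_mx 0 0.
  have -> : k = (fun s => q (enorm (line s)) * 2^-1).
    by apply/funext => s; rewrite /k /line enormZ enorm_delta mulr1 ger0_norm// sqrtr_ge0.
  have cl : continuous line.
    move=> s; apply: (@cvgZr_tmp R E _ (nbhs s) _ (@Num.sqrt R)); exact: sqrt_continuous.
  move=> s; apply: (@cvgM _ _ (nbhs s)); last exact: cvg_cst.
  exact: (@continuous_comp _ _ _ line (fun x : E => q (enorm x)) s (cl s) (cq (line s))).
(* starting from -1 makes [F] differentiable at 0, that is, [W] at [P] *)
pose F (s : R) : R := (\int[@lebesgue_measure R]_(t in `[(-1)%R, s]) k t)%R.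
have dF (s : R) : -1 < s -> is_derive s 1 F (k s).
  move=> s1; have ik : (@lebesgue_measure R).-integrable `[(-1)%R, (s + 1)%R] (EFin \o k).
    apply: continuous_compact_integrable; first exact: segment_compact.
    exact: continuous_subspaceT.
  have ss : s < s + 1 by rewrite ltrDl.
  have [d1 d2] := continuous_FTC1_closed ss ik s1 (ck s).
  by apply: DeriveDef; [exact: d1|rewrite -derive1E; exact: d2].
pose v s := F s - F (rho ^+ 2).
have v0 s : rho ^+ 2 <= s -> v s = 0.
  move=> rs; rewrite /v; have r1 : -1 < rho ^+ 2 by have := sqr_ge0 rho; lra.
  have [||c] := @MVT_segment R F k _ _ rs.
  - by move=> x; rewrite in_itv/= => /andP[xr _]; apply: dF; exact: lt_trans xr.
  - apply: derivable_within_continuous => x; rewrite in_itv/= => /andP[xr _].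
    by have [] := dF x (lt_le_trans r1 xr).
  rewrite in_itv/= => /andP[rc _] ->.
  by rewrite /k q0 ?mul0r// -[rho]gtr0_norm// -sqrtr_sqr ler_wsqrtr.
exists (fun x => v (dot (x - P) (x - P))).
have dW i x : is_derive x (delta_mx i 0) (fun x : E => v (dot (x - P) (x - P)))
    (q (enorm (x - P)) * (x - P) i 0).
  have -> : q (enorm (x - P)) * (x - P) i 0 = k (dot (x - P) (x - P)) * (2 * (x - P) i 0).
    by rewrite /k -enorm_sqr sqrtr_sqr ger0_norm ?enorm_ge0//; field.
  apply: (is_derive_comp1 _ (sqdist_is_derive P i x)).
  have := dot_ge0 (x - P); set N := dot _ _ => N0.
  have N1 : -1 < N by lra.
  have := is_deriveB (dF N N1) (is_derive_cst (F (rho ^+ 2)) N 1).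
  by rewrite subr0.
split.
- apply: (@CkS_is_derive _ _ _ _ (fun i x => q (enorm (x - P)) * (x - P) i 0)) => //.
  + move=> x; apply: (@cvgB _ _ _ (nbhs x)); last exact: cvg_cst.
    have cN : continuous (fun x : E => dot (x - P) (x - P)) by exact: (Ck_continuous (Ck_sqdist 0 P)).
    apply: (@continuous_comp _ _ _ (fun x : E => dot (x - P) (x - P)) F); first exact: cN.
    have := dot_ge0 (x - P); set N := dot _ _ => N0.
    have [d1 _] : is_derive N 1 F (k N) by apply: dF; lra.
    by apply/differentiable_continuous/derivable1_diffP.
  + by move=> i; apply: (@CkM _ _ 0); [exact: (@Ck_shift _ _ 0 _ P cq)|exact: Ck_sub_coord].
- by move=> x rx; apply: v0; rewrite -enorm_sqr lerXn2r ?nnegrE ?enorm_ge0// ltW.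
- by move=> i x; exact: derive_val.
Qed.

Definition laplacian f x : R := \sum_i partial i (partial i f) x.

(** Averages of a harmonic function against dilations of a radial weight do not
    depend on the scale: the derivative in the scale is the integral of a
    gradient against a gradient, hence of a compactly supported function
    against the Laplacian. *)
Lemma mean_value (q : R -> R) (H : E -> R) P (rho rho' : R) :
  0 < rho < rho' -> continuous (fun x : E => q (enorm x)) -> (forall t, rho <= t -> q t = 0) ->
  Ck 2 H -> (forall x, enorm (x - P) < rho' -> laplacian H x = 0) ->
  int3 setT (fun x => q (enorm (x - P)) * H x) = H P * int3 setT (fun x => q (enorm (x - P))).
Proof.
move=> /andP[rho0 rr] cq q0 CH LH.
have [W [CW W0 dW]] := radial_antiderivative P rho0 cq q0.
pose Q x := q (enorm (x - P)).
have cQ : continuous Q := @Ck_shift _ _ 0 _ P cq.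
have [M M0 HM] := continuous_bounded_on (rho + `|P|) cQ.
have vQ : vanishing (rho + `|P|) Q by apply: vanishing_far => x rx; exact: q0.
have vW : vanishing (rho + `|P|) W by exact: vanishing_far.
pose v := rho' / rho.
have v1 : 1 < v by rewrite /v ltr_pdivlMr// mul1r.
have v0 : 0 < v := lt_trans ltr01 v1.
pose f (t : R) x := Q x * H (P + t *: (x - P)).
pose f' (t : R) x := Q x * \sum_i (x - P) i 0 * partial i H (P + t *: (x - P)).
have CHi i : Ck 1 (partial i H) := Ck_partial i CH.
have cHi i : continuous (partial i H) := Ck_continuous (CHi i).
have [B0 B0p HB0] : exists2 B, 0 <= B &
    forall i x, `|x| <= `|P| + v * (rho + `|P| + `|P|) -> `|partial i H x| <= B.
  have bd i := continuous_bounded_on (`|P| + v * (rho + `|P| + `|P|)) (cHi i).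
  have [b0 p0 h0] := bd 0; have [b1 p1 h1] := bd 1; have [b2 p2 h2] := bd 2%:R.
  exists (b0 + b1 + b2); first by rewrite !addr_ge0.
  move=> i x Hx; move: i; apply/forall_I3; split.
  - by have := h0 x Hx; lra.
  - by have := h1 x Hx; lra.
  - by have := h2 x Hx; lra.
have cd (t : R) i : continuous (fun x => partial i H (P + t *: (x - P))).
  by apply: (@Ck_continuous _ _ 1); exact: Ck_dilation.
have := @int3_param_const f f' (-1) v (rho + `|P|) (M * (3 * (rho + `|P| + `|P|) * B0)).
rewrite (_ : f 0 = fun x => H P * Q x); last first.
  by apply/funext => x; rewrite /f scale0r addr0 mulrC.
rewrite (_ : f 1 = fun x => Q x * H x); last first.
  by apply/funext => x; rewrite /f scale1r addrC subrK.
rewrite int3Z; [|exact: mblT|]; last first.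
  apply: (@integ_continuous _ _ _ (rho + `|P|)) => //; first exact: mblT.
  by move=> x _; exact: vQ.
move=> pc; apply: esym; apply: pc => //.
- move=> t _ x; apply: (@cvgM _ _ (nbhs x)); first exact: cQ.
  have : continuous (fun x => H (P + t *: (x - P))) by apply: (@Ck_continuous _ _ 2); exact: Ck_dilation.
  exact.
- by move=> t x _ xr; rewrite /f vQ// mul0r.
- move=> t x _; have /is_derive_line dH := C1_is_derive (P + t *: (x - P)) (x - P) (Ck_le CH).
  apply: is_derive_eq (is_deriveM (is_derive_cst (Q x) t 1) dH) _.
  by rewrite /f' /GRing.scale /= mulr0 addr0.
- move=> t x /andP[t1 tv].
  have [xr|/ltW xr] := leP (rho + `|P|) `|x|.
    by rewrite /f' vQ// mul0r normr0 mulr_ge0// mulr_ge0// mulr_ge0// !addr_ge0// ltW.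
  rewrite /f' normrM; apply: ler_pM => //; first exact: HM.
  have xP : `|x - P| <= rho + `|P| + `|P|.
    by apply: le_trans (ler_normB _ _) _; rewrite lerD2r.
  apply: sum_le_mul => i; first by apply: le_trans (cv_coord_le _ _) xP.
  apply: HB0; apply: le_trans (ler_normD _ _) _; rewrite lerD2l normrZ; apply: ler_pM => //.
  by rewrite ler_norml; apply/andP; lra.
- by move=> t x _ xr; rewrite /f' vQ// mul0r.
- move=> t /andP[t1 tv].
  have E1 x : f' t x = \sum_i partial i H (P + t *: (x - P)) * partial i W x.
    by rewrite /f' mulr_sumr; apply: eq_bigr => i _; rewrite dW mulrA [RHS]mulrC.
  have ci i : continuous (fun x => partial i H (P + t *: (x - P)) * partial i W x).
    apply: (@CkM _ _ 0); first exact: cd.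
    exact: (Ck_continuous (Ck_partial i CW)).
  have ii i : integ setT (fun x => partial i H (P + t *: (x - P)) * partial i W x).
    apply: (@integ_continuous _ _ _ (rho + `|P| + 1)) => //; first exact: mblT.
    by move=> x _ xr; rewrite (partial_vanishing i vW xr) mulr0.
  have CHt i : Ck 1 (fun x => partial i H (P + t *: (x - P))) by exact: Ck_dilation.
  rewrite (_ : f' t = fun x => \sum_i partial i H (P + t *: (x - P)) * partial i W x); last exact/funext.
  rewrite int3_sum//; last exact: mblT.
  under eq_bigr do rewrite (int3_by_parts _ (CHt _) CW vW).
  have cpi i : continuous (partial i (fun x => partial i H (P + t *: (x - P)))).
    exact: (Ck_continuous (Ck_partial i (CHt i))).
  have jj i : integ setT (fun x => partial i (fun x => partial i H (P + t *: (x - P))) x * W x).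
    apply: (@integ_continuous _ _ _ (rho + `|P|)) => //; first exact: mblT.
      by apply: (@CkM _ _ 0); [exact: cpi|exact: (Ck_continuous CW)].
    by move=> x _ xr; rewrite vW// mulr0.
  rewrite sumrN -int3_sum//; last exact: mblT.
  rewrite (_ : (fun x => _) = fun=> 0); first by rewrite int3_0 oppr0.
  apply/funext => x; rewrite -mulr_suml.
  have [rx|xr] := leP rho (enorm (x - P)); first by rewrite W0// mulr0.
  under eq_bigr do rewrite (partial_dilation _ _ _ _ (CHi _)).
  rewrite -mulr_sumr [X in t * X](_ : _ = laplacian H (P + t *: (x - P)))// LH ?mulr0 ?mul0r//.
  rewrite addrC addKr enormZ.
  have [t0|t0] := ltP 0 t.
    rewrite gtr0_norm//; apply: (@lt_le_trans _ _ (v * rho)); last by rewrite /v divfK// gt_eqF.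
    by apply: ltr_pM => //; rewrite ?enorm_ge0// ltW.
  apply: le_lt_trans rr; rewrite -[leRHS]mul1r; apply: ler_pM; rewrite ?enorm_ge0// ?(ltW xr)//.
  by rewrite ler_norml; apply/andP; lra.
Qed.

End MeanValue.

(** * Radial potentials *)

Section SmoothFunctions.
Context {R : realType}.
Local Notation E := 'cV[R]_3.
Implicit Types (U : set E) (f g : E -> R) (x y a P : E) (i j : 'I_3) (M : 'M[R]_3).

Definition Cinf f := forall k, Ck k f.

Lemma Cinf_partial f i : Cinf f -> Cinf (partial i f).
Proof. by move=> Cf k; exact: (Ck_partial i (Cf k.+1)). Qed.

Lemma Cinf_continuous f : Cinf f -> continuous f.
Proof. by move=> /(_ 0%N). Qed.

Lemma Cinf_sum (I : Type) (r : seq I) (F : I -> E -> R) :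
  (forall a : I, Cinf (F a)) -> Cinf (fun x => \sum_(a <- r) F a x).
Proof. by move=> H k; apply: Ck_sum => a _; exact: H. Qed.

Lemma partialD f g i : Ck 1 f -> Ck 1 g ->
  partial i (fun x => f x + g x) = (fun x => partial i f x + partial i g x).
Proof.
move=> Cf Cg; apply: partial_is_derive => x.
exact: (is_deriveD (CkS_derive i Cf x) (CkS_derive i Cg x)).
Qed.

Lemma partialZ (c : R) f i : Ck 1 f ->
  partial i (fun x => c * f x) = (fun x => c * partial i f x).
Proof.
move=> Cf; apply: partial_is_derive => x.
exact: (is_deriveZ c (CkS_derive i Cf x)).
Qed.

Lemma partial_sum (I : Type) (r : seq I) (F : I -> E -> R) i : (forall a : I, Ck 1 (F a)) ->
  partial i (fun x => \sum_(a <- r) F a x) = (fun x => \sum_(a <- r) partial i (F a) x).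
Proof.
move=> CF; elim: r => [|a r IH].
  apply: partial_is_derive => x; rewrite big_nil.
  under eq_fun do rewrite big_nil; exact: is_derive_cst.
under eq_fun do rewrite big_cons.
rewrite partialD ?IH//; last by apply: Ck_sum => b _; exact: CF.
by apply/funext => x; rewrite big_cons.
Qed.

Lemma partial_near f g i x : (\forall y \near x, f y = g y) -> partial i f x = partial i g x.
Proof. exact: near_eq_derive. Qed.

Lemma partial_open U f g i x : open U -> (forall y, U y -> f y = g y) -> U x ->
  partial i f x = partial i g x.
Proof.
move=> oU fg Ux; apply: partial_near.
by apply: filterS (open_nbhs_nbhs (conj oU Ux)); exact: fg.
Qed.

Lemma partial_open0 U f i x : open U -> (forall y, U y -> f y = 0) -> U x -> partial i f x = 0.
Proof.
move=> oU f0 Ux; rewrite (partial_open i oU f0 Ux).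
exact: (derive_cst (0 : R)).
Qed.

Lemma Cinf_laplacian f : Cinf f -> Cinf (laplacian f).
Proof. by move=> Cf; apply: Cinf_sum => i; do 2 apply: Cinf_partial. Qed.

Lemma laplacian_partial f i : Cinf f -> laplacian (partial i f) = partial i (laplacian f).
Proof.
move=> Cf; rewrite /laplacian partial_sum; last by move=> j; do 2 apply: Cinf_partial.
apply/funext => x; apply: eq_bigr => j _.
rewrite [RHS]partial_comm; last exact: (Cinf_partial j Cf 2).
have E1 : partial j (partial i f) = partial i (partial j f).
  by apply/funext => y; exact: (partial_comm j i y (Cf 2%N)).
by rewrite E1.
Qed.

Lemma laplacian_open0 U f i x : open U -> Cinf f -> (forall y, U y -> laplacian f y = 0) -> U x ->
  laplacian (partial i f) x = 0.
Proof. by move=> oU Cf L0 Ux; rewrite laplacian_partial//; apply: (partial_open0 i oU L0). Qed.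

Lemma laplacian_sum (I : Type) (r : seq I) (F : I -> E -> R) : (forall a : I, Cinf (F a)) ->
  laplacian (fun x => \sum_(a <- r) F a x) = (fun x => \sum_(a <- r) laplacian (F a) x).
Proof.
move=> CF; apply/funext => x; rewrite /laplacian exchange_big; apply: eq_bigr => i _.
rewrite partial_sum; last by move=> a; exact: CF.
by rewrite partial_sum// => a; apply: Cinf_partial.
Qed.

Lemma laplacianZ (c : R) f : Cinf f -> laplacian (fun x => c * f x) = (fun x => c * laplacian f x).
Proof.
move=> Cf; apply/funext => x; rewrite /laplacian mulr_sumr; apply: eq_bigr => i _.
rewrite partialZ; last exact: Cf.
by rewrite partialZ//; exact: (Cinf_partial i Cf).
Qed.

Lemma open_eball a (r : R) : open (eball a r).
Proof.
have cN : continuous (fun x : E => enorm (x - a)).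
  move=> x; apply: (@continuous_comp _ _ _ (fun x : E => dot (x - a) (x - a)) (@Num.sqrt R)).
    exact: (Ck_continuous (Ck_sqdist 0 a)).
  exact: sqrt_continuous.
rewrite (_ : eball a r = (fun x : E => enorm (x - a)) @^-1` `]-oo, r[%classic).
  by apply: open_comp => [x _|]; [exact: cN|exact: interval_open].
by apply/seteqP; split => x /=; rewrite in_itv.
Qed.

(** ** Radial functions *)

(** A function of the squared distance, which is smooth at the centre too. *)
Definition radial (h : R -> R) a x : R := h (dot (x - a) (x - a)).

Lemma Ck_radial k h a : C1k k h -> Ck k (radial h a).
Proof. by move=> Hh; apply: Ck_comp1 => //; exact: Ck_sqdist. Qed.

Lemma Cinf_radial h a : smooth h -> Cinf (radial h a).
Proof. by move=> sh k; apply: Ck_radial. Qed.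

Lemma partial_radial h a i : C1k 1 h ->
  partial i (radial h a) = fun x => 2 * (x - a) i 0 * radial (derive1 h) a x.
Proof.
move=> Hh; apply: partial_is_derive => x; rewrite mulrC.
exact: (is_derive_comp1 (C1kS_derive Hh _) (sqdist_is_derive a i x)).
Qed.

Lemma partial_radial1n h n a i : smooth h ->
  partial i (radial (derive1n n h) a) = fun x => 2 * (x - a) i 0 * radial (derive1n n.+1 h) a x.
Proof.
by move=> sh; rewrite partial_radial ?derive1nS//; exact: (smooth_derive1n n sh 1).
Qed.

Lemma partial2_radial h a i j x : smooth h ->
  partial j (partial i (radial h a)) x =
  4 * (x - a) i 0 * (x - a) j 0 * radial (derive1n 2 h) a x
  + 2 * (i == j)%:R * radial (derive1n 1 h) a x.
Proof.
move=> sh; rewrite (partial_radial1n 0 a i sh).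
have d1 : is_derive x (delta_mx j 0) (fun x : E => 2 * (x - a) i 0) (2 * (i == j)%:R).
  by apply: is_derive_eq (is_deriveZ 2 (sub_coord_is_derive a i x (delta_mx j 0))) _; rewrite mxE andbT.
have d2 := CkS_derive j (Ck_radial a (smooth_derive1n 1 sh 1)) x.
have d : is_derive x (delta_mx j 0) (fun x => 2 * (x - a) i 0 * radial (derive1n 1 h) a x)
   (4 * (x - a) i 0 * (x - a) j 0 * radial (derive1n 2 h) a x
    + 2 * (i == j)%:R * radial (derive1n 1 h) a x).
  apply: is_derive_eq (is_deriveM d1 d2) _.
  rewrite (partial_radial1n 1 a j sh) /GRing.scale /=; ring.
by rewrite /partial (@derive_val _ _ _ _ _ _ _ d).
Qed.

Definition radial_laplacian (h : R -> R) (s : R) : R := 4 * s * derive1n 2 h s + 6 * derive1n 1 h s.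

Lemma smooth_radial_laplacian h : smooth h -> smooth (radial_laplacian h).
Proof.
move=> sh k; apply: C1kD; last by apply: C1kZ; exact: (smooth_derive1n 1 sh).
by apply: C1kM; [apply: C1kZ; exact: C1k_id|exact: (smooth_derive1n 2 sh)].
Qed.

Lemma laplacian_radial h a : smooth h -> laplacian (radial h a) = radial (radial_laplacian h) a.
Proof.
move=> sh; apply/funext => x; rewrite /laplacian.
under eq_bigr do rewrite partial2_radial//.
rewrite sum_I3 !eqxx /radial /radial_laplacian.
set u := derive1n 2 h _; set v := derive1n 1 h _.
have t1 : true%:R = 1 :> R by [].
rewrite t1 /dot sum_I3; ring.
Qed.

End SmoothFunctions.

(** ** The Newtonian potential away from its pole *)

Section Newtonian.
Context {R : realType}.
Local Notation E := 'cV[R]_3.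
Implicit Types (U : set E) (s : R) (x y a P : E) (i j : 'I_3) (M : 'M[R]_3).

(** As a function of the squared distance, smoothed out below [s1]. *)
Definition newton (s1 s : R) : R := step (2 * s / s1 - 1) * s `^ (- 2^-1).

Lemma smooth_affine (b c : R) h : smooth h -> smooth (fun s : R => h (b * s + c)).
Proof.
move=> sh k; apply: C1k_comp => //.
by apply: C1kD; [apply: C1kZ; exact: C1k_id|exact: C1k_cst].
Qed.

Lemma smooth_newton s1 : 0 < s1 -> smooth (newton s1).
Proof.
move=> s0 k; apply: (@C1k_powR _ _ (s1 / 2)); first by rewrite divr_gt0.
  move=> s ss; apply: step_le0; rewrite subr_le0 ler_pdivrMr// mul1r.
  by move: ss; rewrite ltr_pdivlMr// mulrC => /ltW.
have -> : (fun s : R => step (2 * s / s1 - 1)) = (fun s : R => step (2 / s1 * s + -1)).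
  by apply/funext => s; rewrite mulrAC.
exact: (smooth_affine _ _ smooth_step).
Qed.

Lemma powR_sqrtV s : 0 <= s -> s `^ (- 2^-1) = (Num.sqrt s)^-1.
Proof. by move=> s0; rewrite powRN powR12_sqrt. Qed.

Lemma newtonE s1 s : 0 < s1 -> s1 <= s -> newton s1 s = (Num.sqrt s)^-1.
Proof.
move=> s0 ss; rewrite /newton step_ge1 ?mul1r ?powR_sqrtV//; first exact: ltW (lt_le_trans s0 ss).
by rewrite lerBrDr ler_pdivlMr//; lra.
Qed.

Definition newton_coef (n : nat) : R := \prod_(k < n) (- (2 * k + 1)%:R / 2).

Lemma derive1n_newton s1 n s : 0 < s1 -> s1 < s ->
  derive1n n (newton s1) s = newton_coef n * (Num.sqrt s)^-1 ^+ (2 * n + 1).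
Proof.
move=> s0; elim: n s => [|n IH] s ss.
  by rewrite derive1n0 newtonE 1?ltW// /newton_coef big_ord0 mul1r expr1.
have sp : 0 < s := lt_trans s0 ss.
have rp : 0 < Num.sqrt s by rewrite sqrtr_gt0.
rewrite derive1nS derive1E.
have near_s : \forall t \near s, s1 < t by exact: (cvgr_gt s (@cvg_id _ (nbhs s))).
rewrite (@near_eq_derive _ _ _ _ (fun s => newton_coef n * (Num.sqrt s)^-1 ^+ (2 * n + 1))); last first.
  by apply: filterS near_s => t; exact: IH.
have rn0 : Num.sqrt s != 0 by rewrite gt_eqF.
have d := is_deriveZ (newton_coef n) (is_deriveX (2 * n + 1) (is_deriveV rn0 (is_derive1_sqrt sp))).
have -> : 'D_1 (fun s => newton_coef n * (Num.sqrt s)^-1 ^+ (2 * n + 1)) s =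
  'D_1 (newton_coef n \*: (fun y : R => (Num.sqrt y)^-1) ^+ (2 * n + 1)) s.
  by congr ('D_1 _ s); apply/funext => t; rewrite /= fctE.
rewrite (@derive_val _ _ _ _ _ _ _ d) /newton_coef big_ord_recr /= -/(newton_coef n) /GRing.scale /=.
have -> : (2 * n.+1 + 1 = (2 * n).+3)%N by rewrite mulnS addnC.
rewrite addn1 /= !exprS; move: (_ ^+ (2 * n)) ((2 * n).+1%:R) (newton_coef n) => p c m.
by field.
Qed.

Lemma newton_coefE : [/\ newton_coef 2 = 3 / 4, newton_coef 3 = - (15 / 8) & newton_coef 4 = 105 / 16].
Proof. by split; rewrite /newton_coef !big_ord_recr big_ord0 /=; field. Qed.

Lemma newton_harmonic s1 s : 0 < s1 -> s1 < s -> radial_laplacian (newton s1) s = 0.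
Proof.
move=> s0 ss; have sp : 0 < s := lt_trans s0 ss.
rewrite /radial_laplacian !derive1n_newton// /newton_coef !big_ord_recr big_ord0 /=.
have rp : 0 < Num.sqrt s by rewrite sqrtr_gt0.
rewrite -{1}(sqr_sqrtr (ltW sp)); field; by rewrite gt_eqF.
Qed.

(** ** Fields of moment sources *)

(** The pairing of [M] with the Hessian of [f]: the action of a point source with
    moment [M] on the gradient of [f]. *)
Definition contract M (f : E -> R) x : R := \sum_k \sum_l M k l * partial l (partial k f) x.

Lemma Cinf_contract M f : Cinf f -> Cinf (contract M f).
Proof.
move=> Cf; apply: Cinf_sum => k; apply: Cinf_sum => l n; apply: CkZ.
by do 2 apply: Cinf_partial.
Qed.

Lemma contract_partial M f i : Cinf f -> contract M (partial i f) = partial i (contract M f).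
Proof.
move=> Cf; have C2 k l : Cinf (fun x => M k l * partial l (partial k f) x).
  by move=> n; apply: CkZ; do 2 apply: Cinf_partial.
rewrite /contract partial_sum; last by move=> k; apply: Cinf_sum => l; exact: C2.
apply/funext => x; apply: eq_bigr => k _.
rewrite partial_sum; last by move=> l; exact: C2.
apply: eq_bigr => l _; rewrite partialZ; last by do 2 apply: Cinf_partial.
have E1 : partial k (partial i f) = partial i (partial k f).
  by apply/funext => y; exact: (partial_comm k i y (Cf 2%N)).
by rewrite E1 (partial_comm l i x (Cinf_partial k Cf 2)).
Qed.

Lemma laplacian_contract0 M U f x : open U -> Cinf f ->
  (forall y, U y -> laplacian f y = 0) -> U x -> laplacian (contract M f) x = 0.
Proof.
move=> oU Cf L0 Ux.
have C2 k l : Cinf (partial l (partial k f)) by do 2 apply: Cinf_partial.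
have C3 k l : Cinf (fun x => M k l * partial l (partial k f) x) by move=> n; apply: CkZ; exact: C2.
rewrite /contract laplacian_sum; last by move=> k; apply: Cinf_sum.
rewrite big1// => k _; rewrite laplacian_sum// big1// => l _; rewrite laplacianZ//.
have Lk y (Uy : U y) := laplacian_open0 k oU Cf L0 Uy.
by rewrite (laplacian_open0 l oU (Cinf_partial k Cf) Lk Ux) mulr0.
Qed.

(** The Hessian of a radial function is a multiple of the identity, which a
    traceless [M] annihilates, plus a multiple of [(x - a) (x - a)^T]. *)
Lemma contract_radial M (h : R -> R) a : smooth h -> \tr M = 0 ->
  contract M (radial h a) = fun x => 4 * dot (M *m (x - a)) (x - a) * radial (derive1n 2 h) a x.
Proof.
move=> sh; rewrite mxtrace3 => trM; apply/funext => x; rewrite /contract.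
under eq_bigr do under eq_bigr do rewrite partial2_radial//.
rewrite !sum_I3 !(eqxx, I3_eqE).
set u := radial _ a x; set v := radial _ a x.
have t1 : true%:R = 1 :> R by [].
have t0 : false%:R = 0 :> R by [].
rewrite t1 t0 /dot !sum_I3 ![(M *m _) _ _]mxE !sum_I3.
have -> : M 2%:R 2%:R = - M 0 0 - M 1 1 by rewrite -[RHS]addr0 -trM; ring.
ring.
Qed.

Lemma mulmx_sub_is_derive M a i j x :
  is_derive x (delta_mx j 0) (fun x : E => (M *m (x - a)) i 0) (M i j).
Proof.
rewrite (_ : (fun x : E => _) = (fun x => M i 0 * (x - a) 0 0 + M i 1 * (x - a) 1 0
   + M i 2%:R * (x - a) 2%:R 0)); last by apply/funext => y; rewrite [LHS]mxE sum_I3.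
have d k := is_deriveZ (M i k) (sub_coord_is_derive a k x (delta_mx j 0)).
apply: is_derive_eq (is_deriveD (is_deriveD (d 0) (d 1)) (d 2%:R)) _.
move: j {d}; apply/forall_I3; split; rewrite /GRing.scale /= !mxE !(eqxx, I3_eqE) /=; ring.
Qed.

Lemma quad_is_derive M a j x : M^T = M ->
  is_derive x (delta_mx j 0) (fun x : E => dot (M *m (x - a)) (x - a)) (2 * (M *m (x - a)) j 0).
Proof.
move=> sM; rewrite /dot; under eq_fun do rewrite sum_I3.
have d i := is_deriveM (mulmx_sub_is_derive M a i j x) (sub_coord_is_derive a i x (delta_mx j 0)).
apply: is_derive_eq (is_deriveD (is_deriveD (d 0) (d 1)) (d 2%:R)) _.
have S i k : M i k = M k i by rewrite -[in LHS]sM mxE.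
rewrite /GRing.scale /=; move: j {d}; apply/forall_I3.
split; rewrite ![(M *m _) _ _]mxE !sum_I3 ![delta_mx _ _ _ _]mxE !(eqxx, I3_eqE) /=.
- rewrite (S 1 0) (S 2%:R 0); ring.
- rewrite (S 0 1) (S 2%:R 1); ring.
- rewrite (S 0 2%:R) (S 1 2%:R); ring.
Qed.

Lemma radial_is_derive (h : R -> R) n a i x : smooth h ->
  is_derive x (delta_mx i 0) (radial (derive1n n h) a) (2 * (x - a) i 0 * radial (derive1n n.+1 h) a x).
Proof.
move=> sh; rewrite mulrC.
exact: (is_derive_comp1 (smooth_is_derive n _ sh) (sqdist_is_derive a i x)).
Qed.

Lemma partial_quad M a (u v : E -> R) i : M^T = M ->
  (forall i x, is_derive x (delta_mx i 0) u (2 * (x - a) i 0 * v x)) ->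
  partial i (fun x => 4 * dot (M *m (x - a)) (x - a) * u x) = fun x =>
   8 * (M *m (x - a)) i 0 * u x + 8 * dot (M *m (x - a)) (x - a) * (x - a) i 0 * v x.
Proof.
move=> sM du; apply: partial_is_derive => x.
have d1 : is_derive x (delta_mx i 0) (fun x : E => 4 * dot (M *m (x - a)) (x - a))
    (4 * (2 * (M *m (x - a)) i 0)) := is_deriveZ 4 (quad_is_derive a i x sM).
apply: is_derive_eq (is_deriveM d1 (du i x)) _; rewrite /GRing.scale /=.
move: (dot _ _) (u x) (v x) ((M *m _) i 0) ((x - a) i 0) => d p r s t; ring.
Qed.

Lemma partial2_quad M a (u v w : E -> R) i j : M^T = M ->
  (forall i x, is_derive x (delta_mx i 0) u (2 * (x - a) i 0 * v x)) ->
  (forall i x, is_derive x (delta_mx i 0) v (2 * (x - a) i 0 * w x)) ->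
  partial j (fun x => 8 * (M *m (x - a)) i 0 * u x
                      + 8 * dot (M *m (x - a)) (x - a) * (x - a) i 0 * v x) = fun x =>
   8 * M i j * u x
   + 16 * ((M *m (x - a)) i 0 * (x - a) j 0 + (M *m (x - a)) j 0 * (x - a) i 0) * v x
   + 8 * dot (M *m (x - a)) (x - a) * (i == j)%:R * v x
   + 16 * dot (M *m (x - a)) (x - a) * ((x - a) i 0 * (x - a) j 0) * w x.
Proof.
move=> sM du dv; apply: partial_is_derive => x.
have d1 : is_derive x (delta_mx j 0) (fun x : E => 8 * (M *m (x - a)) i 0) (8 * M i j) :=
  is_deriveZ 8 (mulmx_sub_is_derive M a i j x).
have d3 : is_derive x (delta_mx j 0) (fun x : E => 8 * dot (M *m (x - a)) (x - a))
    (8 * (2 * (M *m (x - a)) j 0)) := is_deriveZ 8 (quad_is_derive a j x sM).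
have := sub_coord_is_derive a i x (delta_mx j 0); rewrite mxE andbT => d4.
have d34 : is_derive x (delta_mx j 0) (fun x : E => 8 * dot (M *m (x - a)) (x - a) * (x - a) i 0)
    (8 * dot (M *m (x - a)) (x - a) * (i == j)%:R + (x - a) i 0 * (8 * (2 * (M *m (x - a)) j 0))) :=
  is_deriveM d3 d4.
apply: is_derive_eq (is_deriveD (is_deriveM d1 (du j x)) (is_deriveM d34 (dv j x))) _.
rewrite /GRing.scale /=; move: (u x) (v x) (w x) (dot _ _) (i == j)%:R => p r s d t.
move: ((M *m _) i 0) ((M *m _) j 0) ((x - a) i 0) ((x - a) j 0) => b1 b2 b3 b4; ring.
Qed.

Lemma partial_contract_radial M (h : R -> R) a i : smooth h -> M^T = M -> \tr M = 0 ->
  partial i (contract M (radial h a)) = fun x =>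
   8 * (M *m (x - a)) i 0 * radial (derive1n 2 h) a x
   + 8 * dot (M *m (x - a)) (x - a) * (x - a) i 0 * radial (derive1n 3 h) a x.
Proof.
move=> sh sM trM; rewrite contract_radial//.
by apply: partial_quad => // k x; exact: radial_is_derive.
Qed.

Lemma partial2_contract_radial M (h : R -> R) a i j : smooth h -> M^T = M -> \tr M = 0 ->
  partial j (partial i (contract M (radial h a))) = fun x =>
   8 * M i j * radial (derive1n 2 h) a x
   + 16 * ((M *m (x - a)) i 0 * (x - a) j 0 + (M *m (x - a)) j 0 * (x - a) i 0)
      * radial (derive1n 3 h) a x
   + 8 * dot (M *m (x - a)) (x - a) * (i == j)%:R * radial (derive1n 3 h) a x
   + 16 * dot (M *m (x - a)) (x - a) * ((x - a) i 0 * (x - a) j 0) * radial (derive1n 4 h) a x.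
Proof.
move=> sh sM trM; rewrite partial_contract_radial//.
by apply: partial2_quad => // k x; exact: radial_is_derive.
Qed.

Lemma sqrt_dot x : Num.sqrt (dot x x) = enorm x.
Proof. by rewrite -enorm_sqr sqrtr_sqr ger0_norm ?enorm_ge0. Qed.

(** Twice differentiated, [|x - a|^-1] leaves [3 * pole0 M (x - a)] after
    contraction with [M]; [pole1] and [pole2] come from one and two more
    derivatives. *)
Lemma contract_pole1 s1 M a i x : 0 < s1 -> M^T = M -> \tr M = 0 -> s1 < dot (x - a) (x - a) ->
  contract M (partial i (radial (newton s1) a)) x = 3 * pole1 M (x - a) i.
Proof.
move=> s0 sM trM sx; have sn := smooth_newton s0.
rewrite contract_partial; last exact: Cinf_radial.
rewrite partial_contract_radial// /radial !derive1n_newton//.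
have [-> -> _] := newton_coefE; rewrite /pole1 sqrt_dot; move: (dot _ _) ((enorm _)^-1) => d k; by field.
Qed.

Lemma contract_pole2 s1 M a i j x : 0 < s1 -> M^T = M -> \tr M = 0 -> s1 < dot (x - a) (x - a) ->
  contract M (partial j (partial i (radial (newton s1) a))) x = 3 * pole2 M (x - a) i j.
Proof.
move=> s0 sM trM sx; have sn := smooth_newton s0.
have Cr : Cinf (radial (newton s1) a) := Cinf_radial a sn.
rewrite contract_partial; last exact: Cinf_partial.
rewrite contract_partial// partial2_contract_radial// /radial !derive1n_newton//.
have [-> -> ->] := newton_coefE; rewrite /pole2 sqrt_dot; move: (dot _ _) ((enorm _)^-1) => d k; by field.
Qed.

(** Against a potential that is harmonic around the source, a radially
    smeared moment acts as the point moment. *)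
Lemma source_pairing (q : R -> R) M P (psi : E -> R) (rho rho' : R) :
  0 < rho < rho' -> Ck 1 (fun x : E => q (enorm x)) -> (forall t, rho <= t -> q t = 0) ->
  int3 setT (fun x : E => q (enorm x)) = 1 ->
  Cinf psi -> (forall x, enorm (x - P) < rho' -> laplacian psi x = 0) ->
  int3 setT (fun x => dot (moment_source q M P x) (grad psi x)) = contract M psi P.
Proof.
move=> rr Cq q0 q1 Cpsi L0.
pose Q x := q (enorm (x - P)).
have CQ : Ck 1 Q by exact: (Ck_shift P Cq).
have vQ : vanishing (rho + `|P|) Q by apply: vanishing_far => x rx; exact: q0.
have C1 k : Ck 1 (partial k psi) by exact: (Cinf_partial k Cpsi 1).
have cpQ l : continuous (partial l Q) := Ck_continuous (Ck_partial l CQ).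
have i1 k l : integ setT (fun x => partial k psi x * partial l Q x).
  apply: (@integ_continuous _ _ _ (rho + `|P| + 1)); first exact: mblT.
    by apply: (@CkM _ _ 0); [exact: (Ck_continuous (C1 k))|exact: cpQ].
  by move=> x _ xr; rewrite (partial_vanishing l vQ xr) mulr0.
have cp2 k l : continuous (partial l (partial k psi)) := Ck_continuous (Ck_partial l (C1 k)).
have i2 k l : integ setT (fun x => partial l (partial k psi) x * Q x).
  apply: (@integ_continuous _ _ _ (rho + `|P|)); first exact: mblT.
    by apply: (@CkM _ _ 0); [exact: cp2|exact: (Ck_continuous CQ)].
  by move=> x _ xr; rewrite vQ// mulr0.
transitivity (int3 setT (fun x => Q x * contract M psi x)).
  transitivity (\sum_k \sum_l - M k l * int3 setT (fun x => partial k psi x * partial l Q x)).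
    have mT := @mblT R.
    rewrite (_ : (fun x => _) = (fun x => \sum_k \sum_l - M k l * (partial k psi x * partial l Q x))).
      rewrite int3_sum//; last by move=> k; apply: integ_sum => // l; exact: integZ.
      apply: eq_bigr => k _; rewrite int3_sum//; last by move=> l; exact: integZ.
      by apply: eq_bigr => l _; rewrite int3Z.
    apply/funext => x; rewrite /dot /moment_source; apply: eq_bigr => k _.
    rewrite !mxE -sumrN mulr_suml; apply: eq_bigr => l _; rewrite !mxE -/Q; ring.
  have mT := @mblT R.
  rewrite (_ : (fun x => Q x * contract M psi x) =
    (fun x => \sum_k \sum_l M k l * (partial l (partial k psi) x * Q x))).
    rewrite int3_sum//; last by move=> k; apply: integ_sum => // l; exact: integZ.
    apply: eq_bigr => k _; rewrite int3_sum//; last by move=> l; exact: integZ.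
    by apply: eq_bigr => l _; rewrite int3Z// (int3_by_parts _ (C1 k) CQ vQ) mulrNN.
  apply/funext => x; rewrite /contract mulr_sumr; apply: eq_bigr => k _.
  rewrite mulr_sumr; apply: eq_bigr => l _; ring.
have qI : int3 setT Q = 1.
  rewrite -q1 /Q; apply: (int3_translate (f := fun x => q (enorm x)) (r := rho)) => //.
  by move=> x xr; apply: q0; apply: le_trans xr (cv_norm_enorm _).
rewrite (mean_value rr (Ck_continuous Cq) q0 (Cinf_contract M Cpsi 2)); first by rewrite -/Q qI mulr1.
by move=> x Px; exact: (laplacian_contract0 M (@open_eball _ P rho') Cpsi L0 Px).
Qed.

End Newtonian.

(** * The gravitational measurement *)

Section Cutoff.
Context {R : realType}.
Local Notation E := 'cV[R]_3.
Implicit Types (U : set E) (s t r : R) (x a : E) (i j : 'I_3).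

Lemma segment_bounded (f : R -> R) (u v : R) : u <= v -> continuous f ->
  exists2 M, 0 <= M & forall t, u <= t <= v -> `|f t| <= M.
Proof.
move=> uv cf.
have cn : {within `[u, v], continuous (fun t => `|f t|)}.
  apply: continuous_subspaceT => t.
  by apply: (@continuous_comp _ _ _ f (fun y => `|y|)); [exact: cf|exact: norm_continuous].
have [c _ Hc] := EVT_max uv cn.
by exists `|f c| => // t tuv; apply: Hc; rewrite in_itv.
Qed.

Lemma derive1n_scale (k : R -> R) (c b : R) n : smooth k ->
  derive1n n (fun s => c * k (b * s)) = fun s => c * b ^+ n * derive1n n k (b * s).
Proof.
move=> sk; elim: n => [|n IH]; first by apply/funext => s; rewrite !derive1n0 mulr1.
rewrite derive1nS IH; apply: derive1_is_derive => s.
have db : is_derive s 1 (fun s : R => b * s) b.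
  by apply: is_derive_eq (is_deriveZ b (is_derive_id s 1)) _; rewrite /GRing.scale /= mulr1.
rewrite (_ : c * b ^+ n.+1 * _ = (c * b ^+ n) * (derive1n n.+1 k (b * s) * b)); last by rewrite exprS; ring.
exact: (is_deriveZ (c * b ^+ n) (is_derive_comp1 (smooth_is_derive n (b * s) sk) db)).
Qed.

Lemma derive1nD (f g : R -> R) n : smooth f -> smooth g ->
  derive1n n (fun s => f s + g s) = fun s => derive1n n f s + derive1n n g s.
Proof.
move=> sf sg; elim: n => [|n IH]; first by apply/funext => s; rewrite !derive1n0.
rewrite derive1nS IH; apply: derive1_is_derive => s.
exact: (is_deriveD (smooth_is_derive n s sf) (smooth_is_derive n s sg)).
Qed.

Lemma radial_laplacian_near (f g : R -> R) s : (\forall t \near s, f t = g t) ->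
  radial_laplacian f s = radial_laplacian g s.
Proof. by move=> fg; rewrite /radial_laplacian !(derive1n_near _ fg). Qed.

(** Minus the Newtonian profile beyond distance [sqrt 2], and 0 below distance 1. *)
Definition tail_profile t : R := - (step (t - 1) * newton 1 t).

Lemma smooth_tail : smooth tail_profile.
Proof.
move=> k; apply: C1kN; apply: C1kM; last exact: smooth_newton.
rewrite (_ : (fun t => step (t - 1)) = (fun t : R => step (1 * t + -1))).
  exact: smooth_affine smooth_step k.
by apply/funext => t; rewrite mul1r.
Qed.

Lemma tail_lt1 t : t < 1 -> tail_profile t = 0.
Proof. by move=> t1; rewrite /tail_profile step_le0 ?mul0r ?oppr0// subr_le0 ltW. Qed.

Lemma tail_laplacian_gt2 t : 2 < t -> radial_laplacian tail_profile t = 0.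
Proof.
move=> t2; rewrite (@radial_laplacian_near _ (fun u => -1 * newton 1 (1 * u))).
  rewrite /radial_laplacian !derive1n_scale; do ?exact: smooth_newton.
  rewrite !expr1n !mulr1 !mul1r.
  have := @newton_harmonic R 1 t ltr01 ltac:(lra); rewrite /radial_laplacian => h.
  by rewrite -[RHS]oppr0 -h; ring.
have : \forall u \near t, 2 < u by exact: (cvgr_gt t (@cvg_id _ (nbhs t))).
apply: filterS => u u2; rewrite /tail_profile step_ge1; last by lra.
by rewrite mulN1r !mul1r.
Qed.

(** The Newtonian potential cut off at distance [r], in a way which is
    invariant under scaling. *)
Definition newton_cut s1 r s : R := newton s1 s + r^-1 * tail_profile (r^-2 * s).

Lemma smooth_scale (k : R -> R) (c b : R) : smooth k -> smooth (fun s => c * k (b * s)).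
Proof.
move=> sk n; apply: C1kZ; have := smooth_affine b 0 sk n.
by congr (C1k n _); apply/funext => s; rewrite addr0.
Qed.

Lemma smooth_newton_cut s1 r : 0 < s1 -> smooth (newton_cut s1 r).
Proof. by move=> s0 k; apply: C1kD; [exact: smooth_newton|exact: smooth_scale smooth_tail k]. Qed.

Lemma newton_cut_in s1 r s : 0 < r -> s < r ^+ 2 -> newton_cut s1 r s = newton s1 s.
Proof.
move=> r0 sr; rewrite /newton_cut tail_lt1 ?mulr0 ?addr0//.
by rewrite -exprVn mulrC exprVn ltr_pdivrMr ?mul1r// exprn_gt0.
Qed.

Lemma newton_cut_out s1 r s : 0 < s1 -> 0 < r -> s1 <= r ^+ 2 -> 2 * r ^+ 2 <= s -> newton_cut s1 r s = 0.
Proof.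
move=> s0 r0 sr rs; have r20 : 0 < r ^+ 2 by rewrite exprn_gt0.
have s2 : 2 <= r^-2 * s by rewrite mulrC ler_pdivlMr.
rewrite /newton_cut /tail_profile step_ge1 ?mul1r; last by lra.
rewrite (newtonE s0); last by apply: le_trans sr _; apply: le_trans rs; lra.
rewrite newtonE//; last by lra.
rewrite sqrtrM ?invr_ge0 ?sqr_ge0// sqrtrV ?sqr_ge0// sqrtr_sqr gtr0_norm// invfM invrK mulrN.
by rewrite mulKf ?subrr// gt_eqF.
Qed.

Lemma newton_cut_laplacian s1 r s : 0 < s1 -> 0 < r ->
  radial_laplacian (newton_cut s1 r) s =
  radial_laplacian (newton s1) s + r^-1 ^+ 3 * radial_laplacian tail_profile (r^-2 * s).
Proof.
move=> s0 r0; have sn := smooth_newton s0; have st := smooth_tail.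
have rn : r != 0 by rewrite gt_eqF.
rewrite /radial_laplacian /newton_cut !derive1nD ?derive1n_scale//; do ?exact: smooth_scale.
move: (derive1n 2 _ _) (derive1n 1 _ _) (derive1n 2 _ _) (derive1n 1 _ _) => p q p' q'.
by field.
Qed.

End Cutoff.

Section Potentials.
Context {R : realType}.
Local Notation E := 'cV[R]_3.
Implicit Types (U : set E) (s r : R) (x a : E) (i j : 'I_3) (o : option 'I_3).

(** The radial function itself ([None]) or one of its partial derivatives. *)
Definition potential (h : R -> R) a o : E -> R :=
  if o is Some j then partial j (radial h a) else radial h a.

Lemma Cinf_potential (h : R -> R) a o : smooth h -> Cinf (potential h a o).
Proof. by move=> sh; case: o => [j|]; [apply: Cinf_partial|]; exact: Cinf_radial. Qed.

Lemma potential_open (f g : R -> R) U a o x : open U ->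
  (forall y, U y -> radial f a y = radial g a y) -> U x -> potential f a o x = potential g a o x.
Proof. by move=> oU fg Ux; case: o => [j|] /=; [exact: (partial_open j oU fg)|exact: fg]. Qed.

Lemma potentialE (h : R -> R) a o x : smooth h -> potential h a o x =
  if o is Some j then 2 * (x - a) j 0 * derive1n 1 h (dot (x - a) (x - a)) else h (dot (x - a) (x - a)).
Proof.
move=> sh; case: o => [j|] //=.
by rewrite (partial_radial1n 0 a j sh).
Qed.

Lemma laplacian_potential (h : R -> R) a o : smooth h ->
  laplacian (potential h a o) = potential (radial_laplacian h) a o.
Proof.
move=> sh; case: o => [j|] /=; last exact: laplacian_radial.
by rewrite laplacian_partial ?laplacian_radial//; exact: Cinf_radial.
Qed.

Lemma coord_le_sqdist x i s : dot x x <= s -> `|x i 0| <= 1 + s.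
Proof.
move=> xs; apply: le_trans (coord_le_enorm _ _) _.
have := enorm_sqr x; have := enorm_ge0 x; move: (enorm x) => n n0 nn.
by have := sqr_ge0 (n - 1); nra.
Qed.

Lemma potential_bounded (h : R -> R) s : smooth h -> 0 <= s -> (forall t, s < t -> h t = 0) ->
  exists2 A, 0 <= A & forall a o x, `|potential h a o x| <= A.
Proof.
move=> sh s0 h0; have d0 t : s < t -> derive1n 1 h t = 0.
  move=> st; rewrite (@derive1n_near _ _ (fun=> 0)).
    by rewrite derive1n1 derive1_cst.
  have : \forall u \near t, s < u by exact: (cvgr_gt t (@cvg_id _ (nbhs t))).
  by apply: filterS => u; exact: h0.
have [A A0 HA] := segment_bounded s0 (smooth_continuous sh).
have [B B0 HB] := segment_bounded s0 (smooth_continuous (smooth_derive1n 1 sh)).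
exists (A + 2 * (1 + s) * B); first by rewrite addr_ge0// !mulr_ge0// addr_ge0.
move=> a o x; rewrite potentialE//; have N0 := dot_ge0 (x - a).
have s1 : 0 <= 2 * (1 + s) * B by rewrite !mulr_ge0// addr_ge0.
have [sN|Ns] := ltP s (dot (x - a) (x - a)).
  by case: o => [j|]; rewrite ?d0// ?h0// ?mulr0 normr0 addr_ge0.
case: o => [j|].
  apply: (@le_trans _ _ (2 * (1 + s) * B)); last by rewrite lerDr.
  rewrite normrM; apply: ler_pM => //; last by apply: HB; rewrite N0.
  by rewrite normrM gtr0_norm// ler_wpM2l// coord_le_sqdist.
apply: (@le_trans _ _ A); last by rewrite lerDl.
by apply: HA; rewrite N0.
Qed.

Lemma potential_support (h : R -> R) a o x s : smooth h -> 0 <= s -> (forall t, s < t -> h t = 0) ->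
  s < dot (x - a) (x - a) -> potential h a o x = 0.
Proof.
move=> sh s0 h0 sx; rewrite potentialE//.
have d0 t : s < t -> derive1n 1 h t = 0.
  move=> st; rewrite (@derive1n_near _ _ (fun=> 0)).
    by rewrite derive1n1 derive1_cst.
  have : \forall u \near t, s < u by exact: (cvgr_gt t (@cvg_id _ (nbhs t))).
  by apply: filterS => u; exact: h0.
by case: o => [j|]; rewrite ?d0 ?h0 ?mulr0.
Qed.

Lemma potentialD (f g : R -> R) a o x : smooth f -> smooth g ->
  potential (fun s => f s + g s) a o x = potential f a o x + potential g a o x.
Proof.
move=> sf sg; rewrite !potentialE//; last by move=> k; exact: C1kD.
by case: o => [j|] //; rewrite derive1nD// mulrDr.
Qed.

Lemma potential_scale (k : R -> R) (c b : R) o x : smooth k ->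
  potential (fun s => c * k (b ^+ 2 * s)) 0 o x =
  c * (if o is Some j then b else 1) * potential k 0 o (b *: x).
Proof.
move=> sk; rewrite !potentialE//; last exact: smooth_scale.
rewrite !subr0 dotZl dotZr mulrA -expr2.
by case: o => [j|]; rewrite ?mulr1// derive1n_scale// [(b *: x) j 0]mxE; ring.
Qed.

Lemma potential_shift (h : R -> R) a o x : smooth h -> potential h a o x = potential h 0 o (x - a).
Proof. by move=> sh; rewrite !potentialE// subr0. Qed.

(** The Laplacian of the truncated potential: one part sits near the pole, the
    other one at distance [r], where it is small. *)
Lemma laplacian_newton_cut s1 r a o x : 0 < s1 -> 0 < r ->
  laplacian (potential (newton_cut s1 r) a o) x =
  potential (radial_laplacian (newton s1)) a o x
  + r^-1 ^+ 3 * (if o is Some j then r^-1 else 1)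
    * potential (radial_laplacian tail_profile) 0 o (r^-1 *: (x - a)).
Proof.
move=> s0 r0; have sn := smooth_newton s0; have st := @smooth_tail R.
have sL := smooth_radial_laplacian sn; have sT := smooth_radial_laplacian st.
rewrite laplacian_potential; last exact: smooth_newton_cut.
rewrite (_ : radial_laplacian (newton_cut s1 r) = fun s => radial_laplacian (newton s1) s
  + r^-1 ^+ 3 * radial_laplacian tail_profile (r^-1 ^+ 2 * s)); last first.
  by apply/funext => s; rewrite (newton_cut_laplacian _ s0 r0) (exprVn r 2).
rewrite potentialD//; last exact: smooth_scale.
by rewrite [X in _ + X]potential_shift ?potential_scale//; exact: smooth_scale.
Qed.

Lemma test_function_cut s1 r a o : 0 < s1 -> 0 < r -> s1 <= r ^+ 2 ->
  test_function setT (potential (newton_cut s1 r) a o).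
Proof.
move=> s0 r0 sr; have sc := smooth_newton_cut r s0.
suff H : test_function setT (radial (newton_cut s1 r) a).
  by case: o => [j|] //=; exact: test_function_partial.
split; first exact: Cinf_radial.
pose K : set E := [set x : E | `|x| <= 2 * r + `|a|].
have cK : compact K.
  apply: cv_bounded_closed_compact.
    exists (2 * r + `|a|); split; first exact: num_real.
    by move=> y ry x /= xr; apply: le_trans xr (ltW ry).
  rewrite (_ : K = (fun x : E => `|x|) @^-1` `]-oo, 2 * r + `|a|]%classic); last first.
    by apply/seteqP; split => x /=; rewrite in_itv.
  by apply: preimage_closed; [move=> y _; exact: norm_continuous|exact: interval_closed].
apply: (compact_supp_intro cK) => // x nK.
apply: newton_cut_out => //; rewrite -enorm_sqr.
have : 2 * r + `|a| < `|x| by rewrite ltNge; apply/negP.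
have := ler_normB (x - a) (- a); rewrite opprK subrK normrN => h1 h2.
have h3 := cv_norm_enorm (x - a).
have h4 : 2 * r <= enorm (x - a) by lra.
have : (2 * r) ^+ 2 <= enorm (x - a) ^+ 2 by rewrite lerXn2r ?nnegrE ?enorm_ge0// mulr_ge0// ltW.
by have := sqr_ge0 r; nra.
Qed.

End Potentials.

Section Gravity.
Context {R : realType}.
Local Notation E := 'cV[R]_3.
Implicit Types (U Om : set E) (f g phi : E -> R) (x a : E) (i j k : 'I_3) (o : option 'I_3).

Lemma L2_cauchy_schwarz U f g : mbl U -> L2 U f -> L2 U g ->
  `|int3 U (fun x => f x * g x)| <=
  Num.sqrt (int3 U (fun x => f x ^+ 2)) * Num.sqrt (int3 U (fun x => g x ^+ 2)).
Proof.
move=> mU Lf Lg.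
pose b (f g : E -> R) := int3 U (fun x => f x * g x).
have LD (f1 f2 : E -> R) : L2 U f1 -> L2 U f2 -> L2 U (f1 + f2) by exact: L2D.
have LZ (c : R) (f1 : E -> R) : L2 U f1 -> L2 U (c *: f1) by exact: L2Z.
have bC (f1 f2 : E -> R) : b f1 f2 = b f2 f1.
  by congr (int3 U _); apply/funext => x; rewrite mulrC.
have bD (f1 f2 f3 : E -> R) : L2 U f1 -> L2 U f2 -> L2 U f3 -> b (f1 + f2) f3 = b f1 f3 + b f2 f3.
  move=> h1 h2 h3; rewrite /b -int3D//; [|exact: L2_mul..].
  by congr (int3 U _); apply/funext => x; rewrite mulrDl.
have bZ (c : R) (f1 f2 : E -> R) : L2 U f1 -> L2 U f2 -> b (c *: f1) f2 = c * b f1 f2.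
  move=> h1 h2; rewrite /b -int3Z//; last exact: L2_mul.
  by congr (int3 U _); apply/funext => x; rewrite mulrA.
have b0 (f1 : E -> R) : L2 U f1 -> 0 <= b f1 f1.
  by move=> _; apply: int3_ge0 => x _; rewrite -expr2 sqr_ge0.
have := cauchy_schwarz LD LZ bC bD bZ b0 Lf Lg.
by congr (_ <= Num.sqrt (int3 U _) * Num.sqrt (int3 U _)); apply/funext => x; rewrite expr2.
Qed.

Lemma int3_sqr_le f (A r : R) : 0 <= r -> continuous f -> (forall x, `|f x| <= A) ->
  (forall x, r <= `|x| -> f x = 0) -> int3 setT (fun x => f x ^+ 2) <= A ^+ 2 * (2 * r) ^+ 3.
Proof.
move=> r0 cf fA f0.
have A0 : 0 <= A := le_trans (normr_ge0 _) (fA 0).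
have cf2 : continuous (fun x => f x ^+ 2) by move=> x; exact: (cvgM (cf x) (cf x)).
have mC := @mbl_cube R r.
have nC x : ~ cube r x -> r <= `|x|.
  by move=> nC; rewrite leNgt; apply/negP => h; apply: nC; exact: in_cube.
rewrite (@int3_setT_sub _ (cube r)) //; last 2 first.
- by apply: continuous_measurable_on => //; exact: mblT.
- by move=> x /nC /f0 ->; rewrite expr0n.
have fin : (@leb3 R (@vec3 R @^-1` cube r) < +oo)%E by have -> := leb3_cube r0; rewrite ltry.
have i1 (c : R) : integ (cube r) (fun=> c).
  exact: (@integrable_bounded_off _ _ _ _ _ (@vec3 R @^-1` cube r) _ `|c|).
have -> : A ^+ 2 * (2 * r) ^+ 3 = int3 (cube r) (fun=> A ^+ 2).
  rewrite /int3 /Rintegral integral_cst// -[X in (_ * X)%E]/(@leb3 R (@vec3 R @^-1` cube r)).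
  by have -> := leb3_cube r0.
apply: int3_le => //.
  apply: (integS mblT mC) => //; apply: (@integ_continuous _ _ _ r) => //; first exact: mblT.
  by move=> x _ /f0 ->; rewrite expr0n.
by move=> x _; rewrite -real_normK ?num_real// lerXn2r ?nnegrE.
Qed.

(** Second derivatives of a test function commute, so the weak derivatives of
    [S] can be exchanged against them. *)
Lemma wderiv_swap (S phi : E -> R) i k : Hk setT 1 S -> test_function setT phi ->
  int3 setT (fun x => wderiv setT k S x * partial i phi x) =
  int3 setT (fun x => wderiv setT i S x * partial k phi x).
Proof.
move=> [_ HS] tphi.
have [exk _] := HS k; have [exi _] := HS i.
have [_ _ Hk] := wderivP exk; have [_ _ Hi] := wderivP exi.
have h1 := Hk _ (test_function_partial i tphi); have h2 := Hi _ (test_function_partial k tphi).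
have Eik : partial k (partial i phi) = partial i (partial k phi).
  by apply/funext => x; exact: (partial_comm k i x (test_function_Ck 2 tphi)).
rewrite Eik in h1; exact: oppr_inj (etrans (esym h1) h2).
Qed.

Lemma test_function_L2 phi : test_function setT phi -> L2 setT phi.
Proof.
move=> tphi; have [r r0 H] := compact_supp_vanishing tphi.2.
apply: (@L2_continuous _ _ _ r); [exact: mblT|exact: test_function_continuous tphi|].
by move=> x _; exact: H.
Qed.

(** The test function [partial i phi] gives the gradient of [S] against that of
    [partial i phi]; exchanging derivatives turns this into [wderiv i S] against
    the Laplacian of [phi].  Only the gradient of [S] enters, and only where
    [phi] is not harmonic. *)
Lemma gravity_identity Om (rho : R) (u : E -> E) (S phi : E -> R) i : open Om ->
  (forall j, L2 Om (fun x => u x j 0)) -> Hk setT 1 S ->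
  (forall psi, Hk setT 1 psi ->
      int3 setT (fun x => dot (wgrad setT S x) (wgrad setT psi x))
      = - int3 Om (fun x => rho * dot (u x) (wgrad setT psi x))) ->
  test_function setT phi ->
  rho * int3 Om (fun x => dot (u x) (grad (partial i phi) x)) =
  - int3 setT (fun x => wderiv setT i S x * laplacian phi x).
Proof.
move=> oOm Lu HS H tphi; have mOm := mbl_open oOm; have mT := @mblT R.
have ti := test_function_partial i tphi.
have Cti : Ck 1 (partial i phi) := test_function_Ck 1 ti.
have tki k := test_function_partial k ti.
have Hti : Hk setT 1 (partial i phi).
  exact: (Hk_C1 openT Cti (test_function_L2 ti) (fun k => test_function_L2 (tki k))).
have LS k : L2 setT (wderiv setT k S) by have [_ /(_ k) []] := HS.
have cki k : continuous (partial k (partial i phi)) := test_function_continuous (tki k).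
have E1 : int3 setT (fun x => dot (wgrad setT S x) (wgrad setT (partial i phi) x)) =
    \sum_k int3 setT (fun x => wderiv setT k S x * partial k (partial i phi) x).
  have ii k : integ setT (fun x => wderiv setT k S x * partial k (partial i phi) x).
    exact: (L2_mul mT (LS k) (test_function_L2 (tki k))).
  rewrite -(int3_sum _ mT ii); apply: (ae_eq_int3 mT).
  - rewrite /measurable_on /dot; apply: measurable_sum => k; apply: measurable_funM.
      by under eq_fun do rewrite mxE; exact: wderiv_measurable.
    by under eq_fun do rewrite mxE; exact: wderiv_measurable.
  - rewrite /measurable_on; apply: measurable_sum => k; apply: measurable_funM.
      exact: wderiv_measurable.
    exact: (L2_measurable (test_function_L2 (tki k))).
  - have : ae_on setT (fun x => forall k, wderiv setT k (partial i phi) x = partial k (partial i phi) x).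
      have : {ae @leb3 R, forall p, forall k, setT (vec3 p) ->
          wderiv setT k (partial i phi) (vec3 p) = partial k (partial i phi) (vec3 p)}.
        by apply: filter_forall => k; exact: (wderiv_C1 k openT Cti).
      by rewrite /ae_on; apply: filterS => p Hp Op k; exact: Hp.
    by apply: ae_onS => x _ Hx; apply: eq_bigr => k _; rewrite !mxE Hx.
have E2 : int3 Om (fun x => rho * dot (u x) (wgrad setT (partial i phi) x)) =
    rho * int3 Om (fun x => dot (u x) (grad (partial i phi) x)).
  have iu : integ Om (fun x => dot (u x) (grad (partial i phi) x)).
    rewrite /dot; apply: integ_sum => // k; apply: L2_mul => //.
    under eq_fun do rewrite mxE; apply/L2P; have /L2P[m1 i1] := test_function_L2 (tki k).
    by split; [exact: measurable_on_sub m1|exact: integS i1].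
  rewrite -int3Z//; apply: ae_eq_int3 => //.
  - apply: measurable_onM; first exact: measurable_on_cst.
    rewrite /measurable_on /dot; apply: measurable_sum => k; apply: measurable_funM.
      exact: (L2_measurable (Lu k)).
    under eq_fun do rewrite mxE.
    exact: (measurable_on_sub mT (@subsetT _ _) (@wderiv_measurable _ setT k (partial i phi))).
  - by apply: measurable_onM; [exact: measurable_on_cst|exact: integ_measurable_on iu].
  - have : ae_on Om (fun x => forall k, wderiv setT k (partial i phi) x = partial k (partial i phi) x).
      have : {ae @leb3 R, forall p, forall k, setT (vec3 p) ->
          wderiv setT k (partial i phi) (vec3 p) = partial k (partial i phi) (vec3 p)}.
        by apply: filter_forall => k; exact: (wderiv_C1 k openT Cti).
      by rewrite /ae_on; apply: filterS => p Hp Op k; exact: Hp.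
    by apply: ae_onS => x _ Hx; congr (_ * dot _ _); apply/colP => k; rewrite !mxE Hx.
have := H _ Hti; rewrite E1 E2 => /(congr1 -%R); rewrite opprK => <-; congr (- _).
rewrite (_ : (fun x => _ * laplacian phi x) =
  (fun x => \sum_k wderiv setT i S x * partial k (partial k phi) x)); last first.
  by apply/funext => x; rewrite /laplacian mulr_sumr.
have ii k : integ setT (fun x => wderiv setT i S x * partial k (partial k phi) x).
  apply: (L2_mul mT (LS i)); apply: test_function_L2.
  exact: (test_function_partial k (test_function_partial k tphi)).
rewrite (int3_sum _ mT ii); apply: eq_bigr => k _.
have -> : partial k (partial i phi) = partial i (partial k phi).
  by apply/funext => x; exact: (partial_comm k i x (test_function_Ck 2 tphi)).
exact: (wderiv_swap i k HS (test_function_partial k tphi)).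
Qed.

(** Truncating at distance [r] and letting [r] tend to infinity leaves only
    the part of the Laplacian that sits in the ball of measurements. *)
Lemma gravity_bound Om (s1 r0 rOm : R) (b : E) :
  0 < s1 -> 0 < r0 -> s1 <= (r0 / 2) ^+ 2 -> (forall x, Om x -> `|x| <= rOm) ->
  exists2 B, 0 <= B & forall a (rho eps : R) (u : E -> E) (T : 'I_3 -> E -> R),
    enorm (a - b) < r0 / 2 -> (forall i, L2 setT (T i)) ->
    (forall i phi, test_function setT phi ->
      rho * int3 Om (fun x => dot (u x) (grad (partial i phi) x)) =
      - int3 setT (fun x => T i x * laplacian phi x)) ->
    (forall i, Num.sqrt (int3 (eball b r0) (fun x => T i x ^+ 2)) <= eps) ->
    forall i o, `|rho * int3 Om (fun x => dot (u x)
        (grad (partial i (potential (newton s1) a o)) x))| <= B * eps.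
Proof.
move=> s0 r00 s1r HOm; have sn := smooth_newton s0; have sL := smooth_radial_laplacian sn.
have st := @smooth_tail R; have sT := smooth_radial_laplacian st.
have L0 t : s1 < t -> radial_laplacian (newton s1) t = 0 by exact: newton_harmonic.
have [A A0 HA] := potential_bounded sL (ltW s0) L0.
have T0 (t : R) : 2 < t -> radial_laplacian tail_profile t = 0 by exact: tail_laplacian_gt2.
have [B B0 HB] := potential_bounded sT (ler0n R 2) T0.
pose V := (2 * (`|b| + r0)) ^+ 3.
have br0 : 0 <= `|b| + r0 by rewrite addr_ge0// ltW.
exists (Num.sqrt (A ^+ 2 * V)); first exact: sqrtr_ge0.
move=> a rho eps u T ab LT HT HE i o.
set X := rho * _; set K := Num.sqrt _.
pose alpha := potential (radial_laplacian (newton s1)) a o.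
have ca : continuous alpha := Cinf_continuous (Cinf_potential a o sL).
have ab0 x : ~ eball b r0 x -> alpha x = 0.
  move=> nb; apply: (potential_support o sL (ltW s0) L0).
  rewrite -enorm_sqr; apply: (le_lt_trans s1r); rewrite ltrXn2r//=.
  rewrite ?nnegrE ?enorm_ge0 ?divr_ge0 ?(ltW r00)//.
  have := enormD (x - a) (a - b); rewrite subrKA.
  have : r0 <= enorm (x - b) by rewrite leNgt; apply/negP.
  by lra.
have mT := @mblT R; have mb : mbl (eball b r0) := mbl_open (@open_eball _ b r0).
have a0 x : `|b| + r0 <= `|x| -> alpha x = 0.
  move=> xr; apply: ab0 => /= xb.
  have := ler_normB (x - b) (- b); rewrite opprK subrK normrN.
  by have := cv_norm_enorm (x - b); rewrite /eball/= in xb; lra.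
have La : L2 setT alpha.
  by apply: (@L2_continuous _ _ _ (`|b| + r0)) => // x _; exact: a0.
have sub (f : E -> R) : L2 setT f -> L2 (eball b r0) f.
  move=> /L2P[m1 i1]; apply/L2P; split; last exact: integS i1.
  exact: measurable_on_sub m1.
have near_part : `|int3 setT (fun x => T i x * alpha x)| <= K * eps.
  rewrite (int3_setT_sub mb); last 2 first.
  - by apply: measurable_onM; exact: L2_measurable.
  - by move=> x /ab0 ->; rewrite mulr0.
  apply: le_trans (L2_cauchy_schwarz mb (sub _ (LT i)) (sub _ La)) _.
  rewrite mulrC; apply: ler_pM; rewrite ?sqrtr_ge0//; apply: ler_wsqrtr.
  rewrite -(int3_setT_sub mb); last 2 first.
  - by apply: measurable_onM; exact: L2_measurable.
  - by move=> x /ab0 ->; rewrite expr0n.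
  by apply: int3_sqr_le => // x; exact: HA.
(* the remainder lives in a cube of side [8 r] and is at most [B / r^3], so its
   square has integral at most [512 B^2 / r^3 <= (23 B / r)^2] *)
pose c := Num.sqrt (int3 setT (fun x => T i x ^+ 2)) * (23 * B).
have c0 : 0 <= c by rewrite mulr_ge0 ?sqrtr_ge0// mulr_ge0.
have main (r : R) : 1 <= r -> s1 <= r -> `|a| <= r -> 2 * (rOm + `|a|) < r ->
    `|X| <= K * eps + c / r.
  move=> r1 sr ar Or; have rp : 0 < r := lt_le_trans ltr01 r1.
  have rr : r <= r ^+ 2 by rewrite expr2 ler_peMl// ltW.
  have sc := smooth_newton_cut r s0.
  have tf := test_function_cut a o s0 rp (le_trans sr rr).
  have GE x : Om x -> grad (partial i (potential (newton s1) a o)) x =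
      grad (partial i (potential (newton_cut s1 r) a o)) x.
    move=> Ox; apply/colP => k; rewrite [LHS]mxE [RHS]mxE.
    have Ux : eball a r x.
      rewrite /eball/=; apply: le_lt_trans Or; apply: enorm_le_coord => k'.
      apply: le_trans (cv_coord_le _ _) _; apply: le_trans (ler_normB _ _) _.
      by rewrite lerD2r; exact: HOm.
    have E0 y : eball a r y -> radial (newton s1) a y = radial (newton_cut s1 r) a y.
      rewrite /eball/= => yr; rewrite /radial newton_cut_in// -enorm_sqr.
      by rewrite ltrXn2r// ?nnegrE ?enorm_ge0// ltW.
    have E1 y := potential_open o (@open_eball _ a r) E0 (x := y).
    have E2 y := partial_open i (@open_eball _ a r) E1 (x := y).
    exact: (partial_open k (@open_eball _ a r) E2 Ux).
  rewrite /X (int3_eq (fun x Ox => congr1 (dot (u x)) (GE x Ox))).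
  rewrite (HT i _ tf) normrN.
  pose beta x := laplacian (potential (newton_cut s1 r) a o) x - alpha x.
  have cb : continuous beta.
    apply: (@CkB _ _ 0); last exact: ca.
    exact: (Cinf_continuous (Cinf_laplacian (Cinf_potential a o sc))).
  have bE x : beta x = r^-1 ^+ 3 * (if o is Some j then r^-1 else 1)
      * potential (radial_laplacian tail_profile) 0 o (r^-1 *: (x - a)).
    by rewrite /beta laplacian_newton_cut// addrC addKr.
  have ri1 : 0 <= r^-1 <= 1 by rewrite invr_ge0 (ltW rp)/= invf_le1.
  have bB x : `|beta x| <= r^-1 ^+ 3 * B.
    have /andP[ri0 ri1'] := ri1.
    rewrite bE normrM; apply: ler_pM => //.
    rewrite normrM (ger0_norm (exprn_ge0 3 ri0)) -[leRHS]mulr1 ler_wpM2l ?exprn_ge0//.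
    by case: (o) => [_|]; rewrite ger0_norm.
  have b0 x : 4 * r <= `|x| -> beta x = 0.
    move=> xr; rewrite bE (potential_support o sT (ler0n R 2) T0) ?mulr0// subr0.
    rewrite -enorm_sqr enormZ ger0_norm ?invr_ge0 ?(ltW rp)//.
    have h : 3 <= r^-1 * enorm (x - a).
      rewrite mulrC ler_pdivlMr//; have := cv_norm_enorm (x - a).
      by have := ler_normB (x - a) (- a); rewrite opprK subrK normrN; lra.
    by have : 3 ^+ 2 <= (r^-1 * enorm (x - a)) ^+ 2; [rewrite lerXn2r ?nnegrE//; lra|lra].
  have Lb : L2 setT beta.
    by apply: (@L2_continuous _ _ _ (4 * r)) => // x _; exact: b0.
  rewrite (_ : (fun x => _) = (fun x => T i x * alpha x + T i x * beta x)); last first.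
    by apply/funext => x; rewrite /beta -mulrDr addrC subrK.
  rewrite (int3D mT); [|exact: L2_mul..].
  apply: le_trans (ler_normD _ _) _; apply: lerD; first exact: near_part.
  apply: le_trans (L2_cauchy_schwarz mT (LT i) Lb) _.
  rewrite /c -mulrA ler_wpM2l ?sqrtr_ge0//.
  have q0 : 0 <= 23 * B / r by rewrite !mulr_ge0// invr_ge0 ltW.
  rewrite -[leRHS]ger0_norm// -sqrtr_sqr ler_wsqrtr//.
  apply: le_trans (int3_sqr_le (ltW (_ : 0 < 4 * r)) cb bB b0) _; first by rewrite mulr_gt0.
  rewrite (_ : (r^-1 ^+ 3 * B) ^+ 2 * (2 * (4 * r)) ^+ 3 = 512 * B ^+ 2 / r ^+ 2 * r^-1); last first.
    by field; rewrite gt_eqF.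
  rewrite (_ : (23 * B / r) ^+ 2 = 529 * B ^+ 2 / r ^+ 2); last by field; rewrite gt_eqF.
  have p0 : 0 <= B ^+ 2 / r ^+ 2 by rewrite divr_ge0 ?sqr_ge0.
  rewrite -[512 * _ / _]mulrA -[529 * _ / _]mulrA; case/andP: ri1 => ri0 ri1.
  by move: p0 ri0 ri1; move: (B ^+ 2 / r ^+ 2) (r^-1) => p q; nra.
apply/ler_addgt0Pl => e e0; rewrite addrC.
pose r := 1 + s1 + `|a| + 2 * `|rOm + `|a| | + c / e.
have ce : 0 <= c / e by rewrite divr_ge0// ltW.
have n1 := normr_ge0 a; have n2 := normr_ge0 (rOm + `|a|); have n3 := ler_norm (rOm + `|a|).
have r1 : 1 <= r by rewrite /r; lra.
have rp : 0 < r := lt_le_trans ltr01 r1.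
apply: le_trans (main r r1 _ _ _) _; try by rewrite /r; lra.
rewrite lerD2l ler_pdivrMr//; rewrite -ler_pdivrMl// mulrC /r; lra.
Qed.

End Gravity.

(** * Conclusion *)

Section Conclusion.
Context {R : realType}.
Local Notation E := 'cV[R]_3.
Implicit Types (U Om : set E) (f g : E -> R) (x a P v : E) (i j k l : 'I_3) (o : option 'I_3)
  (M : 'M[R]_3).

Lemma finite_bound (I : finType) (Q : I -> R -> Prop) :
  (forall (c : I) (B B' : R), Q c B -> B <= B' -> Q c B') ->
  (forall c : I, exists2 B, 0 <= B & Q c B) -> exists2 B, 0 <= B & forall c : I, Q c B.
Proof.
move=> mono H.
have [B HB] : {B : I -> R & forall c : I, 0 <= B c /\ Q c (B c)}.
  by apply: (@choice _ _ (fun (c : I) (B : R) => 0 <= B /\ Q c B)) => c; have [B] := H c; exists B.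
exists (\sum_(c : I) B c); first by apply: sumr_ge0 => c _; case: (HB c).
move=> c; case: (HB c) => _ /mono; apply.
rewrite (bigD1 c)//= lerDl; apply: sumr_ge0 => e _; by case: (HB e).
Qed.

(** On a segment from [P] to a point outside [U], the first point outside [U] lies
    on the frontier, hence at distance at least [d] from [P]. *)
Lemma ball_inner_domain U P (d : R) : open U -> inner_domain U d P -> eball P d `<=` U.
Proof.
move=> oU [UP dP] x Px; apply: contrapT => nUx.
pose c (t : R) : E := P + t *: (x - P).
have cc : continuous c.
  move=> t; apply: (@cvgD _ _ _ (nbhs t) _ (cst P) (fun t : R => t *: (x - P))); first exact: cvg_cst.
  exact: (@cvgZr_tmp R E _ (nbhs t) _ id).
pose A : set R := [set t | 0 <= t <= 1 /\ ~ U (c t)].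
have A1 : A 1 by split; [rewrite ler01 lexx|rewrite /c scale1r addrC subrK].
have lA : has_lbound A by exists 0 => t [/andP[]].
have hA : has_inf A by split; [exists 1|].
pose s := inf A.
have s0 : 0 <= s by apply: lb_le_inf; [exists 1|move=> t [/andP[]]].
have s1 : s <= 1 by exact: ge_inf.
have near_c (V : set E) : nbhs (c s) V -> exists2 e : R, 0 < e & forall t, `|t - s| < e -> V (c t).
  move=> /(cc s)/nbhs_ballP[e e0 He]; exists e => // t ts; apply: He.
  by rewrite /ball/= distrC.
have nUs : ~ U (c s).
  move=> Us; have [e e0 He] := near_c U (open_nbhs_nbhs (conj oU Us)).
  have [t At ts] := inf_adherent e0 hA.
  have st : s <= t by exact: ge_inf.
  case: At => _; apply; apply: He; rewrite ger0_norm ?subr_ge0//.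
  by rewrite ltrBlDl.
have spos : 0 < s.
  rewrite lt_neqAle s0 andbT; apply/eqP => E0; apply: nUs.
  by rewrite -E0 /c scale0r addr0.
have Fs : frontier U (c s).
  split; last by move=> /interior_subset.
  move=> V /near_c[e e0 He].
  pose t := Num.max (s - e / 2) 0.
  have t0 : 0 <= t by rewrite le_max lexx orbT.
  have ts : t < s by rewrite gt_max spos andbT ltrBlDr ltrDl divr_gt0.
  exists (c t); split.
    apply: contrapT => nt; have : A t by split => //; rewrite t0 (le_trans (ltW ts)).
    by move=> /(ge_inf lA); rewrite leNgt ts.
  apply: He; rewrite distrC ger0_norm ?subr_ge0 ?(ltW ts)//.
  have : s - e / 2 <= t by rewrite le_max lexx.
  by lra.
have : euclid_dist P (frontier U) <= enorm (P - c s).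
  by apply: ge_inf; [exists 0 => _ [y _ <-]; exact: enorm_ge0|exists (c s)].
rewrite enorm_sub /c addrC addKr enormZ ger0_norm// => h.
have : s * enorm (x - P) <= enorm (x - P) by rewrite ler_piMl ?enorm_ge0.
by have : enorm (x - P) < d by []; lra.
Qed.

Lemma L2_bounded_domain U f (r : R) : mbl U -> (forall x, U x -> `|x| <= r) -> continuous f -> L2 U f.
Proof.
move=> mU Ur cf; apply: (@L2_continuous _ _ _ (r + 1)) => // x /Ur xr rx.
by have := le_trans rx xr; rewrite gerDl ler10.
Qed.

Lemma int3_bounded_le U f (r c : R) : mbl U -> (forall x, U x -> `|x| <= r) -> integ U f ->
  (forall x, U x -> f x <= c) -> int3 U f <= c * int3 U (fun=> 1).
Proof.
move=> mU Ur fi fc.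
have i1 (e : R) : integ U (fun=> e).
  apply: (@integ_bounded _ _ _ `|e| (r + 1)) => //; first exact: measurable_on_cst.
  by move=> x /Ur xr rx; have := le_trans rx xr; rewrite gerDl ler10.
rewrite -int3Z//; apply: int3_le => //; last by move=> x /fc; rewrite mulr1.
Qed.

(** ** The source *)

Section Source.
Variables (q : R -> R) (d : R).
Hypotheses (Cq : Ck 2 (fun x : E => q (enorm x))) (q0 : forall t, d <= t -> q t = 0).
Let Q (x : E) := q (enorm x).

Lemma open_outside P : open [set x : E | d < enorm (x - P)].
Proof.
have cN : continuous (fun x : E => enorm (x - P)).
  move=> x; apply: (@continuous_comp _ _ _ (fun x : E => dot (x - P) (x - P)) (@Num.sqrt R)).
    exact: (Ck_continuous (Ck_sqdist 0 P)).
  exact: sqrt_continuous.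
rewrite (_ : [set x : E | _] = (fun x : E => enorm (x - P)) @^-1` `]d, +oo[%classic).
  by apply: open_comp => [x _|]; [exact: cN|exact: interval_open].
by apply/seteqP; split => x /=; rewrite in_itv /= andbT.
Qed.

Lemma moment_sourceE M P x i :
  moment_source q M P x i 0 = - \sum_l M i l * partial l Q (x - P).
Proof.
rewrite /moment_source mxE mxE; congr (- _); apply: eq_bigr => l _.
by rewrite mxE [X in _ * X = _](partial_shift Q P).
Qed.

Lemma moment_source_Ck1 M P i : Ck 1 (fun x => moment_source q M P x i 0).
Proof.
rewrite (_ : (fun x => _) = (fun x => - \sum_l M i l * partial l Q (x - P))).
  apply: CkN; apply: Ck_sum => l _; apply: CkZ.
  exact: (Ck_shift P (Ck_partial l Cq)).
by apply/funext => x; exact: moment_sourceE.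
Qed.

Lemma moment_source_eq0 M P x : d < enorm (x - P) -> moment_source q M P x = 0.
Proof.
move=> xP; apply/colP => i; rewrite moment_sourceE mxE big1 ?oppr0// => l _.
rewrite -(partial_shift Q P) (@partial_open0 R _ _ l x (@open_outside P)) ?mulr0//.
by move=> y /= /ltW; exact: q0.
Qed.

Lemma partial_source_bounds : exists2 B, 0 <= B &
  forall k l x, `|partial l Q x| <= B /\ `|partial k (partial l Q) x| <= B.
Proof.
have v0 : vanishing d Q by move=> x dx; apply: q0; apply: le_trans dx (cv_norm_enorm _).
have [B B0 HB] : exists2 B, 0 <= B & forall kl : 'I_3 * 'I_3, forall x,
    `|partial kl.2 Q x| <= B /\ `|partial kl.1 (partial kl.2 Q) x| <= B.
  apply: finite_bound => [[k l] B B' H BB' x|[k l]].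
    by have [h1 h2] := H x; split; [exact: le_trans h1 BB'|exact: le_trans h2 BB'].
  have C1 : Ck 1 (partial l Q) := Ck_partial l Cq.
  have [B1 B10 H1] := continuous_bounded_on (d + 1) (Ck_continuous C1).
  have [B2 B20 H2] := continuous_bounded_on (d + 1 + 1) (Ck_continuous (Ck_partial k C1)).
  exists (B1 + B2); first exact: addr_ge0.
  have v1 := partial_vanishing l v0; have v2 := partial_vanishing k v1.
  move=> x /=; split.
    apply: (@le_trans _ _ B1); last by rewrite lerDl.
    by have [rx|/ltW/H1//] := leP (d + 1) `|x|; rewrite v1// normr0.
  apply: (@le_trans _ _ B2); last by rewrite lerDr.
  by have [rx|/ltW/H2//] := leP (d + 1 + 1) `|x|; rewrite v2// normr0.
by exists B => // k l x; exact: (HB (k, l)).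
Qed.

(** The source is built from first derivatives of the profile; moving its position
    costs second derivatives, which are bounded. *)
Lemma moment_source_lipschitz (M0 : R) : 0 <= M0 ->
  exists2 K, 0 <= K & forall M1 M2 P1 P2 x i, fnorm M2 <= M0 ->
   `|(moment_source q M1 P1 x - moment_source q M2 P2 x) i 0| <=
   K * (enorm (P1 - P2) + fnorm (M1 - M2)).
Proof.
move=> M00; have [B B0 HB] := partial_source_bounds.
exists (3 * B + 9 * M0 * B); first by rewrite addr_ge0// !mulr_ge0.
move=> M1 M2 P1 P2 x i M2l.
have lip l : `|partial l Q (x - P1) - partial l Q (x - P2)| <= 3 * enorm (P1 - P2) * B.
  have [t _ Ht] : exists2 t : R, 0 <= t <= 1 &
      partial l Q ((x - P1) + (P1 - P2)) - partial l Q (x - P1) =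
      \sum_k (P1 - P2) k 0 * partial k (partial l Q) (x - P1 + t *: (P1 - P2)).
    apply: (is_derive_line_MVT (df := fun t =>
      \sum_k (P1 - P2) k 0 * partial k (partial l Q) (x - P1 + t *: (P1 - P2)))) => t.
    exact: (C1_is_derive _ _ (Ck_partial l Cq)).
  rewrite distrC; move: Ht; rewrite subrKA => ->.
  apply: sum_le_mul => k; first exact: coord_le_enorm.
  by have [] := HB k l (x - P1 + t *: (P1 - P2)).
have -> : (moment_source q M1 P1 x - moment_source q M2 P2 x) i 0 =
    - (\sum_l M1 i l * partial l Q (x - P1)) + \sum_l M2 i l * partial l Q (x - P2).
  have subE (v w : E) (r s : R) : v i 0 = r -> w i 0 = - s -> (v - w) i 0 = r + s.
    by move=> vr ws; rewrite !mxE vr ws opprK.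
  exact: subE (moment_sourceE M1 P1 x i) (moment_sourceE M2 P2 x i).
rewrite (_ : _ + _ = - (\sum_l (M1 - M2) i l * partial l Q (x - P1)
    + \sum_l M2 i l * (partial l Q (x - P1) - partial l Q (x - P2)))); last first.
  rewrite opprD -!sumrN -!big_split; apply: eq_bigr => l _; rewrite !mxE /=; ring.
rewrite normrN; apply: le_trans (ler_normD _ _) _.
have h1 : `|\sum_l (M1 - M2) i l * partial l Q (x - P1)| <= 3 * fnorm (M1 - M2) * B.
  apply: sum_le_mul => l; first exact: coord_le_fnorm.
  by have [] := HB l l (x - P1).
have h2 : `|\sum_l M2 i l * (partial l Q (x - P1) - partial l Q (x - P2))| <=
    3 * M0 * (3 * enorm (P1 - P2) * B).
  apply: sum_le_mul => l; first exact: le_trans (coord_le_fnorm _ _ _) M2l.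
  exact: lip.
apply: le_trans (lerD h1 h2) _.
have e1 := mulr_ge0 B0 (enorm_ge0 (P1 - P2)).
have e2 := mulr_ge0 (mulr_ge0 M00 B0) (fnorm_ge0 (M1 - M2)).
rewrite -subr_ge0 (_ : _ - _ = 3 * (B * enorm (P1 - P2)) + 9 * (M0 * B * fnorm (M1 - M2))); last by ring.
by rewrite addr_ge0// mulr_ge0.
Qed.

End Source.

Lemma partial2_shift f g a k l x : f = (fun y => g (y - a)) ->
  partial l (partial k f) x = partial l (partial k g) (x - a).
Proof.
move=> ->; have E1 : partial k (fun y => g (y - a)) = fun y => partial k g (y - a).
  by apply/funext => y; exact: partial_shift.
exact: (etrans (congr1 (fun h => partial l h x) E1) (partial_shift (partial k g) a l x)).
Qed.

(** ** Test potentials on the domain *)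

Section Domain.
Variables (Om : set E) (b : E) (r0 rOm : R).
Hypotheses (oOm : open Om) (r00 : 0 < r0) (HOm : forall x, Om x -> `|x| <= rOm).
Hypothesis far : forall x, Om x -> r0 <= enorm (x - b).
Let mOm : mbl Om := mbl_open oOm.
(* the smoothing stays within [r0 / 4] of the pole, hence away from [Om] *)
Let s1 : R := (r0 / 4) ^+ 2.

Let s10 : 0 < s1. Proof. by rewrite exprn_gt0// divr_gt0. Qed.

Definition test_potential a (o : option 'I_3) i : E -> R := partial i (potential (newton s1) a o).

Lemma Cinf_test_potential a o i : Cinf (test_potential a o i).
Proof. exact: (Cinf_partial i (Cinf_potential a o (smooth_newton s10))). Qed.

Lemma pole_distance a x : enorm (a - b) < r0 / 2 -> Om x -> r0 / 2 <= enorm (x - a).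
Proof.
by move=> ab /far; have := enormD (x - a) (a - b); rewrite subrKA; lra.
Qed.

Lemma pole_sqdist a x : enorm (a - b) < r0 / 2 -> Om x -> s1 < dot (x - a) (x - a).
Proof.
move=> ab /(pole_distance ab) xa; rewrite -enorm_sqr /s1 ltrXn2r// ?nnegrE ?enorm_ge0//.
  by rewrite divr_ge0// ltW.
by have r0p := r00; apply: lt_le_trans xa; lra.
Qed.

Lemma pole_norm a : enorm (a - b) < r0 / 2 -> `|a| <= `|b| + r0.
Proof.
move=> ab; have := ler_normB (a - b) (- b); rewrite opprK subrK normrN.
by have r0p := r00; have := cv_norm_enorm (a - b); lra.
Qed.

Lemma test_potential_harmonic a o i x : enorm (a - b) < r0 / 2 -> Om x ->
  laplacian (test_potential a o i) x = 0.
Proof.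
move=> ab Ox; have sn := smooth_newton s10.
have L0 y : Om y -> laplacian (potential (newton s1) a o) y = 0.
  move=> Oy; rewrite laplacian_potential//.
  apply: (potential_support o (smooth_radial_laplacian sn) (ltW s10)).
    by move=> t; exact: newton_harmonic.
  exact: pole_sqdist.
exact: (laplacian_open0 i oOm (Cinf_potential a o sn) L0 Ox).
Qed.

Lemma grad_vfield f : Cinf f -> vfield Om (grad f).
Proof.
move=> Cf i; rewrite (_ : (fun x => _) = partial i f); last by apply/funext => x; rewrite mxE.
exact: (L2_bounded_domain mOm HOm (Cinf_continuous (Cinf_partial i Cf))).
Qed.

Lemma jacobian_grad f x i j : jacobian (grad f) x i j = partial j (partial i f) x.
Proof.
rewrite mxE (_ : (fun y => _) = partial i f)//.
by apply/funext => y; rewrite mxE.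
Qed.

Lemma jacobian_mfield f : Cinf f -> mfield Om (jacobian (grad f)).
Proof.
move=> Cf [i j] /=; rewrite (_ : (fun x => _) = partial j (partial i f)); last first.
  by apply/funext => x; exact: jacobian_grad.
exact: (L2_bounded_domain mOm HOm (Cinf_continuous (Cinf_partial j (Cinf_partial i Cf)))).
Qed.

(** The bound is uniform in the pole, as the potentials are translates. *)
Lemma jacobian_bound : exists2 K, 0 <= K & forall a o i, enorm (a - b) < r0 / 2 ->
  nrm (mip Om) (jacobian (grad (test_potential a o i))) <= K.
Proof.
have sn := smooth_newton s10.
have [B B0 HB] : exists2 B, 0 <= B & forall c : option 'I_3 * ('I_3 * ('I_3 * 'I_3)),
    forall z : E, `|z| <= rOm + (`|b| + r0) ->
    `|partial c.2.2.2 (partial c.2.2.1 (test_potential 0 c.1 c.2.1)) z| <= B.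
  apply: finite_bound => [c B B' H BB' z zr | ]; first exact: le_trans (H z zr) BB'.
  case=> o [i [k l]].
  have C3 := Cinf_partial l (Cinf_partial k (Cinf_test_potential 0 o i)).
  by have [B B0 HB] := continuous_bounded_on (rOm + (`|b| + r0)) (Cinf_continuous C3); exists B.
exists (Num.sqrt (9 * B ^+ 2 * int3 Om (fun=> 1))); first exact: sqrtr_ge0.
move=> a o i ab; apply: ler_wsqrtr.
have LJ := jacobian_mfield (Cinf_test_potential a o i).
apply: (int3_bounded_le mOm HOm); first exact: m_integ.
move=> x Ox; rewrite mdotE.
have xa : `|x - a| <= rOm + (`|b| + r0).
  by apply: le_trans (ler_normB _ _) _; apply: lerD; [exact: HOm|exact: pole_norm].
have shift k l : partial l (partial k (test_potential a o i)) x =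
    partial l (partial k (test_potential 0 o i)) (x - a).
  have E0 : potential (newton s1) a o = fun y => potential (newton s1) 0 o (y - a).
    by apply/funext => y; exact: potential_shift.
  have E1 : test_potential a o i = fun y => test_potential 0 o i (y - a).
    by apply/funext => y; rewrite /test_potential E0 partial_shift.
  exact: partial2_shift E1.
apply: (@le_trans _ _ (\sum_(k < 3) \sum_(l < 3) B ^+ 2)).
  apply: ler_sum => k _; apply: ler_sum => l _; rewrite jacobian_grad shift -expr2.
  rewrite -real_normK ?num_real// lerXn2r ?nnegrE//.
  exact: (HB (o, (i, (k, l)))).
by rewrite !sum_I3; lra.
Qed.

Lemma vfield_bounded_nrm (F : E -> E) (K : R) : vfield Om F -> 0 <= K ->
  (forall x i, `|F x i 0| <= K) -> nrm (vip Om) F <= Num.sqrt (3 * int3 Om (fun=> 1)) * K.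
Proof.
move=> LF K0 FK; have V0 : 0 <= int3 Om (fun=> 1 : R) by exact: int3_ge0.
rewrite -[K in _ * K]ger0_norm// -sqrtr_sqr -sqrtrM ?mulr_ge0//; apply: ler_wsqrtr.
rewrite mulrAC; apply: (int3_bounded_le mOm HOm); first exact: v_integ.
move=> x _; rewrite /dot (_ : 3 * K ^+ 2 = \sum_(i < 3) K ^+ 2); last first.
  by rewrite sumr_const card_ord mulr_natl.
apply: ler_sum => i _; rewrite -expr2 -real_normK ?num_real// lerXn2r ?nnegrE//.
Qed.

(** ** The measurement bounds the moments of the displacement *)

(** The identity of [gravity_identity] is linear in the displacement and the
    potential, so it holds for the differences of two solutions. *)
Lemma measurement_bound (lambda mu rho : R) : exists2 B, 0 <= B &
  forall a (eps t : R) (f1 f2 : E -> E) (u1 u2 : R -> E -> E) (S1 S2 : R -> E -> R),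
    enorm (a - b) < r0 / 2 -> 0 <= t ->
    elasto_gravitational_solution Om lambda mu rho f1 u1 S1 ->
    elasto_gravitational_solution Om lambda mu rho f2 u2 S2 ->
    L2norm (eball b r0) (fun x => wgrad setT (S1 t) x - wgrad setT (S2 t) x) <= eps ->
    forall o i, `|rho * vip Om (u1 t - u2 t) (grad (test_potential a o i))| <= B * eps.
Proof.
have r0p := r00.
have s1r : s1 <= (r0 / 2) ^+ 2 by rewrite lerXn2r ?nnegrE ?divr_ge0 ?(ltW r00)//; lra.
have [B B0 HB] := gravity_bound b s10 r00 s1r HOm.
exists B => // a eps t f1 f2 u1 u2 S1 S2 ab t0 [e1 g1] [e2 g2] Heps o i.
have [H1 W1] := g1 t t0; have [H2 W2] := g2 t t0.
have V (u : R -> E -> E) (f : E -> E) : elastic_solution Om lambda mu rho f u -> vfield Om (u t).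
  by case=> ut [utt [[/(_ t t0)[h _] _ _] _ _ _ _]]; exact: HkV_vfield h.
have L1 := V _ _ e1; have L2' := V _ _ e2.
have mT := @mblT R.
have LT (S : R -> E -> R) k : Hk setT 1 (S t) -> L2 setT (wderiv setT k (S t)).
  by case=> _ /(_ k) [].
pose T k x := wderiv setT k (S1 t) x - wderiv setT k (S2 t) x.
have LTk k : L2 setT (T k) by apply: L2B => //; exact: LT.
apply: (HB a rho eps (u1 t - u2 t) T ab LTk _ _ i o).
- move=> k phi tphi; have tk := test_function_partial k tphi.
  have I1 := gravity_identity k oOm L1 H1 W1 tphi.
  have I2 := gravity_identity k oOm L2' H2 W2 tphi.
  have Lp := test_function_L2 tphi.
  have Ll : L2 setT (laplacian phi).
    by apply: L2_sum => // l; apply: test_function_L2; do 2 apply: test_function_partial.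
  have iT (S : R -> E -> R) : Hk setT 1 (S t) -> integ setT (fun x => wderiv setT k (S t) x * laplacian phi x).
    by move=> HS; apply: (L2_mul mT (LT _ k HS) Ll).
  rewrite (_ : (fun x => T k x * _) = (fun x => wderiv setT k (S1 t) x * laplacian phi x
      - wderiv setT k (S2 t) x * laplacian phi x)); last by apply/funext => x; rewrite mulrBl.
  have LG : vfield Om (grad (partial k phi)).
    by apply: grad_vfield => n; exact: (test_function_Ck n tk).
  have iG (u : E -> E) : vfield Om u -> integ Om (fun x => dot (u x) (grad (partial k phi) x)).
    by move=> Lu; exact: (v_integ oOm Lu LG).
  have EL : int3 Om (fun x => dot ((u1 t - u2 t) x) (grad (partial k phi) x)) =
      int3 Om (fun x => dot (u1 t x) (grad (partial k phi) x)) -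
      int3 Om (fun x => dot (u2 t x) (grad (partial k phi) x)).
    rewrite -(int3B mOm (iG _ L1) (iG _ L2')); congr (int3 Om _).
    by apply/funext => x; exact: dotBl.
  by rewrite EL mulrBr I1 I2 (int3B mT (iT _ H1) (iT _ H2)) [RHS]opprD.
- move=> k; apply: le_trans Heps; apply: ler_wsqrtr.
  have mb : mbl (eball b r0) := mbl_open (@open_eball _ b r0).
  have sub (f : E -> R) : L2 setT f -> L2 (eball b r0) f.
    move=> /L2P[m1 i1]; apply/L2P; split; last exact: integS i1.
    exact: measurable_on_sub m1.
  have EE x : enorm (wgrad setT (S1 t) x - wgrad setT (S2 t) x) ^+ 2 = \sum_l T l x ^+ 2.
    by rewrite enorm_sqr /dot; apply: eq_bigr => l _; rewrite !mxE expr2.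
  apply: int3_le => //; first exact: L2_sqr (sub _ (LTk k)).
    rewrite (_ : (fun x => _) = (fun x => \sum_l T l x ^+ 2)); last exact/funext.
    by apply: integ_sum => // l; exact: L2_sqr (sub _ (LTk l)).
  move=> x _; rewrite EE (bigD1 k)//= lerDl; apply: sumr_ge0 => l _; exact: sqr_ge0.
Qed.

End Domain.

(** Against the gradient of a potential that is harmonic in the domain, the
    smeared source acts as a point source. *)
Lemma source_moment Om (q : R -> R) (d0 rOm : R) M P (psi : E -> R) : open Om -> 0 < d0 ->
  (forall x, Om x -> `|x| <= rOm) ->
  Ck 2 (fun x : E => q (enorm x)) -> (forall t, 3 / 4 * d0 <= t -> q t = 0) ->
  int3 setT (fun x : E => q (enorm x)) = 1 -> inner_domain Om d0 P ->
  Cinf psi -> (forall x, Om x -> laplacian psi x = 0) ->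
  vfield Om (moment_source q M P) /\
  vip Om (moment_source q M P) (grad psi) = contract M psi P.
Proof.
move=> oOm d00 HOm Cq q0 q1 inP Cpsi L0; have mOm := mbl_open oOm.
have BO := ball_inner_domain oOm inP.
have cf i : continuous (fun x => moment_source q M P x i 0) := Ck_continuous (moment_source_Ck1 Cq M P i).
split; first by move=> i; exact: (L2_bounded_domain mOm HOm (cf i)).
have dd : 0 < 3 / 4 * d0 < d0 by lra.
have LB x : enorm (x - P) < d0 -> laplacian psi x = 0 by move=> xP; apply: L0; exact: BO.
rewrite -(source_pairing M dd (Ck_le Cq) q0 q1 Cpsi LB); apply: esym; apply: int3_setT_sub => //.
  apply: continuous_measurable_on; first exact: mblT.
  apply: (@Ck_sum _ _ 0) => i _; apply: (@CkM _ _ 0); first exact: cf.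
  rewrite (_ : (fun x => grad psi x i 0) = partial i psi); last by apply/funext => x; rewrite mxE.
  exact: (Cinf_continuous (Cinf_partial i Cpsi)).
move=> x nOx; rewrite (@moment_source_eq0 q (3 / 4 * d0)) ?dot0l//.
have : d0 <= enorm (x - P) by rewrite leNgt; apply/negP => xP; apply: nOx; exact: BO.
by lra.
Qed.

End Conclusion.


Theorem theorem3p1 (R : realType) (Om : set 'cV[R]_3)
    (lambda0 mu0 rho0 d0 m0 M0 t0 r0 : R) (xbar : 'cV[R]_3) (q : R -> R)
    (Om_neq0 : Om !=set0) (Om_open : open Om) (Om_bounded : bounded_set Om)
    (Om_convex : convex_set Om) (Om_C2 : C2_boundary Om)
    (lambda0_gt0 : 0 < lambda0) (mu0_gt0 : 0 < mu0) (rho0_gt0 : 0 < rho0)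
    (d0_gt0 : 0 < d0) (m0_gt0 : 0 < m0) (le_m0_M0 : m0 <= M0)
    (t0_gt0 : 0 < t0) (r0_gt0 : 0 < r0)
    (ball_out : eball xbar r0 `<=` ~` closure Om)
    (q_C2c : Ck_c 2 Om (fun x => q (enorm x)))
    (q_supp : closure [set r | q r != 0] `<=` `[- (d0 / 2), d0 / 2])
    (q_int : int3 setT (fun x : 'cV[R]_3 => q (enorm x)) = 1) :
  exists2 C : R, 0 < C &
    forall (M1 M2 : 'M[R]_3) (P1 P2 : 'cV[R]_3)
      (u1 u2 : R -> 'cV[R]_3 -> 'cV[R]_3) (S1 S2 : R -> 'cV[R]_3 -> R)
      (eps : R),
    admissible_moment m0 M0 M1 -> admissible_moment m0 M0 M2 ->
    inner_domain Om d0 P1 -> inner_domain Om d0 P2 ->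
    elasto_gravitational_solution Om lambda0 mu0 rho0
      (moment_source q M1 P1) u1 S1 ->
    elasto_gravitational_solution Om lambda0 mu0 rho0
      (moment_source q M2 P2) u2 S2 ->
    (forall t, 0 <= t <= t0 ->
      L2norm (eball xbar r0)
        (fun x => wgrad setT (S1 t) x - wgrad setT (S2 t) x) <= eps) ->
    enorm (P1 - P2) + fnorm (M1 - M2) <= C * eps.
Proof.
have [rOm HOm] : exists rOm : R, forall x : 'cV[R]_3, Om x -> `|x| <= rOm.
  by have [A [_ HA]] := Om_bounded; exists (A + 1) => x Ox; apply: HA Ox; rewrite ltrDl.
have mOm : mbl Om := mbl_open Om_open.
have far (x : 'cV[R]_3) : Om x -> r0 <= enorm (x - xbar).
  move=> Ox; rewrite leNgt; apply/negP => /ball_out; apply; exact: subset_closure.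
have Cq : Ck 2 (fun x : 'cV[R]_3 => q (enorm x)) by case: q_C2c.
(* a radius strictly between the support of the profile and the distance to the
   boundary, as the mean value property needs room on both sides *)
have q0 (t : R) : 3 / 4 * d0 <= t -> q t = 0.
  move=> dt; apply/eqP/negP => /negP qt.
  have /q_supp : closure [set r | q r != 0] t by exact: subset_closure.
  by rewrite /= in_itv/= => /andP[_]; lra.
have M00 : 0 < M0 := lt_le_trans m0_gt0 le_m0_M0.
have rO0 : 0 <= rOm by case: Om_neq0 => x /HOm; exact: le_trans.
pose rmax := 2 * (rOm + (`|xbar| + r0)).
have rmax0 : 0 < rmax by rewrite /rmax mulr_gt0// ltr_wpDl// ltr_wpDl.
have r20 : 0 < r0 / 2 by rewrite divr_gt0.
have [C1 C1p stab] := pole_stability r20 rmax0 r20 m0_gt0 M00.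
have [Kf Kf0 HKf] := moment_source_lipschitz Cq q0 (ltW M00).
have [KJ KJ0 HKJ] := jacobian_bound xbar Om_open r0_gt0 HOm.
have [B B0 HB] := measurement_bound xbar Om_open r0_gt0 HOm lambda0 mu0 rho0.
pose V := Num.sqrt (3 * int3 Om (fun=> 1)) * Kf.
have V0 : 0 <= V by rewrite mulr_ge0// sqrtr_ge0.
pose W := Num.sqrt (3 * lambda0 + 4 * mu0) * KJ.
have W0 : 0 <= W by rewrite mulr_ge0// sqrtr_ge0.
pose c := C1 / 3 * (W * V).
have c0 : 0 <= c by rewrite mulr_ge0// ?mulr_ge0// ltW.
pose T := Num.min (Num.min 2^-1 t0) (rho0 / (8 * (c + 1) ^+ 2)).
have c10 : 0 < c + 1 by rewrite ltr_wpDl.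
have T0 : 0 < T by rewrite !lt_min t0_gt0 invr_gt0 ltr0n divr_gt0// mulr_gt0// exprn_gt0.
have T12 : 0 < T <= 2^-1 by rewrite T0 !ge_min lexx.
have Tt0 : 0 <= T <= t0 by rewrite (ltW T0) !ge_min lexx orbT.
(* [T] is so short that the elastic error is absorbed by the left-hand side *)
have sT : c * Num.sqrt (2 * T / rho0) <= 2^-1.
  have -> : 2^-1 = (c + 1) * Num.sqrt ((2 * (c + 1))^-1 ^+ 2).
    rewrite sqrtr_sqr ger0_norm ?invr_ge0 ?mulr_ge0 ?(ltW c10)//.
    by field; rewrite gt_eqF.
  apply: ler_pM; rewrite ?sqrtr_ge0 ?lerDl//; apply: ler_wsqrtr.
  rewrite ler_pdivrMr//.
  have : T <= rho0 / (8 * (c + 1) ^+ 2) by rewrite ge_min lexx orbT.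
  move=> /(ler_wpM2l (ler0n R 2)) /le_trans; apply.
  by rewrite le_eqVlt; apply/orP; left; apply/eqP; field; rewrite gt_eqF.
pose K := C1 / 3 * (2 / T ^+ 2 * B).
have K0 : 0 <= K.
  by rewrite mulr_ge0 ?divr_ge0 ?(ltW C1p)// mulr_ge0// divr_ge0// sqr_ge0.
exists (2 * K + 1); first by rewrite ltr_wpDl// mulr_ge0.
move=> M1 M2 P1 P2 u1 u2 S1 S2 eps [_ s1 tr1 /andP[lM1 uM1]] [_ s2 tr2 /andP[lM2 uM2]] in1 in2 sol1 sol2 Heps.
set D := enorm (P1 - P2) + fnorm (M1 - M2).
have D0 : 0 <= D by rewrite addr_ge0 ?enorm_ge0 ?fnorm_ge0.
have eps0 : 0 <= eps by apply: le_trans (Heps T Tt0); exact: sqrtr_ge0.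
pose f1 := moment_source q M1 P1; pose f2 := moment_source q M2 P2.
pose J := 2 / T ^+ 2 * (B * eps) + W * Num.sqrt (2 * T / rho0) * (V * D).
(* the difference of the fields of the two point sources, to which the measurement
   contributes the first term of [J] and the elastic error the second *)
have pairing a o i : enorm (a - xbar) < r0 / 2 ->
    `|contract M1 (test_potential r0 a o i) P1 - contract M2 (test_potential r0 a o i) P2| <= J.
  move=> ab; set psi := test_potential r0 a o i.
  have Cpsi : Cinf psi := Cinf_test_potential r0_gt0 a o i.
  have L0 := test_potential_harmonic Om_open r0_gt0 far o i ab.
  have [Lf1 <-] := source_moment M1 Om_open d0_gt0 HOm Cq q0 q_int in1 Cpsi L0.
  have [Lf2 <-] := source_moment M2 Om_open d0_gt0 HOm Cq q0 q_int in2 Cpsi L0.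
  have LG : vfield Om (grad psi) := grad_vfield Om_open HOm Cpsi.
  have LJ := jacobian_mfield Om_open HOm Cpsi.
  have CG k : Ck 1 (fun x => grad psi x k 0).
    rewrite (_ : (fun x => grad psi x k 0) = partial k psi); last by apply/funext => x; rewrite mxE.
    exact: (Cinf_partial k Cpsi 1).
  have -> : vip Om (moment_source q M1 P1) (grad psi) - vip Om (moment_source q M2 P2) (grad psi) =
      vip Om (f1 - f2) (grad psi).
    rewrite /vip /ip -(int3B mOm (v_integ Om_open Lf1 LG) (v_integ Om_open Lf2 LG)).
    by congr (int3 Om _); apply/funext => x; rewrite -dotBl.
  apply: le_trans (elastic_source_bound Om_open lambda0_gt0 mu0_gt0 rho0_gt0 Lf1 Lf2
    sol1.1 sol2.1 CG LG LJ T12) _.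
  have HM := HB a eps T f1 f2 u1 u2 S1 S2 ab (ltW T0) sol1 sol2 (Heps T Tt0) o i.
  apply: lerD; first by rewrite ler_wpM2l// divr_ge0// sqr_ge0.
  have Lf : vfield Om (f1 - f2) := vfieldB Om_open Lf1 Lf2.
  have nf : nrm (vip Om) (f1 - f2) <= V * D.
    rewrite /V -mulrA; apply: (vfield_bounded_nrm Om_open HOm Lf); first exact: mulr_ge0.
    by move=> x k; exact: (HKf M1 M2 P1 P2 x k uM2).
  apply: ler_pM nf; rewrite ?nrm_ge0// ?mulr_ge0 ?sqrtr_ge0 ?nrm_ge0//.
  by rewrite /W ler_wpM2r ?sqrtr_ge0// ler_wpM2l ?sqrtr_ge0//; exact: HKJ.
have : D <= C1 * (J / 3).
  apply: (stab M1 M2 P1 P2 xbar) => // a ab.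
  have bnd P : inner_domain Om d0 P -> r0 / 2 <= enorm (P - a) <= rmax.
    move=> [OP _]; rewrite (pole_distance far ab OP)/=.
    apply: enorm_le_coord => k; apply: le_trans (cv_coord_le _ _) _.
    apply: le_trans (ler_normB _ _) _; apply: lerD; first exact: HOm.
    exact: (pole_norm r0_gt0 ab).
  have sq P : inner_domain Om d0 P -> (r0 / 4) ^+ 2 < dot (P - a) (P - a).
    by move=> [OP _]; exact: (pole_sqdist r0_gt0 far ab OP).
  have s10 : 0 < (r0 / 4) ^+ 2 by rewrite exprn_gt0// divr_gt0.
  split; [exact: bnd|exact: bnd|move=> i|move=> i j].
    have := pairing a None i ab; rewrite /test_potential /=.
    rewrite (contract_pole1 i s10 s1 tr1 (sq _ in1)) (contract_pole1 i s10 s2 tr2 (sq _ in2)).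
    by rewrite -mulrBr normrM gtr0_norm// ler_pdivlMr// mulrC.
  have := pairing a (Some i) j ab; rewrite /test_potential /=.
  rewrite (contract_pole2 i j s10 s1 tr1 (sq _ in1)) (contract_pole2 i j s10 s2 tr2 (sq _ in2)).
  by rewrite -mulrBr normrM gtr0_norm// ler_pdivlMr// mulrC.
have -> : C1 * (J / 3) = K * eps + c * Num.sqrt (2 * T / rho0) * D.
  by rewrite /J /K /c; field; rewrite gt_eqF.
have := ler_wpM2r D0 sT; have := mulr_ge0 K0 eps0.
rewrite [(2 * K + 1) * eps]mulrDl mul1r -[2 * K * eps]mulrA.
by move: (K * eps) (c * _ * D) => x y; lra.
Qed.
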